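(* Let $n\ge2$, $0<s<1$ and $1<p\le2$. Let $f:\mathbb R\to\mathbb R$ be locally Lipschitz continuous with $f(0)\ge0$. Let $u\in W^{s,p}_0(B_1)\cap L^\infty(B_1)$ be a nontrivial nonnegative weak solution of $$\begin{cases}(-\Delta)^s_p u=f(u)&\text{in }B_1,\\ u=0&\text{in }\mathbb R^n\setminus B_1.\end{cases}$$ Then $u$ is radially symmetric with respect to the origin and radially nonincreasing in $B_1$.
   Context: $B_1\subset\mathbb R^n$ is the open unit ball centered at $0$. $W^{s,p}(\mathbb R^n)$ is the space of $u\in L^p(\mathbb R^n)$ with $\iint_{\mathbb R^n\times\mathbb R^n}\frac{|u(x)-u(y)|^p}{|x-y|^{n+sp}}\,dx\,dy<\infty$, and $W^{s,p}_0(B_1):=\{u\in W^{s,p}(\mathbb R^n):u=0\text{ a.e. in }\mathbb R^n\setminus B_1\}$. With $G(t):=|t|^{p-2}t$ (and $G(0)=0$), $$\langle(-\Delta)^s_p u,\varphi\rangle:=\frac12\iint_{\mathbb R^n\times\mathbb R^n}\frac{G(u(x)-u(y))(\varphi(x)-\varphi(y))}{|x-y|^{n+sp}}\,dx\,dy .$$ A function $u\in W^{s,p}_0(B_1)$ is a weak solution of the problem if $\langle(-\Delta)^s_p u,\varphi\rangle=\int_{B_1}f(u)\varphi\,dx$ for every $\varphi\in W^{s,p}_0(B_1)$. As usual, functions are identified when equal a.e. *)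

(* Defs.v *)
From HB Require Import structures.
From mathcomp Require Import all_boot all_order all_algebra.
From mathcomp Require Import all_classical all_reals all_analysis.
From mathcomp Require Import measurable_realfun.

Set Implicit Arguments.
Unset Strict Implicit.
Unset Printing Implicit Defensive.

Import Order.TTheory GRing.Theory Num.Theory.
Import numFieldNormedType.Exports.

Local Open Scope classical_set_scope.
Local Open Scope ring_scope.

(* R^n as a measurable space: the library's product sigma-algebra on tuples,
   i.e. the Borel sets of R^n. *)
Notation Rn R n := (n.-tuple (measurableTypeR R)).

Section lebesgue_tuple.
Context {R : realType}.

Definition cons_Rn n (z : measurableTypeR R * Rn R n) : Rn R n.+1 :=
  [tuple of z.1 :: z.2].

Lemma measurable_cons_Rn n : measurable_fun setT (@cons_Rn n).
Proof. exact: (measurable_cons measurable_fst measurable_snd). Qed.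

HB.instance Definition _ n := isMeasurableFun.Build _ _ _ _
  (@cons_Rn n) (@measurable_cons_Rn n).

Section step.
Variables (n : nat) (m : {sigma_finite_measure set (Rn R n) -> \bar R}).

Definition lebesgueS : set (Rn R n.+1) -> \bar R :=
  pushforward (@lebesgue_measure R \x m)%E (@cons_Rn n).

Let lebesgueS0 : lebesgueS set0 = 0%E.
Proof. by rewrite /lebesgueS /pushforward preimage_set0 measure0. Qed.

Let lebesgueS_ge0 A : (0 <= lebesgueS A)%E.
Proof. exact: measure_ge0. Qed.

Let lebesgueS_sigma_additive : semi_sigma_additive lebesgueS.
Proof.
exact: measure_semi_sigma_additive.
Qed.

HB.instance Definition _ := isMeasure.Build _ _ _ lebesgueS
  lebesgueS0 lebesgueS_ge0 lebesgueS_sigma_additive.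

Let lebesgueS_sigma_finite : sigma_finite setT lebesgueS.
Proof.
have /sigma_finiteP[F [FT ndF Foo]] := sigma_finiteT (@lebesgue_measure R).
have /sigma_finiteP[G [GT ndG Goo]] := sigma_finiteT m.
pose g (x : Rn R n.+1) : measurableTypeR R * Rn R n :=
  (thead x, [tuple of behead x]).
have mg : measurable_fun setT g.
  apply/measurable_fun_pairP; split; last exact: measurable_behead.
  exact: (@measurable_tnth _ _ n.+1 ord0).
have gK : cancel (@cons_Rn n) g.
  by move=> [a t]; rewrite /g /cons_Rn /= theadE; congr (_, _); exact: val_inj.
exists (fun k => g @^-1` (F k `*` G k)).
  apply/seteqP; split => // x _.
  have [i _ Fi] : (\bigcup_i F i) (g x).1 by rewrite -FT.
  have [j _ Gj] : (\bigcup_i G i) (g x).2 by rewrite -GT.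
  exists (maxn i j) => //; split.
    by apply: (subsetPset _ _ (ndF _ _ (leq_maxl i j))).
  by apply: (subsetPset _ _ (ndG _ _ (leq_maxr i j))).
move=> k; have [mF Fk] := Foo k; have [mG Gk] := Goo k; split.
  by rewrite -[X in measurable X]setTI; apply: mg => //; exact: measurableX.
rewrite /lebesgueS /pushforward -comp_preimage.
rewrite (_ : g \o _ = id); last by apply/funext => z /=; rewrite gK.
by rewrite preimage_id product_measure1E// lte_mul_pinfty// ge0_fin_numE.
Qed.

HB.instance Definition _ := Measure_isSigmaFinite.Build _ _ _ lebesgueS
  lebesgueS_sigma_finite.

End step.

(* Lebesgue measure on R^n, as an iterated product of copies of the Lebesgue
   measure on R, starting from the unit mass on the one-point space R^0. *)
Fixpoint lebesgue_Rn n : {sigma_finite_measure set (Rn R n) -> \bar R} :=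
  match n with
  | 0 => \d_([tuple] : Rn R 0)
  | n'.+1 => lebesgueS (lebesgue_Rn n')
  end.

Lemma lebesgue_Rn_box n (A : 'I_n -> set (measurableTypeR R)) :
  (forall i, measurable (A i)) ->
  lebesgue_Rn n [set x | forall i, A i (tnth x i)] =
  (\prod_(i < n) lebesgue_measure (A i))%E.
Proof.
elim: n A => [|n ih] A mA /=.
  rewrite big_ord0 (_ : [set _ | _] = setT) ?diracT//.
  by apply/seteqP; split => // x _ [].
rewrite big_ord_recl /= -ih// /lebesgueS /pushforward.
rewrite (_ : _ @^-1` _ = A ord0 `*`
    [set x | forall i, A (lift ord0 i) (tnth x i)]).
  rewrite product_measure1E//.
  rewrite (_ : [set _ | _] =
      \bigcap_(i in [set: 'I_n]) ((@tnth n _)^~ i @^-1` A (lift ord0 i))).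
    apply: fin_bigcap_measurable => // i _.
    rewrite -[X in measurable X]setTI.
    exact: measurable_tnth.
  by apply/seteqP; split => x /= xA i; [move=> _; exact: xA|exact: xA].
apply/seteqP; split => -[a t] /=.
  move=> h; split; first exact: (h ord0).
  by move=> i; have := h (lift ord0 i); rewrite tnthS.
move=> [Aa At] i; case: (unliftP ord0 i) => [j ->|->//].
by rewrite tnthS; exact: At.
Qed.

End lebesgue_tuple.

Section fractional_p_laplacian.
Context {R : realType} {n : nat}.
Implicit Types (s p : R) (u v phi : Rn R n -> R) (x y : Rn R n).

Local Notation leb := (@lebesgue_Rn R n).

Definition enorm x : R := Num.sqrt (\sum_(i < n) (tnth x i : R) ^+ 2).

Definition edist x y : R :=
  enorm [tuple ((tnth x i : R) - (tnth y i : R) : measurableTypeR R) | i < n].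

Definition unit_ball : set (Rn R n) := [set x | enorm x < 1].

Lemma measurable_enorm : measurable_fun setT enorm.
Proof.
apply: (measurableT_comp (@continuous_measurable_fun _ _ (@sqrt_continuous R))).
apply: (@measurable_sum _ _ _ _ _ _ (fun i x => (tnth x i : R) ^+ 2)) => i.
apply: measurable_funX; exact: measurable_tnth.
Qed.

Lemma measurable_unit_ball : measurable unit_ball.
Proof.
rewrite (_ : unit_ball = enorm @^-1` `]-oo, 1[%classic); last first.
  by apply/seteqP; split => x; rewrite /unit_ball /= in_itv.
rewrite -[X in measurable X]setTI; exact: measurable_enorm.
Qed.

(* On the diagonal the integrand is 0, since _ / 0 = 0. *)
Definition Wsp s p : set (Rn R n -> R) :=
  [set u | u \in Lfun leb p%:E /\
    (\int[leb \x leb]_z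
      (`|u z.1 - u z.2| `^ p / edist z.1 z.2 `^ (n%:R + s * p))%:E
     < +oo)%E].

Definition Wsp0 s p : set (Rn R n -> R) :=
  [set u | Wsp s p u /\ {ae leb, forall x, ~ unit_ball x -> u x = 0}].

Definition Linfty_ball : set (Rn R n -> R) :=
  [set u | u \in Lfun (mrestr leb measurable_unit_ball) +oo%E].

(* The last factor makes the value at t = 0 equal to 0. *)
Definition Gp p (t : R) : R := `|t| `^ (p - 2) * t.

Definition frac_plap s p u phi : \bar R :=
  ((2^-1)%:E * \int[leb \x leb]_z
    (Gp p (u z.1 - u z.2) * (phi z.1 - phi z.2)
      / edist z.1 z.2 `^ (n%:R + s * p))%:E)%E.

Definition weak_solution s p (f : R -> R) u :=
  Wsp0 s p u /\
  forall phi, Wsp0 s p phi ->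
    frac_plap s p u phi = (\int[leb]_(x in unit_ball) (f (u x) * phi x)%:E)%E.

Definition radially_symmetric v := forall x y, enorm x = enorm y -> v x = v y.

Definition radially_nonincreasing_in_ball v :=
  forall x y, unit_ball x -> unit_ball y -> enorm x <= enorm y -> v y <= v x.

End fractional_p_laplacian.

(* Main.v *)
Require Import Defs.
From HB Require Import structures.
From mathcomp Require Import all_boot all_order all_algebra.
From mathcomp Require Import all_classical all_reals all_analysis.
From mathcomp Require Import measurable_realfun.
From mathcomp Require Import ring lra.

(** The function [u] is compared with its reflections, by the method of moving planes. Fix a unit vector [nu]. For
[lam >= 0] let [Re] be the reflection in the hyperplane [dot x nu = lam], and let the excess be the positive part of
[u - u \o Re] beyond the hyperplane, extended to an odd function of the reflection. The claim is that the excess is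
zero almost everywhere for every [lam >= 0], [no_excess_all].

After a modification on a null set, [u] has values in the interval from [0] to [M] and vanishes off the unit ball, so
the excess is an admissible test function, [excess_Wsp0]. Adding the four copies of the weak form that arise by
reflecting either variable gives a nonnegative density [form_sum], whose integral is at most [4 * Cf] times the
integral of the squared excess, where [Cf] is a Lipschitz constant of [f] on the interval from [0] to [M],
[integral_form_sum]. Hence the excess is zero as soon as at each point [x] beyond the hyperplane the integral of
[form_sum] in the other variable is at least [4 * Cf + 1] times the squared excess at [x], [no_excess_criterion].

Lower bounds for [form_sum] come from a pointwise inequality, [four_point_lower]. It rests on the uniform monotonicity
of [t |-> |t|^(p-2) t] on bounded sets, which holds because [p <= 2], and on the kernel being larger for a pair of
points on one side than for the pair with one point reflected. It gives two bounds. The first one, [probe_lower], is a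
multiple of the squared excess at [x]; the multiple is large if the excess is small on most of a small ball close to
[x], since the kernel is singular. The second one, [gap_lower], is linear in the excess at [x], with a factor coming
from the points where [u] is definitely below its reflection.

The first bound applies near the hyperplane, because the excess is nonpositive on the other side; so there is no
excess when the hyperplane cuts off a thin cap, [no_excess_start]. If there is no excess at some [lam0 > 0], then
there is none slightly below: translations are continuous in measure, so the excess is small off a set of small
measure, and the first bound applies where the excess is large, the second one where it is small, [no_excess_step].
The second bound needs [u] to lie strictly below its reflection on a set of positive measure, [gap_negative].
Otherwise [u] would vanish on a small ball near the boundary of the unit ball, whose mirror image lies outside; but
testing the equation with a rescaled copy of [u] supported in that ball gives a negative number on the left, because
[u] is not zero, and a nonnegative one on the right, because [f 0 >= 0], [vanishing_on_ball]. Since the positions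
without excess form a closed set, [no_excess_closed], the hyperplane reaches the origin.

These inequalities, for all [nu] and all [lam >= 0], compare the integrals of [u] over any two balls of the same
radius: the one with the center closer to the origin has the larger integral, [ball_integral_le]. Means over balls are
therefore radial and nonincreasing, and so is their limit superior along a sequence of radii, which equals [u] almost
everywhere, [radial_representative]. *)

Set Implicit Arguments.
Unset Strict Implicit.
Unset Printing Implicit Defensive.

Import Order.TTheory GRing.Theory Num.Theory.
Import numFieldNormedType.Exports.
Import Defs.

Local Open Scope classical_set_scope.
Local Open Scope ring_scope.

(** * Vectors and changes of variables *)
Section change_of_variables.
Context d {T : measurableType d} {R : realType}.
Variables (mu : {measure set T -> \bar R}) (phi : T -> T) (c : {nonneg R}).
Hypotheses (mphi : measurable_fun setT phi)
  (phiE : forall A, measurable A -> mu (phi @^-1` A) = (c%:num%:E * mu A)%E).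

Lemma ge0_integral_comp (g : T -> \bar R) :
  measurable_fun setT g -> (forall x, 0 <= g x)%E ->
  (\int[mu]_x g (phi x) = c%:num%:E * \int[mu]_x g x)%E.
Proof.
move=> mg g0.
rewrite -(ge0_integral_mscale mu measurableT c)//.
transitivity (\int[pushforward mu phi]_(y in setT) g y)%E.
  by rewrite (ge0_integral_pushforward mphi)//= preimage_setT.
pose mphi_mixin := isMeasurableFun.Build _ _ _ _ _ mphi.
pose phi' : {mfun _ >-> _} := HB.pack phi mphi_mixin.
exact: (@eq_measure_integral _ _ _ setT (mscale c mu) (pushforward mu phi') g (fun A mA _ => phiE mA)).
Qed.

End change_of_variables.

Section vectors.
Context {R : realType} {n : nat}.
Implicit Types (x y z nu : Rn R n) (a lam r : R).

Definition co x (i : 'I_n) : R := tnth x i.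

Definition mkv (F : 'I_n -> R) : Rn R n :=
  [tuple (F i : measurableTypeR R) | i < n].

Lemma co_mkv F i : co (mkv F) i = F i.
Proof. by rewrite /co tnth_mktuple. Qed.

Lemma vecP x y : (forall i, co x i = co y i) -> x = y.
Proof. by move=> xy; apply: eq_from_tnth => i; exact: xy. Qed.

Definition vadd x y := mkv (fun i => co x i + co y i).
Definition vsub x y := mkv (fun i => co x i - co y i).
Definition vscale a x := mkv (fun i => a * co x i).
Definition dot x y : R := \sum_(i < n) co x i * co y i.

Lemma edistE x y : edist x y = enorm (vsub x y).
Proof. by []. Qed.

Lemma enormE x : enorm x = Num.sqrt (dot x x).
Proof. by []. Qed.

Lemma dotC x y : dot x y = dot y x.
Proof. by apply: eq_bigr => i _; rewrite mulrC. Qed.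

Lemma dotDl x y z : dot (vadd x y) z = dot x z + dot y z.
Proof. by rewrite -big_split; apply: eq_bigr => i _; rewrite co_mkv mulrDl. Qed.

Lemma dotBl x y z : dot (vsub x y) z = dot x z - dot y z.
Proof.
by rewrite -sumrB; apply: eq_bigr => i _; rewrite co_mkv mulrBl.
Qed.

Lemma dotZl a x z : dot (vscale a x) z = a * dot x z.
Proof. by rewrite mulr_sumr; apply: eq_bigr => i _; rewrite co_mkv mulrA. Qed.

Lemma dotDr x y z : dot z (vadd x y) = dot z x + dot z y.
Proof. by rewrite dotC dotDl !(dotC z). Qed.

Lemma dotBr x y z : dot z (vsub x y) = dot z x - dot z y.
Proof. by rewrite dotC dotBl !(dotC z). Qed.

Lemma dotZr a x z : dot z (vscale a x) = a * dot z x.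
Proof. by rewrite dotC dotZl (dotC z). Qed.

Lemma dot_ge0 x : 0 <= dot x x.
Proof. by apply: sumr_ge0 => i _; rewrite -expr2 sqr_ge0. Qed.

Lemma dot_eq0 x : dot x x = 0 -> forall i, co x i = 0.
Proof.
move=> /eqP; rewrite psumr_eq0; last by move=> i _; rewrite -expr2 sqr_ge0.
by move=> /allP xx0 i; have := xx0 i (mem_index_enum _); rewrite /= mulf_eq0 orbb => /eqP.
Qed.

Lemma enorm_ge0 x : 0 <= enorm x.
Proof. exact: sqrtr_ge0. Qed.

Lemma enorm2 x : enorm x ^+ 2 = dot x x.
Proof. by rewrite sqr_sqrtr ?dot_ge0. Qed.

Lemma enorm_ltE x r : 0 < r -> (enorm x < r) = (dot x x < r ^+ 2).
Proof.
move=> r0; rewrite -enorm2.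
by rewrite ltr_pXn2r// nnegrE ?enorm_ge0// ltW.
Qed.

Lemma enorm_leE x r : 0 <= r -> (enorm x <= r) = (dot x x <= r ^+ 2).
Proof.
by move=> r0; rewrite -enorm2 ler_pXn2r// nnegrE ?enorm_ge0.
Qed.

Lemma le_enorm x y : (enorm x <= enorm y) = (dot x x <= dot y y).
Proof. by rewrite enorm_leE ?enorm_ge0// enorm2. Qed.

Lemma edist2 x y : edist x y ^+ 2 = dot x x - 2 * dot x y + dot y y.
Proof. by rewrite edistE enorm2 dotBl !dotBr (dotC y x); ring. Qed.

Lemma edist_ge0 x y : 0 <= edist x y.
Proof. exact: enorm_ge0. Qed.

Lemma edistC x y : edist x y = edist y x.
Proof.
by rewrite !edistE !enormE; congr Num.sqrt; rewrite !dotBl !dotBr (dotC y x); ring.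
Qed.

Lemma edist_eq0 x y : edist x y = 0 -> x = y.
Proof.
move=> d0; apply: vecP => i; apply/eqP; rewrite -subr_eq0.
have /dot_eq0/(_ i) : dot (vsub x y) (vsub x y) = 0.
  by rewrite -enorm2 -edistE d0 expr0n.
by rewrite co_mkv => ->.
Qed.

Lemma edist_xx x : edist x x = 0.
Proof.
by apply/eqP; rewrite -sqrf_eq0; apply/eqP; rewrite edist2; ring.
Qed.

(** Cauchy-Schwarz against a unit vector is Pythagoras. *)
Lemma dot_unit_le x nu : dot nu nu = 1 -> dot x nu ^+ 2 <= dot x x.
Proof.
move=> nu1; have := dot_ge0 (vsub x (vscale (dot x nu) nu)).
rewrite dotBl !dotBr !dotZl !dotZr nu1 (dotC nu x); lra.
Qed.

Lemma measurable_mkv d (T : measurableType d) (F : T -> 'I_n -> R) :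
  (forall i, measurable_fun setT (fun t => F t i)) ->
  measurable_fun setT (fun t => mkv (F t)).
Proof.
move=> mF; apply/measurable_fun_tnthP => i.
suff -> : (tnth (T:=measurableTypeR R))^~ i \o (fun t => mkv (F t)) = (fun t => F t i).
  exact: mF.
by apply: funext => t /=; rewrite -[LHS]/(co (mkv (F t)) i) co_mkv.
Qed.

Lemma measurable_co i : measurable_fun setT (fun x : Rn R n => co x i).
Proof. exact: measurable_tnth. Qed.

Lemma measurable_dot nu : measurable_fun setT (fun x : Rn R n => dot x nu).
Proof.
apply: (@measurable_sum _ _ _ _ _ _ (fun i x => co x i * co nu i)) => i.
by apply: measurable_funM => //; exact: measurable_co.
Qed.

End vectors.

Lemma lebesgue_measure_translate {R : realType} (h : R) (A : set (measurableTypeR R)) :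
  measurable A -> lebesgue_measure ((+%R^~ h) @^-1` A) = lebesgue_measure A.
Proof.
move=> mA.
have mh : measurable_fun [set: measurableTypeR R]
    ((fun x => x + h) : measurableTypeR R -> measurableTypeR R).
  exact: measurable_funD.
pose mh_mixin := isMeasurableFun.Build _ _ _ _ _ mh.
pose h' : {mfun _ >-> _} := HB.pack ((fun x => x + h) : measurableTypeR R -> measurableTypeR R) mh_mixin.
apply/esym; apply: (@lebesgue_measure_unique _ (pushforward (@lebesgue_measure R) h')) => // _ [[a b] _ <-].
rewrite /pushforward /=.
rewrite [X in _ = lebesgue_measure X](_ : _ = `]a - h, b - h]%classic).
  rewrite !lebesgue_measure_itv/= !lte_fin ltrD2r.
  by case: ifP => // _; rewrite -!EFinB; congr EFin; ring.
by apply/seteqP; split=> x /=; rewrite !in_itv/= ltrBlDr lerBrDr.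
Qed.

Section coordinatewise.
Context {R : realType}.

(** A product of measure-preserving maps preserves the product measure: both measures agree on rectangles with one
side in the first coordinate, and the induction hypothesis handles the remaining coordinates. *)
Lemma lebesgue_Rn_coordinatewise n (t : 'I_n -> R -> R) :
  (forall i, measurable_fun setT (t i : measurableTypeR R -> measurableTypeR R)) ->
  (forall i (A : set (measurableTypeR R)), measurable A ->
    lebesgue_measure (t i @^-1` A) = lebesgue_measure A) ->
  forall A, measurable A ->
  lebesgue_Rn n ((fun x => mkv (fun i => t i (co x i))) @^-1` A) =
  lebesgue_Rn n A.
Proof.
elim: n t => [|n ih] t mt tE A mA.
  rewrite (_ : (fun x => _) = id) ?preimage_id//.
  by apply/funext => x; apply: vecP => -[].
pose t' i := t (lift ord0 i).
pose T' (x : Rn R n) := mkv (fun i => t' i (co x i)).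
have mT' : measurable_fun setT T'.
  apply: measurable_mkv => i; apply: (measurableT_comp (mt (lift ord0 i))).
  exact: measurable_co.
pose P (z : measurableTypeR R * Rn R n) : measurableTypeR R * Rn R n := (t ord0 z.1, T' z.2).
have mP : measurable_fun setT P.
  apply/measurable_fun_pairP; split => /=.
    exact: (measurableT_comp (mt ord0) measurable_fst).
  exact: (measurableT_comp mT' measurable_snd).
pose P_mixin := isMeasurableFun.Build _ _ _ _ _ mP.
pose P' : {mfun _ >-> _} := HB.pack P P_mixin.
have mX : measurable (@cons_Rn R n @^-1` A).
  by rewrite -[X in measurable X]setTI; apply: measurable_cons_Rn.
rewrite /= /lebesgueS /pushforward.
have consP z : mkv (fun i => t i (co (cons_Rn z) i)) = cons_Rn (P z).
  apply: vecP => i; rewrite co_mkv; case: z => a x; rewrite /co /cons_Rn/=.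
  case: (unliftP ord0 i) => [j ->|-> //].
  by rewrite !tnthS tnth_mktuple.
have -> : @cons_Rn R n @^-1` ((fun x => mkv (fun i => t i (co x i))) @^-1` A) =
    P @^-1` (@cons_Rn R n @^-1` A).
  by apply/seteqP; split=> z; rewrite /preimage/= consP.
apply/esym; apply: (@product_measure_unique _ _ _ _ _ lebesgue_measure (lebesgue_Rn n)
   (pushforward (@lebesgue_measure R \x lebesgue_Rn n)%E P')) => //.
move=> B C mB mC.
rewrite -[LHS]/((@lebesgue_measure R \x lebesgue_Rn n)%E ((t ord0 @^-1` B) `*` (T' @^-1` C))).
have mtB : measurable (t ord0 @^-1` B).
  by rewrite -[X in measurable X]setTI; exact: (mt ord0).
have mTC : measurable (T' @^-1` C) by rewrite -[X in measurable X]setTI; exact: mT'.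
rewrite product_measure1E//; congr (_ * _)%E; first exact: (tE ord0).
by apply: ih => // i; [exact: mt|exact: tE].
Qed.

End coordinatewise.

(** * Lebesgue measure under translations and affine maps *)
Section change_of_variables2.
Context d {T : measurableType d} {R : realType}.
Variables (mu : {sigma_finite_measure set T -> \bar R}).

Lemma ge0_integral_comp2 (phi psi : T -> T) (c e : {nonneg R})
    (g : T * T -> \bar R) :
  measurable_fun setT phi ->
  (forall A, measurable A -> mu (phi @^-1` A) = (c%:num%:E * mu A)%E) ->
  measurable_fun setT psi ->
  (forall A, measurable A -> mu (psi @^-1` A) = (e%:num%:E * mu A)%E) ->
  measurable_fun setT g -> (forall z, 0 <= g z)%E ->
  (\int[mu \x mu]_z g (phi z.1, psi z.2) =
   (c%:num * e%:num)%:E * \int[mu \x mu]_z g z)%E.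
Proof.
move=> mphi phiE mpsi psiE mg g0.
have mgT : measurable_fun setT (fun z : T * T => g (phi z.1, psi z.2)).
  apply: (measurableT_comp mg); apply/measurable_fun_pairP; split.
    exact: (measurableT_comp mphi measurable_fst).
  exact: (measurableT_comp mpsi measurable_snd).
rewrite fubini_tonelli1// [in RHS]fubini_tonelli1// /fubini_F/=.
have mgx x : measurable_fun setT (fun y => g (x, y)).
  exact: (measurableT_comp mg (measurable_pair1 x)).
under eq_integral => x _ do rewrite (ge0_integral_comp mpsi psiE (mgx (phi x)))//.
have mF : measurable_fun setT (fun x => \int[mu]_y g (x, y))%E.
  exact: (@measurable_fun_fubini_tonelli_F _ _ _ _ _ mu g mg g0).
have F0 x : (0 <= \int[mu]_y g (x, y))%E by apply: integral_ge0.
rewrite (@ge0_integralZl _ _ _ mu _ measurableT (fun x => \int[mu]_y g (phi x, y))%E)//;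
  last exact: (measurableT_comp mF mphi).
by rewrite (ge0_integral_comp mphi phiE mF)// muleA -EFinM mulrC.
Qed.

End change_of_variables2.

Section lebesgue_Rn_invariance.
Context {R : realType} {n : nat}.
Local Notation T := (Rn R n).
Local Notation mu := (@lebesgue_Rn R n).
Implicit Types (x y h : T) (A B : set T).

Lemma measurable_vadd (F G : T * T -> T) :
  measurable_fun setT F -> measurable_fun setT G ->
  measurable_fun setT (fun z => vadd (F z) (G z)).
Proof.
move=> mF mG; apply: measurable_mkv => i; apply: measurable_funD.
  exact: (measurableT_comp (measurable_co i) mF).
exact: (measurableT_comp (measurable_co i) mG).
Qed.

Lemma measurable_vsub (F G : T * T -> T) :
  measurable_fun setT F -> measurable_fun setT G ->
  measurable_fun setT (fun z => vsub (F z) (G z)).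
Proof.
move=> mF mG; apply: measurable_mkv => i; apply: measurable_funB.
  exact: (measurableT_comp (measurable_co i) mF).
exact: (measurableT_comp (measurable_co i) mG).
Qed.

Lemma measurable_translation h : measurable_fun setT (vadd^~ h : T -> T).
Proof.
apply: measurable_mkv => i; apply: measurable_funD => //; exact: measurable_co.
Qed.

Lemma measurable_point_reflection h : measurable_fun setT (vsub h : T -> T).
Proof.
apply: measurable_mkv => i; apply: measurable_funB => //; exact: measurable_co.
Qed.

Let madd (a : R) : measurable_fun setT ((fun t => t + a) : measurableTypeR R -> measurableTypeR R).
Proof. exact: measurable_funD. Qed.

Let msub (a : R) : measurable_fun setT ((fun t => a - t) : measurableTypeR R -> measurableTypeR R).
Proof. exact: measurable_funB. Qed.

Lemma lebesgue_Rn_translate h A :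
  measurable A -> mu ((vadd^~ h) @^-1` A) = mu A.
Proof.
exact: (@lebesgue_Rn_coordinatewise _ n (fun i a => a + co h i) (fun i => madd (co h i))
  (fun i D mD => lebesgue_measure_translate (co h i) mD)).
Qed.

Lemma lebesgue_Rn_point_reflect h A :
  measurable A -> mu ((vsub h) @^-1` A) = mu A.
Proof.
apply: (@lebesgue_Rn_coordinatewise _ n (fun i a => co h i - a) (fun i => msub (co h i))).
move=> i B mB.
have mB' : measurable ((+%R^~ (co h i)) @^-1` B : set (measurableTypeR R)).
  by rewrite -[X in measurable X]setTI; exact: (madd (co h i)).
rewrite -[RHS](lebesgue_measure_translate (co h i))// -[RHS]lebesgue_measureN//.
rewrite /pushforward; congr (lebesgue_measure _).
by apply/seteqP; split=> a /=; rewrite addrC.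
Qed.

Let ge0_integral_translate h (g : T -> \bar R) :
  measurable_fun setT g -> (forall x, 0 <= g x)%E ->
  (\int[mu]_x g (vadd x h) = \int[mu]_x g x)%E.
Proof.
move=> mg g0.
rewrite (@ge0_integral_comp _ _ _ mu (vadd^~ h) 1%:nng (measurable_translation h))//= ?mul1e//.
by move=> A mA; rewrite mul1e lebesgue_Rn_translate.
Qed.

Let ge0_integral_point_reflect h (g : T -> \bar R) :
  measurable_fun setT g -> (forall x, 0 <= g x)%E ->
  (\int[mu]_x g (vsub h x) = \int[mu]_x g x)%E.
Proof.
move=> mg g0.
rewrite (@ge0_integral_comp _ _ _ mu (vsub h) 1%:nng (measurable_point_reflection h))//= ?mul1e//.
by move=> A mA; rewrite mul1e lebesgue_Rn_point_reflect.
Qed.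

(** Uniqueness of Haar measure: the image of [mu] under an affine bijection is again translation invariant, and
two translation invariant measures are proportional. The identity is Fubini's theorem applied twice to
[\1_A (f x) * \1_B (y + f x)], which is translated once in [y] and once in [x]. *)
Lemma lebesgue_Rn_affine (f : T -> T) A B : measurable_fun setT f ->
  (forall h, exists k, forall x, f (vadd x k) = vadd (f x) h) ->
  measurable A -> measurable B ->
  (mu (f @^-1` A) * mu B = mu (f @^-1` B) * mu A)%E.
Proof.
move=> mf fD mA mB.
have mpre C : measurable C -> measurable (f @^-1` C).
  by move=> mC; rewrite -[X in measurable X]setTI; exact: mf.
have mind C : measurable C -> measurable_fun setT (\1_C : T -> R).
  by move=> mC; exact: measurable_indic.
have JE C D : measurable C -> measurable D ->
    (mu (f @^-1` C) * mu D = \int[mu]_x \int[mu]_y (\1_C (f x) * \1_D y)%:E)%E.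
  move=> mC mD.
  transitivity (\int[mu]_x ((\1_C (f x))%:E * mu D))%E; last first.
    apply: eq_integral => x _; rewrite -(setIT D) -integral_indic// setIT.
    by rewrite -ge0_integralZl//; apply/measurable_EFinP; exact: mind.
  rewrite ge0_integralZr//; last first.
    by apply/measurable_EFinP; exact: (measurableT_comp (mind _ mC) mf).
  congr (_ * _)%E; rewrite -[in LHS](setIT (f @^-1` C)) -integral_indic//.
  exact: mpre.
have mg (F G : T * T -> T) : measurable_fun setT F -> measurable_fun setT G ->
    measurable_fun setT (fun z => (\1_A (F z) * \1_B (G z))%:E : \bar R).
  move=> mF mG; apply/measurable_EFinP; apply: measurable_funM.
    exact: (measurableT_comp (mind _ mA) mF).
  exact: (measurableT_comp (mind _ mB) mG).
have mf1 : measurable_fun setT (fun z : T * T => f z.1).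
  exact: (measurableT_comp mf measurable_fst).
have mfst : measurable_fun setT (fun z : T * T => z.2) by exact: measurable_snd.
have mY (g : T * T -> \bar R) : measurable_fun setT g -> forall x,
    measurable_fun setT (fun y => g (x, y)).
  by move=> mg' x; exact: (measurableT_comp mg' (measurable_pair1 x)).
have mX (g : T * T -> \bar R) : measurable_fun setT g -> forall y,
    measurable_fun setT (fun x => g (x, y)).
  by move=> mg' y; exact: (measurableT_comp mg' (measurable_pair2 y)).
have ge0 a b : (0%E <= (\1_A a * \1_B b)%:E :> \bar R)%E.
  by rewrite lee_fin mulr_ge0.
rewrite (JE _ _ mA mB).
transitivity (\int[mu]_x \int[mu]_y (\1_A (f x) * \1_B (vadd y (f x)))%:E)%E.
  apply: eq_integral => x _; apply/esym.
  apply: (ge0_integral_translate (f x) (g := fun y => (\1_A (f x) * \1_B y)%:E)) => //.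
  exact: (mY _ (mg _ _ mf1 mfst) x).
rewrite (@fubini_tonelli _ _ _ _ _ mu mu (fun z => (\1_A (f z.1) * \1_B (vadd z.2 (f z.1)))%:E))//=; last first.
  by apply: mg => //; exact: measurable_vadd.
transitivity (\int[mu]_y \int[mu]_x (\1_A (vsub (f x) y) * \1_B (f x))%:E)%E.
  apply: eq_integral => y _.
  have [k fk] := fD (vscale (-1) y).
  rewrite -(ge0_integral_translate k
      (g := fun x => (\1_A (f x) * \1_B (vadd y (f x)))%:E))//; last first.
    exact: (mX _ (mg _ _ mf1 (measurable_vadd mfst mf1)) y).
  apply: eq_integral => x _; rewrite fk; congr (EFin (\1_A _ * \1_B _)).
    by apply: vecP => i; rewrite !co_mkv; ring.
  by apply: vecP => i; rewrite !co_mkv; ring.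
rewrite -(@fubini_tonelli _ _ _ _ _ mu mu (fun z => (\1_A (vsub (f z.1) z.2) * \1_B (f z.1))%:E))//=; last first.
  by apply: mg => //; exact: measurable_vsub.
rewrite (JE _ _ mB mA).
apply: eq_integral => x _.
rewrite (ge0_integral_point_reflect (f x) (g := fun y => (\1_A y * \1_B (f x))%:E))//.
  by apply: eq_integral => y _; rewrite mulrC.
apply: (mY (fun z => (\1_A z.2 * \1_B (f z.1))%:E)); exact: mg.
Qed.

End lebesgue_Rn_invariance.

(** * Balls, reflections and dilations *)
Lemma mule_fin_inj {R : realType} (a x y : \bar R) : a \is a fin_num -> (0 < a)%E ->
  (x * a = y * a -> x = y)%E.
Proof.
case: a => [a||]//= _; rewrite lte_fin => a0 xy.
by rewrite -[x]mule1 -[y]mule1 -(@mulfV _ a) ?gt_eqF// EFinM !muleA xy.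
Qed.

Section balls.
Context {R : realType} {n : nat}.
Local Notation T := (Rn R n).
Local Notation mu := (@lebesgue_Rn R n).

Definition eball (z : T) (r : R) : set T := [set y | edist y z < r].

Definition ebox (a b : 'I_n -> R) : set T := [set x | forall i, [set` `[a i, b i]] (tnth x i)].

Lemma measurable_edist2 d (S : measurableType d) (F G : S -> T) :
  measurable_fun setT F -> measurable_fun setT G ->
  measurable_fun setT (fun t => edist (F t) (G t)).
Proof.
move=> mF mG; apply: (measurableT_comp (@measurable_enorm R n)).
apply: measurable_mkv => i; apply: measurable_funB.
  exact: (measurableT_comp (measurable_co i) mF).
exact: (measurableT_comp (measurable_co i) mG).
Qed.

Lemma measurable_lt d (S : measurableType d) (F : S -> R) (r : R) :
  measurable_fun setT F -> measurable [set t | F t < r].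
Proof.
move=> mF; rewrite (_ : [set t | _] = F @^-1` `]-oo, r[%classic).
  by rewrite -[X in measurable X]setTI; exact: mF.
by apply/seteqP; split=> t /=; rewrite in_itv.
Qed.

Lemma measurable_le d (S : measurableType d) (F : S -> R) (r : R) :
  measurable_fun setT F -> measurable [set t | r <= F t].
Proof.
move=> mF; rewrite (_ : [set t | _] = F @^-1` `[r, +oo[%classic).
  by rewrite -[X in measurable X]setTI; exact: mF.
by apply/seteqP; split=> t /=; rewrite in_itv/= ?andbT.
Qed.

Lemma measurable_gt d (S : measurableType d) (F : S -> R) (r : R) :
  measurable_fun setT F -> measurable [set t | r < F t].
Proof.
move=> mF; rewrite (_ : [set t | _] = F @^-1` `]r, +oo[%classic).
  by rewrite -[X in measurable X]setTI; exact: mF.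
by apply/seteqP; split=> t /=; rewrite in_itv/= ?andbT.
Qed.

Lemma measurable_neq0 d (S : measurableType d) (F : S -> R) :
  measurable_fun setT F -> measurable [set t | F t != 0].
Proof.
move=> mF; rewrite (_ : [set t | _] = [set t | 0 < F t] `|` [set t | F t < 0]).
  by apply: measurableU; [exact: measurable_gt|exact: measurable_lt].
apply/seteqP; split => t /=; rewrite neq_lt; first by move=> /orP[?|?]; [right|left].
by move=> [->|->]; rewrite ?orbT.
Qed.

Lemma measurable_eball z r : measurable (eball z r).
Proof.
apply: measurable_lt; apply: measurable_edist2; first exact: measurable_id.
exact: measurable_cst.
Qed.

Lemma eball_box z r : eball z r `<=` ebox (fun i => co z i - r) (fun i => co z i + r).
Proof.
move=> x /= xz i /=; rewrite in_itv/= -/(co x i).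
have r0 : 0 < r by rewrite (le_lt_trans (edist_ge0 x z)).
move: xz; rewrite /eball/= edistE enorm_ltE// /dot (bigD1 i)//= !co_mkv => xz.
have s0 : 0 <= \sum_(j < n | j != i) co (vsub x z) j * co (vsub x z) j.
  by apply: sumr_ge0 => j _; rewrite -expr2 sqr_ge0.
have : (co x i - co z i) ^+ 2 < r ^+ 2 by rewrite expr2; lra.
rewrite -ltr_sqrt ?exprn_gt0// !sqrtr_sqr (ger0_norm (ltW r0)) ltr_norml.
by move=> /andP[? ?]; apply/andP; split; lra.
Qed.

Lemma box_eball z r : 0 < r ->
  ebox (fun i => co z i - r / n.+1%:R) (fun i => co z i + r / n.+1%:R) `<=` eball z r.
Proof.
move=> r0 x /= xz; rewrite /eball/= edistE enorm_ltE//.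
apply: (@le_lt_trans _ _ (\sum_(i < n) (r / n.+1%:R) ^+ 2)).
  apply: ler_sum => i _; rewrite co_mkv -expr2 -ler_sqrt ?sqr_ge0// !sqrtr_sqr.
  have q0 : 0 <= r / n.+1%:R by rewrite divr_ge0// ltW.
  rewrite (ger0_norm q0).
  have : co x i \in `[co z i - r / n.+1%:R, co z i + r / n.+1%:R] := xz i.
  rewrite in_itv/= ler_norml; move: (r / _) => q /andP[? ?].
  by apply/andP; split; lra.
rewrite sumr_const card_ord expr_div_n -[ltLHS]mulr_natl mulrCA.
rewrite gtr_pMr ?exprn_gt0// ltr_pdivrMr ?exprn_gt0// mul1r -natrX ltr_nat.
by rewrite (@leq_trans n.+1)// expnS leq_pmulr// expn1.
Qed.

Lemma measurable_box (a b : 'I_n -> R) :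
  measurable (ebox a b).
Proof.
rewrite (_ : ebox a b = \bigcap_(i in [set: 'I_n]) ((@tnth n _)^~ i @^-1` [set` `[a i, b i]])).
  apply: fin_bigcap_measurable => // i _.
  by rewrite -[X in measurable X]setTI; exact: measurable_tnth.
by apply/seteqP; split => x /= xA i; [move=> _; exact: xA|exact: xA].
Qed.

Lemma lebesgue_Rn_cube (a b : 'I_n -> R) (l : R) : 0 <= l -> (forall i, b i - a i = l) ->
  mu (ebox a b) = (l ^+ n)%:E.
Proof.
move=> l0 ab; rewrite (lebesgue_Rn_box (A := fun i => [set` `[a i, b i]]))//.
rewrite (eq_bigr (fun=> l%:E)); last first.
  move=> i _; rewrite lebesgue_measure_itv/= lte_fin -subr_gt0 ab.
  case: ltgtP l0 => // [l0 _|<- _ //].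
  by rewrite -EFinB ab.
by rewrite prodEFin prodr_const card_ord.
Qed.

Lemma eball_lty z r : (mu (eball z r) < +oo)%E.
Proof.
have [r0|r0] := ltP 0 r; last first.
  rewrite (_ : eball z r = set0) ?measure0//; apply/seteqP; split => // x.
  by rewrite /eball/= => /(le_lt_trans (edist_ge0 _ _)); rewrite ltNge r0.
apply: (@le_lt_trans _ _ (mu (ebox (fun i => co z i - r) (fun i => co z i + r)))).
  apply: le_measure; rewrite ?inE; [exact: measurable_eball|exact: measurable_box|].
  exact: eball_box.
rewrite (@lebesgue_Rn_cube _ _ (2 * r)) ?ltry//; first lra.
by move=> i; ring.
Qed.

Lemma eball_ge z r : 0 < r -> (((2 * (r / n.+1%:R)) ^+ n)%:E <= mu (eball z r))%E.
Proof.
move=> r0; rewrite -(@lebesgue_Rn_cube (fun i => co z i - r / n.+1%:R)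
  (fun i => co z i + r / n.+1%:R)).
- apply: le_measure; rewrite ?inE; [exact: measurable_box|exact: measurable_eball|].
  exact: box_eball.
- by rewrite mulr_ge0// divr_ge0// ltW.
- by move=> i; ring.
Qed.

Lemma eball_gt0 z r : 0 < r -> (0 < mu (eball z r))%E.
Proof.
move=> r0; apply: lt_le_trans (eball_ge z r0).
by rewrite lte_fin exprn_gt0// mulr_gt0// divr_gt0.
Qed.

Lemma eball_translate z r : (vadd^~ z) @^-1` (eball z r) = eball (mkv (fun=> 0)) r.
Proof.
apply/seteqP; split=> x; rewrite /eball/=; rewrite !edistE.
  by congr (enorm _ < _); apply: vecP => i; rewrite !co_mkv; ring.
by congr (enorm _ < _); apply: vecP => i; rewrite !co_mkv; ring.
Qed.

Lemma lebesgue_Rn_eball z r : mu (eball z r) = mu (eball (mkv (fun=> 0)) r).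
Proof.
by rewrite -(lebesgue_Rn_translate z (measurable_eball z r)) eball_translate.
Qed.

Lemma unit_ballE : unit_ball = eball (mkv (fun=> 0)) 1.
Proof.
apply/seteqP; split=> x; rewrite /unit_ball/eball/= edistE.
  by congr (enorm _ < _); apply: vecP => i; rewrite !co_mkv; ring.
by congr (enorm _ < _); apply: vecP => i; rewrite !co_mkv; ring.
Qed.

Lemma fin_eball z r : mu (eball z r) \is a fin_num.
Proof. by rewrite ge0_fin_numE ?measure_ge0// eball_lty. Qed.

(** The proportionality [lebesgue_Rn_affine] is evaluated on the unit ball, whose preimage is again a ball of
radius one. *)
Lemma lebesgue_Rn_isometry (f : T -> T) : measurable_fun setT f ->
  (forall h, exists k, forall x, f (vadd x k) = vadd (f x) h) ->
  involutive f -> (forall x y, edist (f x) (f y) = edist x y) ->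
  forall A, measurable A -> mu (f @^-1` A) = mu A.
Proof.
move=> mf fD fK fiso A mA; pose o : T := mkv (fun=> 0).
have := lebesgue_Rn_affine mf fD mA (measurable_eball o 1).
rewrite (_ : f @^-1` eball o 1 = eball (f o) 1); last first.
  by apply/seteqP; split=> x; rewrite /eball/= -[in X in X -> _]fiso fK.
rewrite (lebesgue_Rn_eball (f o)) -/o [RHS]muleC.
by apply: mule_fin_inj; [exact: fin_eball|exact: eball_gt0].
Qed.

End balls.

Section reflection.
Context {R : realType} {n : nat}.
Local Notation T := (Rn R n).
Local Notation mu := (@lebesgue_Rn R n).
Implicit Types (x y nu : T) (lam r : R).

(** For a unit vector [nu], the reflection in the hyperplane [dot x nu = lam]. *)
Definition refl nu lam x := vadd x (vscale (2 * (lam - dot x nu)) nu).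

Lemma measurable_refl nu lam : measurable_fun setT (refl nu lam).
Proof.
apply: measurable_mkv => i; apply: measurable_funD; first exact: measurable_co.
under eq_fun do rewrite co_mkv.
apply: measurable_funM => //; apply: measurable_funM => //.
by apply: measurable_funB => //; exact: measurable_dot.
Qed.

Section unit_normal.
Variables (nu : T) (nu1 : dot nu nu = 1).

Lemma dot_refl lam x : dot (refl nu lam x) nu = 2 * lam - dot x nu.
Proof. by rewrite dotDl dotZl nu1; ring. Qed.

Lemma reflK lam : involutive (refl nu lam).
Proof.
by move=> x; apply: vecP => i; rewrite {1}/refl co_mkv dot_refl !co_mkv; ring.
Qed.

Lemma edist_refl lam x y : edist (refl nu lam x) (refl nu lam y) = edist x y.
Proof.
apply/eqP; rewrite -(@eqrXn2 _ 2)// ?edist_ge0// !edist2; apply/eqP.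
rewrite !dotDl !dotDr !dotZl !dotZr nu1 !(dotC nu); ring.
Qed.

Lemma edist_reflr lam x y : edist x (refl nu lam y) = edist (refl nu lam x) y.
Proof. by rewrite -[in LHS](reflK lam x) edist_refl. Qed.

(** The product on the right is positive for points strictly on the same side, so reflecting one of them increases the
distance, and by a definite amount away from the hyperplane. *)
Lemma edist2_refl lam x y : edist x (refl nu lam y) ^+ 2 =
  edist x y ^+ 2 + 4 * (dot x nu - lam) * (dot y nu - lam).
Proof.
by rewrite !edist2 !dotDl !dotDr !dotZl !dotZr nu1 !(dotC nu); ring.
Qed.

Lemma dot_refl_self lam x : dot (refl nu lam x) (refl nu lam x) =
  dot x x + 4 * lam * (lam - dot x nu).
Proof.
by rewrite !dotDl !dotDr !dotZl !dotZr nu1 !(dotC nu); ring.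
Qed.

Lemma refl_shift lam lam' x :
  refl nu lam x = vadd (refl nu lam' x) (vscale (2 * (lam - lam')) nu).
Proof. by apply: vecP => i; rewrite !co_mkv; ring. Qed.

Lemma refl_fix lam x : dot x nu = lam -> refl nu lam x = x.
Proof. by move=> xl; apply: vecP => i; rewrite !co_mkv xl; ring. Qed.

Lemma lebesgue_Rn_refl lam (A : set T) : measurable A ->
  mu (refl nu lam @^-1` A) = mu A.
Proof.
apply: lebesgue_Rn_isometry.
- exact: measurable_refl.
- move=> h; exists (vsub h (vscale (2 * dot h nu) nu)) => x.
  apply: vecP => i; rewrite !co_mkv dotDl dotBl dotZl nu1; ring.
- exact: reflK.
- exact: edist_refl.
Qed.

Lemma ge0_integral_refl lam (g : T -> \bar R) :
  measurable_fun setT g -> (forall x, 0 <= g x)%E ->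
  (\int[mu]_x g (refl nu lam x) = \int[mu]_x g x)%E.
Proof.
move=> mg g0.
rewrite (@ge0_integral_comp _ _ _ mu (refl nu lam) 1%:nng (measurable_refl nu lam))//= ?mul1e//.
by move=> A mA; rewrite mul1e lebesgue_Rn_refl.
Qed.

Let refl1 lam (A : set T) : measurable A ->
  (mu (refl nu lam @^-1` A) = (1%:nng : {nonneg R})%:num%:E * mu A)%E.
Proof. by move=> mA; rewrite mul1e lebesgue_Rn_refl. Qed.

Let id1 (A : set T) : measurable A ->
  (mu (idfun @^-1` A) = (1%:nng : {nonneg R})%:num%:E * mu A)%E.
Proof. by move=> mA; rewrite mul1e. Qed.

Lemma ge0_integral_refl12 lam (g : T * T -> \bar R) :
  measurable_fun setT g -> (forall z, 0 <= g z)%E ->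
  (\int[mu \x mu]_z g (refl nu lam z.1, refl nu lam z.2) = \int[mu \x mu]_z g z)%E.
Proof.
move=> mg g0; rewrite (ge0_integral_comp2 (measurable_refl nu lam) (refl1 lam)
  (measurable_refl nu lam) (refl1 lam) mg g0).
by rewrite mulr1 mul1e.
Qed.

Lemma ge0_integral_refl1 lam (g : T * T -> \bar R) :
  measurable_fun setT g -> (forall z, 0 <= g z)%E ->
  (\int[mu \x mu]_z g (refl nu lam z.1, z.2) = \int[mu \x mu]_z g z)%E.
Proof.
move=> mg g0; rewrite (ge0_integral_comp2 (measurable_refl nu lam) (refl1 lam)
  (@measurable_id _ _ _) id1 mg g0).
by rewrite mulr1 mul1e.
Qed.

Lemma ge0_integral_refl2 lam (g : T * T -> \bar R) :
  measurable_fun setT g -> (forall z, 0 <= g z)%E ->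
  (\int[mu \x mu]_z g (z.1, refl nu lam z.2) = \int[mu \x mu]_z g z)%E.
Proof.
move=> mg g0; rewrite (ge0_integral_comp2 (@measurable_id _ _ _) id1
  (measurable_refl nu lam) (refl1 lam) mg g0).
by rewrite mulr1 mul1e.
Qed.

End unit_normal.

(** The affine map sending [eball z rho] onto the unit ball. *)
Definition dilation z rho x : T := vscale rho^-1 (vsub x z).

Lemma measurable_dilation z rho : measurable_fun setT (dilation z rho).
Proof.
apply: measurable_mkv => i; apply: measurable_funM => //.
under eq_fun do rewrite co_mkv.
by apply: measurable_funB => //; exact: measurable_co.
Qed.

Lemma enorm_vscale a x : enorm (vscale a x) = `|a| * enorm x.
Proof.
rewrite !enormE dotZl dotZr mulrA -expr2 sqrtrM ?sqr_ge0//.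
by rewrite sqrtr_sqr.
Qed.

Lemma edist_dilation z rho x y : 0 < rho ->
  edist (dilation z rho x) (dilation z rho y) = rho^-1 * edist x y.
Proof.
move=> rho0; rewrite !edistE -[in RHS](@ger0_norm _ rho^-1) ?invr_ge0 ?(ltW rho0)//.
by rewrite -enorm_vscale; congr enorm; apply: vecP => i; rewrite !co_mkv; ring.
Qed.

Lemma dilation_unit_ball z rho x : 0 < rho ->
  unit_ball (dilation z rho x) <-> eball z rho x.
Proof.
move=> rho0; rewrite /unit_ball /eball/= /dilation enorm_vscale edistE.
rewrite ger0_norm ?invr_ge0 ?(ltW rho0)// ltr_pdivrMl// mulr1.
by [].
Qed.

(** The scaling constant is the ratio of the volumes of [eball z rho] and of the unit ball. *)
Lemma lebesgue_Rn_dilation z rho : 0 < rho -> exists2 c : {nonneg R}, 0 < c%:num &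
  forall A, measurable A -> (mu (dilation z rho @^-1` A) = c%:num%:E * mu A)%E.
Proof.
move=> rho0; pose o : T := mkv (fun=> 0).
have pre1 : dilation z rho @^-1` (eball o 1) = eball z rho.
  by apply/seteqP; split=> x; rewrite -unit_ballE/= => /(dilation_unit_ball z x rho0).
have b0 := eball_gt0 o (@ltr01 R); have e0 := eball_gt0 z rho0.
have bf := fin_eball o 1; have ef := fin_eball z rho.
have c0 : 0 < fine (mu (eball z rho)) / fine (mu (eball o 1)).
  by rewrite divr_gt0// fine_gt0// -ge0_fin_numE ?measure_ge0// ?e0 ?b0 ?ef ?bf.
exists (NngNum (ltW c0)) => // A mA /=.
apply: (@mule_fin_inj _ (mu (eball o 1))) => //.
rewrite (lebesgue_Rn_affine (measurable_dilation z rho) _ mA (measurable_eball o 1)).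
  rewrite pre1 muleAC; congr (_ * _)%E.
  rewrite -(fineK bf) -(fineK ef) -EFinM /= divfK// gt_eqF// fine_gt0//.
  by rewrite b0 ltey_eq bf.
move=> h; exists (vscale rho h) => x.
by apply: vecP => i; rewrite !co_mkv; field; rewrite gt_eqF.
Qed.

End reflection.

(** * Continuity of translations in measure *)
Lemma cvge0_le {R : realType} (f : nat -> \bar R) (e : R) :
  (f N @[N --> \oo] --> 0)%E -> 0 < e -> exists N, (f N <= e%:E)%E.
Proof.
move=> /fine_cvgP[ffin /cvgr0Pnorm_le fe] e0.
have [N _ hN] : \forall N \near \oo, (f N <= e%:E)%E.
  near=> N; rewrite -(@fineK _ (f N)); last by near: N.
  rewrite lee_fin (le_trans (ler_norm _))//; near: N; exact: fe.
by exists N; apply: hN => /=.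
Unshelve. all: end_near. Qed.

(** The property of a measurable set that small members of a family [tau] of maps move it little, in measure, is
stable under countable unions. It is localized to the sets [Q a], of finite measure, because a union of infinitely
many sets can be truncated only where the measure is finite; a map moves [Q a] into the slightly larger [Q (a + 1)]. *)
Section continuity_in_measure.
Context d {S : measurableType d} {R : realType} (m : {measure set S -> \bar R}).
Variables (J : Type) (small : R -> J -> Prop) (tau : J -> S -> S) (Q : R -> set S).
Hypotheses (smallW : forall r r' i, r <= r' -> small r i -> small r' i)
  (mtau : forall i, measurable_fun setT (tau i))
  (mQ : forall a, measurable (Q a)) (Qfin : forall a, (m (Q a) < +oo)%E)
  (Qtau : forall a i B, small 1 i -> measurable B ->
    (m (Q a `&` tau i @^-1` B) <= m (Q (a + 1) `&` B))%E)
  (QS : forall a, Q a `<=` Q (a + 1)).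

Definition flip i (A : set S) := [set x | ~ (A x <-> A (tau i x))].

Lemma flipE i A : flip i A = (A `\` tau i @^-1` A) `|` (tau i @^-1` A `\` A).
Proof.
apply/seteqP; split=> x; rewrite /flip/=; last by case=> -[? ?]; tauto.
move=> h; have [Ax|nAx] := pselect (A x).
  by left; split => // At; apply: h; split.
right; split => //; apply: contrapT => nAt; apply: h; split => //.
Qed.

Lemma measurable_flip i A : measurable A -> measurable (flip i A).
Proof.
move=> mA; have mtA : measurable (tau i @^-1` A).
  by rewrite -[X in measurable X]setTI; exact: mtau.
by rewrite flipE; apply: measurableU; exact: measurableD.
Qed.

Definition mcont (A : set S) := measurable A /\ forall a e : R, 0 < e ->
  exists2 r, 0 < r & forall i, small r i -> (m (Q a `&` flip i A) <= e%:E)%E.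

Lemma mcontC A : mcont A -> mcont (~` A).
Proof.
move=> [mA cA]; split; first exact: measurableC.
move=> a e e0; have [r r0 hr] := cA a e e0; exists r => // i /hr.
suff -> : flip i (~` A) = flip i A by [].
rewrite !flipE !setDE -preimage_setC !setCK setUC; congr (_ `|` _); rewrite setIC//.
Qed.

Lemma mcont0 : mcont set0.
Proof.
split => // a e e0; exists 1 => // i _.
rewrite flipE preimage_set0 setDv setU0 setI0 measure0 lee_fin; exact: ltW.
Qed.

Lemma mcontU A B : mcont A -> mcont B -> mcont (A `|` B).
Proof.
move=> [mA cA] [mB cB]; split; first exact: measurableU.
move=> a e e0; have e20 : 0 < e / 2 by rewrite divr_gt0.
have [r r0 hr] := cA a _ e20; have [r' r'0 hr'] := cB a _ e20.
exists (Num.min r r'); first by rewrite lt_min r0.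
move=> i si.
have si1 : small r i by apply: smallW si; rewrite ge_min lexx.
have si2 : small r' i by apply: smallW si; rewrite ge_min lexx orbT.
rewrite (splitr e) EFinD; apply: le_trans (leeD (hr _ si1) (hr' _ si2)).
apply: (@le_trans _ _ (m ((Q a `&` flip i A) `|` (Q a `&` flip i B)))); last first.
  by apply: measureU2; apply: measurableI => //; exact: measurable_flip.
have mI C : measurable C -> measurable (Q a `&` flip i C).
  by move=> mC; apply: measurableI => //; exact: measurable_flip.
apply: le_measure; rewrite ?inE.
- by apply: mI; exact: measurableU.
- by apply: measurableU; exact: mI.
- rewrite -setIUr; apply: setIS => x; rewrite /flip/= => h.
  have [hA|] := pselect (A x <-> A (tau i x)); last by left.
  have [hB|] := pselect (B x <-> B (tau i x)); last by right.
  by exfalso; apply: h; rewrite hA hB.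
Qed.

(** On [Q (a + 1)], of finite measure, the union is a finite union up to a small remainder; the remainder and its
preimage are both small on [Q a]. *)
Lemma mcont_bigcup (F : (set S)^nat) : (forall k, mcont (F k)) -> mcont (\bigcup_k F k).
Proof.
move=> cF; have mF k : measurable (F k) by case: (cF k).
have mU := bigcup_measurable (fun k (_ : setT k) => mF k).
split=> // a e e0.
pose U N := \big[setU/set0]_(k < N) F k.
have cU N : mcont (U N).
  by rewrite /U; elim/big_ind : _ => //; [exact: mcont0|exact: mcontU].
pose V N := \bigcup_k F k `\` U N.
have mV N : measurable (V N) by apply: measurableD => //; case: (cU N).
have UF N : U N `<=` \bigcup_k F k.
  by rewrite /U -bigcup_mkord => x [k _ Fkx]; exists k.
have V0 : (m (Q (a + 1) `&` V N) @[N --> \oo] --> 0)%E.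
  rewrite -(measure0 m).
  have -> : set0 = \bigcap_N (Q (a + 1) `&` V N).
    apply/seteqP; split => // x xV.
    have [_ [[k _ Fkx] _]] := xV 0%N I.
    have [_ [_]] := xV k.+1 I; apply.
    by rewrite /U -bigcup_mkord; exists k => //=.
  apply: nonincreasing_cvg_mu.
  - rewrite (le_lt_trans _ (Qfin (a + 1)))//; apply: le_measure; rewrite ?inE//.
    exact: measurableI.
  - by move=> N; exact: measurableI.
  - by apply: bigcapT_measurable => N; exact: measurableI.
  - move=> p q pq; apply/subsetPset; apply: setIS; apply: setDS.
    by rewrite /U -!bigcup_mkord => x [k kp Fkx]; exists k => //=; exact: leq_trans pq.
have [N hN] : exists N, (m (Q (a + 1) `&` V N) <= (e / 4)%:E)%E.
  by apply: cvge0_le V0 _; rewrite divr_gt0.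
have e20 : 0 < e / 2 by rewrite divr_gt0.
have [_ /(_ a _ e20)[r r0 hr]] := cU N.
exists (Num.min r 1); first by rewrite lt_min r0 ltr01.
move=> i si.
have si1 : small r i by apply: smallW si; rewrite ge_min lexx.
have si2 : small 1 i by apply: smallW si; rewrite ge_min lexx orbT.
have mtV : measurable (tau i @^-1` V N).
  by rewrite -[X in measurable X]setTI; exact: mtau.
have mfU : measurable (flip i (U N)) by apply: measurable_flip; case: (cU N).
have hV : (m (Q a `&` V N) <= (e / 4)%:E)%E.
  apply: le_trans hN; apply: le_measure; rewrite ?inE; [exact: measurableI|exact: measurableI|].
  exact: setSI.
have htV : (m (Q a `&` tau i @^-1` V N) <= (e / 4)%:E)%E.
  by apply: le_trans hN; exact: Qtau.
rewrite (_ : e = e / 2 + (e / 4 + e / 4)); last by field.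
rewrite !EFinD; apply: le_trans (leeD (hr _ si1) (leeD hV htV)).
apply: (@le_trans _ _ (m ((Q a `&` flip i (U N)) `|` ((Q a `&` V N) `|` (Q a `&` tau i @^-1` V N))))).
  apply: le_measure; rewrite ?inE.
  - by apply: measurableI => //; exact: measurable_flip.
  - by do !apply: measurableU; exact: measurableI.
  rewrite -!setIUr; apply: setIS => x h.
  have [hU|] := pselect (U N x <-> U N (tau i x)); last by left.
  have [Vx|nVx] := pselect (V N x); first by right; left.
  have [Vtx|nVtx] := pselect (V N (tau i x)); first by right; right.
  exfalso; apply: h; split => hx.
    apply: UF; apply/hU; apply: contrapT => nU; exact: nVx.
  apply: UF; apply/hU; apply: contrapT => nU; exact: nVtx.
apply: le_trans (measureU2 _ _ _) _; rewrite ?leeD2l//.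
- exact: measurableI.
- by apply: measurableU; exact: measurableI.
- by apply: measureU2; exact: measurableI.
Qed.

(** The sets moved little by small shifts form a sigma-algebra. *)
Lemma mcont_generated (G : set (set S)) : G `<=` mcont -> <<s G >> `<=` mcont.
Proof.
apply: smallest_sub; split; first exact: mcont0.
- by move=> A cA; rewrite setTD; exact: mcontC.
- exact: mcont_bigcup.
Qed.

End continuity_in_measure.

Section translation_continuity.
Context {R : realType} {n : nat}.
Local Notation T := (Rn R n).
Local Notation mu := (@lebesgue_Rn R n).

Definition coord_small (r : R) (h : T) := forall i, `|co h i| <= r.
Definition centered_box (a : R) : set T := ebox (fun=> - a) (fun=> a).

Let smallW r r' (h : T) : r <= r' -> coord_small r h -> coord_small r' h.
Proof. by move=> rr' hr i; apply: le_trans rr'. Qed.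

Let boxS a : centered_box a `<=` centered_box (a + 1).
Proof.
move=> x /= + i => /(_ i)/=; rewrite !in_itv/= => /andP[? ?].
by apply/andP; split; lra.
Qed.

Let mbox a : measurable (centered_box a).
Proof. exact: measurable_box. Qed.

Lemma centered_box_lty a : (mu (centered_box a) < +oo)%E.
Proof.
have [a0|a0] := leP 0 a.
  by rewrite (@lebesgue_Rn_cube _ _ _ _ (2 * a)) ?ltry ?mulr_ge0// => i; ring.
apply: le_lt_trans (_ : (mu (centered_box 0) < +oo)%E).
  apply: le_measure; rewrite ?inE; [exact: mbox|exact: mbox|].
  move=> x /= + i => /(_ i)/=; rewrite !in_itv/= => /andP[? ?].
  by apply/andP; split; lra.
by rewrite (@lebesgue_Rn_cube _ _ _ _ 0) ?ltry// => i; ring.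
Qed.

Let box_shift a (h : T) B : coord_small 1 h -> measurable B ->
  (mu (centered_box a `&` (vadd^~ h) @^-1` B) <= mu (centered_box (a + 1) `&` B))%E.
Proof.
move=> h1 mB.
have mI : measurable (centered_box (a + 1) `&` B) by apply: measurableI => //; exact: mbox.
rewrite -(lebesgue_Rn_translate h mI); apply: le_measure; rewrite ?inE.
- apply: measurableI; first exact: mbox.
  by rewrite -[X in measurable X]setTI; exact: measurable_translation.
- by rewrite -[X in measurable X]setTI; exact: measurable_translation.
- rewrite preimage_setI; apply: setSI => x /= xa i /=; rewrite in_itv/=.
  have := xa i; have := h1 i; rewrite /= in_itv/= ler_norml -!/(co _ i) co_mkv.
  by move=> /andP[? ?] /andP[? ?]; apply/andP; split; lra.
Qed.

Let interval1 (a b h : R) (r : R) : 0 <= r -> `|h| <= r ->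
  [set x | ~ (x \in `]a, b] <-> x + h \in `]a, b])] `<=`
  `[a - r, a + r] `|` `[b - r, b + r].
Proof.
move=> r0; rewrite ler_norml => /andP[h1 h2] x /= hx.
rewrite !in_itv/=.
apply: contrapT => /not_orP[/negP xa /negP xb]; apply: hx.
rewrite !in_itv/= in xa xb *.
by split => /andP[? ?]; apply/andP; split; lra.
Qed.

Local Notation leb := (@lebesgue_measure R).
Let small1 (r h : R) := `|h| <= r.
Let tau1 (h : R) : measurableTypeR R -> measurableTypeR R := fun x => x + h.
Let Q1 (a : R) : set (measurableTypeR R) := [set` `[- a, a]].

Let mtau1 h : measurable_fun setT (tau1 h).
Proof. exact: measurable_funD. Qed.

Let lebQ1 a : leb (Q1 a) = (Num.max (2 * a) 0)%:E.
Proof.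
rewrite /Q1 lebesgue_measure_itv/= lte_fin; case: ifPn => [aa|aa].
  by rewrite -EFinB; congr EFin; rewrite max_l; lra.
by rewrite max_r//; lra.
Qed.

Let small1W r r' h : r <= r' -> small1 r h -> small1 r' h.
Proof. by move=> rr' /le_trans; exact. Qed.

Let Q1_lty a : (leb (Q1 a) < +oo)%E.
Proof. by rewrite lebQ1 ltry. Qed.

Let Q1_shift a h B : small1 1 h -> measurable B ->
  (leb (Q1 a `&` tau1 h @^-1` B) <= leb (Q1 (a + 1) `&` B))%E.
Proof.
move=> h1 mB.
have mI : measurable (Q1 (a + 1) `&` B) by apply: measurableI => //; exact: measurable_itv.
rewrite -(lebesgue_measure_translate h mI); apply: le_measure; rewrite ?inE.
- apply: measurableI; first exact: measurable_itv.
  by rewrite -[X in measurable X]setTI; exact: mtau1.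
- by rewrite -[X in measurable X]setTI; exact: mtau1.
- rewrite preimage_setI; apply: setSI => x; rewrite /Q1/= !in_itv/=.
  move: h1; rewrite /small1 ler_norml.
  by move=> /andP[? ?] /andP[? ?]; apply/andP; split; lra.
Qed.

Let Q1S a : Q1 a `<=` Q1 (a + 1).
Proof.
move=> x; rewrite /Q1/= !in_itv/= => /andP[? ?].
by apply/andP; split; lra.
Qed.

(** A translation by at most [r] changes the membership in an interval only for points within [r] of an endpoint. *)
Let mcont1 (B : set (measurableTypeR R)) : measurable B -> mcont leb small1 tau1 Q1 B.
Proof.
have mQ1 a : measurable (Q1 a) by exact: measurable_itv.
have gen := mcont_generated small1W mtau1 mQ1 Q1_lty Q1_shift Q1S (G := @ocitv R).
apply: gen => _ [[a b] _ <-]; split; first exact: measurable_itv.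
move=> c e e0; exists (e / 4); first by rewrite divr_gt0.
move=> h hr; have r0 : 0 <= e / 4 by rewrite divr_ge0// ltW.
have mU : measurable (`[a - e / 4, a + e / 4] `|` `[b - e / 4, b + e / 4] : set (measurableTypeR R)).
  by apply: measurableU; exact: measurable_itv.
apply: (@le_trans _ _ (leb (`[a - e / 4, a + e / 4] `|` `[b - e / 4, b + e / 4]))).
  apply: le_measure; rewrite ?inE//.
    apply: measurableI; first exact: mQ1.
    by apply: measurable_flip => //; exact: measurable_itv.
  by move=> x [_ fx]; exact: (interval1 r0 hr).
apply: le_trans (measureU2 _ _ _) _; [exact: measurable_itv|exact: measurable_itv|].
have q0 : 0 < e / 4 by rewrite divr_gt0.
have len (t : R) : (lebesgue_measure [set` `[(t - e / 4)%R, (t + e / 4)%R]] <= (2 * (e / 4))%:E)%E.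
  rewrite lebesgue_measure_itv/= lte_fin ifT; last lra.
  by rewrite -EFinB lee_fin; lra.
by apply: (le_trans (leeD (len a) (len b))); rewrite -EFinD lee_fin; lra.
Qed.

(** A translation changes the membership in a cylinder through one coordinate only, which reduces the claim to the
line. *)
Lemma cylinder_mcont (i0 : 'I_n) (B : set (measurableTypeR R)) : measurable B ->
  mcont mu coord_small (fun h x => vadd x h) centered_box [set x | B (co x i0)].
Proof.
move=> mB; split.
  by rewrite -[X in measurable X]setTI; exact: (measurable_co i0).
move=> a e e0; pose L := Num.max (2 * a) 0.
have L0 : 0 <= L by rewrite le_max lexx orbT.
have e'0 : 0 < e / (L ^+ n.-1 + 1).
  by rewrite divr_gt0// ltr_wpDl// exprn_ge0.
have [_ /(_ a _ e'0)[r r0 hr]] := mcont1 mB.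
exists r => // h hs.
pose A j : set (measurableTypeR R) := if j == i0 then Q1 a `&` flip tau1 (co h j) B else Q1 a.
have mA j : measurable (A j).
  rewrite /A; case: ifP => _; last exact: measurable_itv.
  apply: measurableI; first exact: measurable_itv.
  exact: measurable_flip.
rewrite (_ : _ `&` _ = [set x : T | forall i, A i (tnth x i)]); last first.
  apply/seteqP; split => x /=.
    move=> [xQ xf] i; rewrite /A; case: eqP => [->|_]; last exact: xQ.
    split; first exact: xQ.
    by move: xf; rewrite /flip/= co_mkv.
  move=> xA; split.
    move=> i; have := xA i; rewrite /A; case: ifP => // _; first by case.
  by have := xA i0; rewrite /A eqxx /flip/= co_mkv => -[].
rewrite [X in (X <= _)%E](lebesgue_Rn_box mA) (bigD1 i0)//=.
rewrite (eq_bigr (fun=> L%:E)); last first.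
  by move=> i ii0; rewrite /A (negbTE ii0) lebQ1.
rewrite prodEFin prodr_const cardC1 card_ord /A eqxx.
apply: (@le_trans _ _ ((e / (L ^+ n.-1 + 1))%:E * (L ^+ n.-1)%:E))%E.
  by apply: lee_wpmul2r; [rewrite lee_fin exprn_ge0|exact: (hr _ (hs i0))].
rewrite -EFinM lee_fin mulrAC ler_pdivrMr; last by rewrite ltr_wpDl// exprn_ge0.
by rewrite ler_wpM2l ?(ltW e0)// lerDl.
Qed.

(** The cylinders generate the product sigma-algebra. *)
Lemma translation_mcont (A : set T) : measurable A ->
  mcont mu coord_small (fun h x => vadd x h) centered_box A.
Proof.
have gen := mcont_generated smallW measurable_translation mbox centered_box_lty box_shift boxS.
apply: gen.
apply: (big_ind (fun G : set (set T) => G `<=` mcont mu coord_small (fun h x => vadd x h) centered_box)) => //.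
- by move=> G G' hG hG'; rewrite subUset.
- by move=> i _ _ [B mB <-]; rewrite setTI; exact: cylinder_mcont.
Qed.

Lemma coord_small_enorm r (h : T) : enorm h <= r -> coord_small r h.
Proof.
move=> hr i; apply: le_trans hr; rewrite -sqrtr_sqr enormE ler_sqrt ?dot_ge0//.
rewrite /dot (bigD1 i)//= expr2 lerDl.
by apply: sumr_ge0 => j _; rewrite -expr2 sqr_ge0.
Qed.

Lemma unit_ball_box a : 1 <= a -> unit_ball `<=` centered_box a.
Proof.
move=> a1 x x1; have /coord_small_enorm cx : enorm x <= a by rewrite (le_trans (ltW x1)).
by move=> i /=; rewrite in_itv/=; have := cx i; rewrite ler_norml.
Qed.

End translation_continuity.

Section bounded_functions.
Context {R : realType} {n : nat}.
Local Notation T := (Rn R n).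
Local Notation mu := (@lebesgue_Rn R n).
Variables (u : T -> R) (M : R).
Hypotheses (umeas : measurable_fun setT u) (u0 : forall x, 0 <= u x <= M)
  (uB : forall x, ~ unit_ball x -> u x = 0).

Lemma measurable_shift_gap (h : T) (e : R) :
  measurable [set x | e < `|u (vadd x h) - u x|].
Proof.
apply: measurable_gt; apply: (measurableT_comp (@normr_measurable R setT)).
apply: measurable_funB => //.
by apply: (measurableT_comp umeas); exact: measurable_translation.
Qed.

(** A value jump larger than [delta] crosses one of finitely many levels [k * delta], so it is seen by the
translates of finitely many superlevel sets. *)
Lemma shift_continuity_in_measure (delta e : R) : 0 < delta -> 0 < e ->
  exists2 r, 0 < r & forall h, enorm h <= r ->
    (mu [set x | (delta < `|u (vadd x h) - u x|)%R] <= e%:E)%E.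
Proof.
move=> d0 e0; pose N := (Num.truncn (M / delta)).+1.
pose A (k : nat) := [set x | k%:R * delta < u x].
have mA k : measurable (A k) by exact: measurable_gt.
pose e' := e / N%:R; have e'0 : 0 < e' by rewrite divr_gt0// ltr0n.
have [r /andP[r0 r1] hr] : exists2 r : R, 0 < r <= 1 & forall h, coord_small r h -> forall k : nat, (k < N)%N ->
    (mu (centered_box 2 `&` flip (fun h x => vadd x h) h (A k)) <= e'%:E)%E.
  elim: (N) => [|K [r /andP[r0 r1] hr]]; first by exists 1; rewrite ?ltr01 ?lexx.
  have [_ /(_ 2 _ e'0)[r' r'0 hr']] := translation_mcont (mA K).
  exists (Num.min r r'); first by rewrite lt_min r0 r'0 ge_min r1.
  move=> h hh k; rewrite ltnS leq_eqVlt => /orP[/eqP ->|kK].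
    by apply: hr' => i; rewrite (le_trans (hh i))// ge_min lexx orbT.
  by apply: hr kK => i; rewrite (le_trans (hh i))// ge_min lexx.
exists r => // h hh; have hs := coord_small_enorm hh.
have M0 : 0 <= M by have /andP[] := u0 (mkv (fun=> 0)); exact: le_trans.
pose F k := centered_box 2 `&` flip (fun h x => vadd x h) h (A k).
have mF k : measurable (F k).
  apply: measurableI; first exact: measurable_box.
  by apply: measurable_flip => //; exact: measurable_translation.
apply: (@le_trans _ _ (mu (\big[setU/set0]_(k < N) F k))).
  apply: le_measure; rewrite ?inE; first exact: measurable_shift_gap.
    by apply: bigsetU_measurable.
  move=> x /= jump; rewrite -bigcup_mkord.
  have xQ : centered_box 2 x.
    have [xB|/uB ux] := pselect (unit_ball x).
      by apply: unit_ball_box xB; lra.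
    have [xhB|/uB uxh] := pselect (unit_ball (vadd x h)); last first.
      by move: jump; rewrite ux uxh subrr normr0 ltNge (ltW d0).
    move=> i /=; have := @unit_ball_box R n 1 (lexx _) _ xhB i; have := hs i.
    rewrite /= !in_itv/= -!/(co _ i) co_mkv ler_norml => /andP[? ?] /andP[? ?].
    by apply/andP; split; lra.
  pose lo := Num.min (u (vadd x h)) (u x); pose hi := Num.max (u (vadd x h)) (u x).
  have lohi : lo + delta < hi.
    by move: jump; rewrite /lo /hi; case: (leP (u (vadd x h)) (u x)) => ?;
      [rewrite ler0_norm ?subr_le0// | rewrite gtr0_norm ?subr_gt0//]; lra.
  have lo0 : 0 <= lo.
    by rewrite /lo le_min; have /andP[-> _] := u0 x; have /andP[-> _] := u0 (vadd x h).
  have hiM : hi <= M.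
    by rewrite /hi ge_max; have /andP[_ ->] := u0 x; have /andP[_ ->] := u0 (vadd x h).
  (* the first multiple of [delta] above [lo], which is below [hi] since [hi - lo > delta] *)
  pose k := (Num.truncn (lo / delta)).+1.
  have /andP[k1 k2] : k.-1%:R <= lo / delta < k%:R.
    by apply: truncn_itv; rewrite divr_ge0// ltW.
  have klo : lo < k%:R * delta by rewrite -ltr_pdivrMr.
  have khi : k%:R * delta < hi.
    by apply: le_lt_trans lohi; rewrite -natr1 mulrDl mul1r lerD2r -ler_pdivlMr.
  exists k => /=.
    rewrite /N ltnS truncn_ge_nat; last by rewrite divr_ge0// ltW.
    by rewrite ler_pdivlMr// (le_trans (ltW khi)).
  split=> //; rewrite /flip /A/= => -[h1 h2].
  move: klo khi h1 h2; rewrite /lo /hi.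
  case: (leP (u (vadd x h)) (u x)) => _ klo khi h1 h2.
    by have := h1 khi; rewrite ltNge (ltW klo).
  by have := h2 khi; rewrite ltNge (ltW klo).
apply: le_trans (Boole_inequality mu (n := N) _) _ => //.
apply: (@le_trans _ _ (\sum_(k < N) e'%:E)%E).
  by apply: lee_sum => k _; exact: hr.
by rewrite sumEFin sumr_const card_ord -[_ *+ N]mulr_natr /e' divfK// pnatr_eq0.
Qed.

End bounded_functions.

(** * Pointwise inequalities for the power nonlinearity and the kernel *)
Section power_monotone.
Context {R : realType}.
Implicit Types (p q t a b M : R).

(** Bernoulli's inequality for exponents at most one, as a case of Young's inequality. *)
Lemma powR_bernoulli q t : 0 < q <= 1 -> 0 <= t -> t `^ q <= 1 + q * (t - 1).
Proof.
move=> /andP[q0 q1] t0; have [->|qn1] := eqVneq q 1.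
  by rewrite powRr1// mul1r; lra.
have q1' : 0 < 1 - q by rewrite subr_gt0 lt_neqAle qn1.
have := @conjugate_powR R (t `^ q) 1 q^-1 (1 - q)^-1 (powR_ge0 _ _) ler01.
rewrite !invr_gt0 !invrK => /(_ q0 q1'); rewrite -powRrM divff ?gt_eqF//.
rewrite powRr1// powR1 mulr1 mul1r subrKC => /(_ erefl); lra.
Qed.

Lemma GpN p t : Gp p (- t) = - Gp p t.
Proof. by rewrite /Gp normrN mulrN. Qed.

Lemma ge0_GpE p t : 1 < p -> 0 <= t -> Gp p t = t `^ (p - 1).
Proof.
move=> p1 t0; rewrite /Gp ger0_norm// mulrC (_ : p - 2 = p - 1 - 1); last by ring.
by rewrite mulr_powRB1// subr_gt0.
Qed.

Lemma Gp0 p : Gp p 0 = 0.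
Proof. by rewrite /Gp mulr0. Qed.

Lemma Gp_gt0 p t : 1 < p -> 0 < t -> 0 < Gp p t.
Proof. by move=> p1 t0; rewrite ge0_GpE ?(ltW t0)// powR_gt0. Qed.

Lemma normr_Gp p t : 1 < p -> `|Gp p t| = `|t| `^ (p - 1).
Proof.
move=> p1; rewrite /Gp normrM ger0_norm ?powR_ge0//.
rewrite mulrC (_ : p - 2 = p - 1 - 1); last by ring.
by rewrite mulr_powRB1// subr_gt0.
Qed.

Let ge0_Gp_lower p M a b : 1 < p <= 2 -> 0 < M -> 0 <= b -> b <= a -> a <= M ->
  (p - 1) * M `^ (p - 2) * (a - b) <= Gp p a - Gp p b.
Proof.
move=> /andP[p1 p2] M0 b0 ba aM; have a0 : 0 <= a by exact: le_trans ba.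
move: a0; rewrite le_eqVlt => /predU1P[a0|a0].
  have -> : b = 0 by apply/eqP; rewrite eq_le b0 a0 ba.
  by rewrite -a0 !subrr mulr0.
rewrite !ge0_GpE// ?(ltW a0)//; set q := p - 1.
have q0 : 0 < q by rewrite subr_gt0.
have q1 : q <= 1 by rewrite /q; lra.
have t0 : 0 <= b / a by rewrite divr_ge0// ltW.
have := @powR_bernoulli q (b / a); rewrite q0 q1 => /(_ erefl t0) bern.
have -> : b `^ q = (b / a) `^ q * a `^ q by rewrite -powRM ?divfK ?gt_eqF// ltW.
have aq : a `^ q = a * a `^ (p - 2).
  by rewrite -[LHS]mulr_powRB1 ?(ltW a0)//; congr (_ * _ `^ _); rewrite /q; ring.
have Ma : M `^ (p - 2) <= a `^ (p - 2).
  have -> : p - 2 = - (2 - p) by ring.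
  rewrite !powRN lef_pV2 ?posrE ?powR_gt0//.
  by apply: ge0_ler_powR; rewrite ?nnegrE ?subr_ge0 ?(ltW a0) ?(ltW M0).
have -> : a `^ q - (b / a) `^ q * a `^ q = (1 - (b / a) `^ q) * a `^ q by ring.
apply: (@le_trans _ _ (q * (1 - b / a) * a `^ q)); last first.
  by apply: ler_wpM2r; [exact: powR_ge0|lra].
rewrite aq (_ : q * (1 - b / a) * _ = q * (a - b) * a `^ (p - 2)); last first.
  by field; rewrite gt_eqF.
rewrite mulrAC; apply: ler_wpM2l => //.
by rewrite mulr_ge0 ?subr_ge0// ltW.
Qed.

(** On bounded arguments [t |-> |t|^(p-2) t] is uniformly monotone when [p <= 2]: its slope
[(p - 1) |t|^(p-2)] is smallest at the largest [|t|]. *)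
Lemma Gp_lower p M a b : 1 < p <= 2 -> 0 < M -> - M <= b -> b <= a -> a <= M ->
  (p - 1) * M `^ (p - 2) * (a - b) <= Gp p a - Gp p b.
Proof.
move=> p12 M0 Mb ba aM; have [b0|b0] := leP 0 b; first exact: ge0_Gp_lower.
have [a0|a0] := leP 0 a; last first.
  have := @ge0_Gp_lower p M (- b) (- a) p12 M0; rewrite !GpN; lra.
have := @ge0_Gp_lower p M a 0 p12 M0 (lexx _) a0 aM.
have := @ge0_Gp_lower p M (- b) 0 p12 M0 (lexx _).
rewrite Gp0 GpN; lra.
Qed.

End power_monotone.

Section four_points.
Context {R : realFieldType}.
Variables (g : R -> R) (c M : R).
Hypothesis c0 : 0 <= c.
Hypothesis gmono : forall x y, - M <= y -> y <= x -> x <= M -> c * (x - y) <= g x - g y.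

Section ineq.
Variables (a a' b b' K1 K2 : R).
Hypotheses (aM : 0 <= a <= M) (a'M : 0 <= a' <= M) (bM : 0 <= b <= M) (b'M : 0 <= b' <= M).
Hypotheses (K20 : 0 <= K2) (K21 : K2 <= K1).

Definition four_point_sum :=
  (g (a - b) - g (a' - b')) * (Num.max (a - a') 0 - Num.max (b - b') 0) * K1 +
  (g (a - b') - g (a' - b)) * (Num.max (a - a') 0 + Num.max (b - b') 0) * K2.

(** This sum collects the four reflected copies of the weak form at a pair of points on the same side of a hyperplane:
[a, b] are the values of the solution there, [a', b'] those at the mirror images, and [K1, K2] the kernels of the pair
and of the pair with one point reflected. The first bound is coercivity; the second one is linear in the positive part
of [a - a'], so that it dominates the quadratic terms where this part is small.

The only delicate case is when [a - a'] and [b - b'] have opposite signs. Then the coefficient of [K2]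
may be negative, but the one of [K1] is not and their sum is controlled, whence [K2 <= K1] suffices. *)
Lemma four_point_lower :
  c * ((Num.max (a - a') 0 - Num.max (b - b') 0) ^+ 2 * K1 +
       (Num.max (a - a') 0 + Num.max (b - b') 0) ^+ 2 * K2) <= four_point_sum /\
  c * Num.max (a - a') 0 * Num.max (b' - b) 0 * (K1 - K2) <= four_point_sum.
Proof.
move: aM a'M bM b'M => /andP[a0 a1] /andP[a'0 a'1] /andP[b0 b1] /andP[b'0 b'1].
have K10 : 0 <= K1 by exact: le_trans K21.
have K120 : 0 <= K1 - K2 by rewrite subr_ge0.
rewrite /four_point_sum.
have [aa'|aa'] := leP (a - a') 0; have [bb'|bb'] := leP (b - b') 0.
- by rewrite !subrr !addr0 !mulr0 !mul0r !add0r !expr0n/= !mul0r ?addr0 ?mulr0; split.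
- have P1 : c * ((b - b') + (a' - a)) <= g (a' - b') - g (a - b).
    have -> : b - b' + (a' - a) = (a' - b') - (a - b) by ring.
    by apply: gmono; lra.
  have P2 : c * (b - b') <= g (a - b') - g (a - b).
    have -> : b - b' = (a - b') - (a - b) by ring.
    by apply: gmono; lra.
  have P3 : c * (b - b') <= g (a' - b') - g (a' - b).
    have -> : b - b' = (a' - b') - (a' - b) by ring.
    by apply: gmono; lra.
  have y0 : 0 <= b - b' by exact: ltW.
  have z0 : 0 <= c * (a' - a) by apply: mulr_ge0 => //; lra.
  have -> : (g (a - b) - g (a' - b')) * (0 - (b - b')) * K1 +
      (g (a - b') - g (a' - b)) * (0 + (b - b')) * K2 =
    (b - b') * ((g (a' - b') - g (a - b)) * (K1 - K2) +
      ((g (a - b') - g (a - b)) + (g (a' - b') - g (a' - b))) * K2) by ring.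
  have E1 : c * (b - b') * (K1 - K2) <= (g (a' - b') - g (a - b)) * (K1 - K2).
    by apply: ler_wpM2r => //; lra.
  have E2 : 2 * c * (b - b') * K2 <= ((g (a - b') - g (a - b)) + (g (a' - b') - g (a' - b))) * K2.
    by apply: ler_wpM2r => //; lra.
  split.
    have -> : c * ((0 - (b - b')) ^+ 2 * K1 + (0 + (b - b')) ^+ 2 * K2) =
      (b - b') * (c * (b - b') * (K1 - K2) + 2 * c * (b - b') * K2) by ring.
    by apply: ler_wpM2l => //; lra.
  rewrite mulr0 !mul0r; apply: mulr_ge0 => //.
  have : 0 <= c * (b - b') * (K1 - K2) by rewrite !mulr_ge0.
  have : 0 <= 2 * c * (b - b') * K2 by rewrite !mulr_ge0.
  lra.
- have P1 : c * ((a - a') + (b' - b)) <= g (a - b) - g (a' - b').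
    have -> : a - a' + (b' - b) = (a - b) - (a' - b') by ring.
    by apply: gmono; lra.
  have P2 : c * (a - a') <= g (a - b) - g (a' - b).
    have -> : a - a' = (a - b) - (a' - b) by ring.
    by apply: gmono; lra.
  have P3 : c * (a - a') <= g (a - b') - g (a' - b').
    have -> : a - a' = (a - b') - (a' - b') by ring.
    by apply: gmono; lra.
  have y0 : 0 <= a - a' by exact: ltW.
  have w0 : 0 <= b' - b by lra.
  have z0 : 0 <= c * (b' - b) by exact: mulr_ge0.
  have -> : (g (a - b) - g (a' - b')) * (a - a' - 0) * K1 +
      (g (a - b') - g (a' - b)) * (a - a' + 0) * K2 =
    (a - a') * ((g (a - b) - g (a' - b')) * (K1 - K2) +
      ((g (a - b) - g (a' - b)) + (g (a - b') - g (a' - b'))) * K2) by ring.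
  have E1 : c * ((a - a') + (b' - b)) * (K1 - K2) <= (g (a - b) - g (a' - b')) * (K1 - K2).
    by apply: ler_wpM2r.
  have E2 : 2 * c * (a - a') * K2 <= ((g (a - b) - g (a' - b)) + (g (a - b') - g (a' - b'))) * K2.
    by apply: ler_wpM2r => //; lra.
  have F1 : 0 <= c * (b' - b) * (K1 - K2) by rewrite mulr_ge0.
  have F2 : 0 <= c * (a - a') * (K1 - K2) by rewrite !mulr_ge0.
  have F3 : 0 <= 2 * c * (a - a') * K2 by rewrite !mulr_ge0.
  split.
    have -> : c * ((a - a' - 0) ^+ 2 * K1 + (a - a' + 0) ^+ 2 * K2) =
      (a - a') * (c * (a - a') * (K1 - K2) + 2 * c * (a - a') * K2) by ring.
    by apply: ler_wpM2l => //; lra.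
  rewrite (max_l w0).
  have -> : c * (a - a') * (b' - b) * (K1 - K2) = (a - a') * (c * (b' - b) * (K1 - K2)) by ring.
  by apply: ler_wpM2l => //; lra.
- have sq x y : - M <= x -> x <= M -> - M <= y -> y <= M -> c * (x - y) ^+ 2 <= (g x - g y) * (x - y).
    move=> ? ? ? ?; have [xy|xy] := leP y x.
      by rewrite expr2 mulrA; apply: ler_wpM2r; [lra|exact: gmono].
    rewrite expr2 mulrA -[leRHS]mulrNN -[leLHS]mulrNN; apply: ler_wpM2r; first lra.
    have : c * (y - x) <= g y - g x by apply: gmono => //; exact: ltW.
    by lra.
  have S1 := sq (a - b) (a' - b'); have S2 := sq (a - b') (a' - b).
  have A1 : c * (a - a' - (b - b')) ^+ 2 * K1 <= (g (a - b) - g (a' - b')) * (a - a' - (b - b')) * K1.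
    apply: ler_wpM2r => //; have -> : a - a' - (b - b') = a - b - (a' - b') by ring.
    by apply: S1; lra.
  have A2 : c * (a - a' + (b - b')) ^+ 2 * K2 <= (g (a - b') - g (a' - b)) * (a - a' + (b - b')) * K2.
    apply: ler_wpM2r => //; have -> : a - a' + (b - b') = a - b' - (a' - b) by ring.
    by apply: S2; lra.
  split; first by rewrite mulrDr !mulrA; lra.
  have -> : Num.max (b' - b) 0 = 0 by rewrite max_r//; lra.
  rewrite mulr0 mul0r; apply: le_trans (lerD A1 A2).
  by apply: addr_ge0; apply: mulr_ge0 => //; apply: mulr_ge0 => //; exact: sqr_ge0.
Qed.

End ineq.
End four_points.

Section kernel.
Context {R : realType} {n : nat}.
Local Notation T := (Rn R n).
Variables (N : R) (N0 : 0 < N).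
Implicit Types (x y z : T).

Definition ker x y : R := (edist x y `^ N)^-1.

Lemma ker_ge0 x y : 0 <= ker x y.
Proof. by rewrite invr_ge0 powR_ge0. Qed.

Lemma kerC x y : ker x y = ker y x.
Proof. by rewrite /ker edistC. Qed.

Lemma edist_gt0 x y : x <> y -> 0 < edist x y.
Proof.
move=> xy; rewrite lt_neqAle edist_ge0 andbT eq_sym; apply/eqP => /edist_eq0.
exact: xy.
Qed.

Lemma le_ker x y z w : x <> y -> edist x y <= edist z w -> ker z w <= ker x y.
Proof.
move=> xy d; have d0 := edist_gt0 xy.
rewrite lef_pV2 ?posrE ?powR_gt0//; last exact: lt_le_trans d.
by apply: ge0_ler_powR; rewrite ?nnegrE ?edist_ge0 ?(ltW N0).
Qed.

Lemma ker_ge x y (D : R) : x <> y -> edist x y <= D -> (D `^ N)^-1 <= ker x y.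
Proof.
move=> xy d; have d0 := edist_gt0 xy.
rewrite lef_pV2 ?posrE ?powR_gt0//; last exact: lt_le_trans d.
by apply: ge0_ler_powR; rewrite ?nnegrE ?edist_ge0 ?(ltW N0) ?(le_trans (edist_ge0 x y) d).
Qed.

Lemma measurable_ker : measurable_fun setT (fun z : T * T => ker z.1 z.2).
Proof.
rewrite /ker; under eq_fun do rewrite -powRN.
by apply: (measurableT_comp (@measurable_powR R (- N))); exact: measurable_edist2.
Qed.

(** The ratio of the kernels is a power of the ratio of the squared distances, and the latter stays away from one since
the distances are bounded; the larger kernel is itself bounded below. *)
Lemma ker_gap (D e : R) : 0 < D -> 0 < e <= D ^+ 2 -> exists2 k : R, 0 < k &
  forall x y z w, x <> y -> edist z w <= D ->
    edist x y ^+ 2 + e <= edist z w ^+ 2 -> k <= ker x y - ker z w.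
Proof.
move=> D0 /andP[e0 eD]; pose t0 := 1 - e / D ^+ 2.
have D20 : 0 < D ^+ 2 by rewrite exprn_gt0.
have t00 : 0 <= t0 by rewrite subr_ge0 ler_pdivrMr// mul1r.
have t01 : t0 < 1 by rewrite ltrBlDr ltrDl divr_gt0.
pose t := t0 `^ (N / 2).
have t1 : t < 1.
  rewrite -[ltRHS](_ : (1 : R) `^ (N / 2) = 1); last by rewrite powR1.
  by apply: gt0_ltr_powR; rewrite ?nnegrE ?divr_gt0.
exists ((1 - t) * (D `^ N)^-1); first by rewrite mulr_gt0 ?subr_gt0// invr_gt0 powR_gt0.
move=> x y z w xy zwD gap; have d0 := edist_gt0 xy.
have zw2 : edist z w ^+ 2 <= D ^+ 2 by rewrite ler_pXn2r ?nnegrE ?edist_ge0 ?(ltW D0).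
have sq (d : R) : 0 <= d -> d `^ N = (d ^+ 2) `^ (N / 2).
  by move=> d_ge0; rewrite -powR_mulrn// -powRrM; congr powR; field.
have dd : edist x y `^ N <= t * edist z w `^ N.
  have h : edist x y ^+ 2 <= t0 * edist z w ^+ 2.
    rewrite /t0 mulrBl mul1r lerBrDr (le_trans _ gap)// lerD2l mulrAC ler_pdivrMr//.
    by rewrite ler_pM2l.
  rewrite !sq ?edist_ge0// -powRM ?sqr_ge0//.
  apply: ge0_ler_powR h; first by rewrite divr_ge0// ltW.
    by rewrite nnegrE sqr_ge0.
  by rewrite nnegrE mulr_ge0// sqr_ge0.
have dzw : 0 < edist z w.
  rewrite -(ltr_pXn2r (_ : 0 < 2)%N) ?nnegrE ?edist_ge0// expr0n/=.
  by apply: lt_le_trans gap; rewrite ltr_wpDl ?sqr_ge0.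
have kk : ker z w <= t * ker x y.
  rewrite /ker -ler_pdivrMr ?invr_gt0 ?powR_gt0// invrK mulrC ler_pdivrMr ?powR_gt0//.
have xyD : edist x y <= D.
  rewrite -(ler_pXn2r (_ : 0 < 2)%N) ?nnegrE ?edist_ge0 ?(ltW D0)//.
  by apply: le_trans zw2; apply: le_trans gap; rewrite lerDl ltW.
have kx := ker_ge xy xyD.
apply: (@le_trans _ _ ((1 - t) * ker x y)); first by rewrite ler_pM2l// subr_gt0.
by rewrite mulrBl mul1r lerD2l lerN2.
Qed.

End kernel.

(** * Symmetrized integrals and test functions *)
Section measure_preserving.
Context d {X : measurableType d} {R : realType} (m : {measure set X -> \bar R}).
Implicit Types f : X -> X.

Definition preserves f := measurable_fun setT f /\
  forall g : X -> \bar R, measurable_fun setT g ->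
  (forall x, 0 <= g x)%E -> (\int[m]_x g (f x) = \int[m]_x g x)%E.

Lemma integral_preserved f (g : X -> \bar R) : preserves f -> measurable_fun setT g ->
  (\int[m]_x (g \o f) x = \int[m]_x g x)%E.
Proof.
move=> [_ fm] mg; rewrite (integralE m setT (g \o f)) funepos_comp funeneg_comp.
rewrite [RHS]integralE; congr (_ - _)%E.
  by rewrite -(fm _ (measurable_funepos mg)).
by rewrite -(fm _ (measurable_funeneg mg)).
Qed.

Lemma integrable_preserved f (g : X -> \bar R) : preserves f -> m.-integrable setT g ->
  m.-integrable setT (fun x => g (f x)).
Proof.
move=> [mf fm] /integrableP[mg ig]; apply/integrableP; split; first exact: (measurableT_comp mg mf).
have mab : measurable_fun setT (fun x => `|g x|%E) by exact: measurableT_comp.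
by rewrite (fm _ mab (fun x => abse_ge0 (g x))).
Qed.

Lemma integral_symmetrized (f1 f2 f3 : X -> X) (q : X -> R) :
  preserves f1 -> preserves f2 -> preserves f3 -> m.-integrable setT (EFin \o q) ->
  m.-integrable setT (fun z => (q z + q (f1 z) + (q (f2 z) + q (f3 z)))%:E) /\
  (\int[m]_z (q z + q (f1 z) + (q (f2 z) + q (f3 z)))%:E =
   4%:E * \int[m]_z (q z)%:E)%E.
Proof.
move=> f1P f2P f3P iq.
have [mq _] := integrableP _ _ _ iq.
have i1 := integrable_preserved f1P iq.
have i2 := integrable_preserved f2P iq.
have i3 := integrable_preserved f3P iq.
have E1 : (\int[m]_z (q (f1 z))%:E = \int[m]_z (q z)%:E)%E := integral_preserved f1P mq.
have E2 : (\int[m]_z (q (f2 z))%:E = \int[m]_z (q z)%:E)%E := integral_preserved f2P mq.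
have E3 : (\int[m]_z (q (f3 z))%:E = \int[m]_z (q z)%:E)%E := integral_preserved f3P mq.
have i01 := integrableD measurableT iq i1.
have i23 := integrableD measurableT i2 i3.
split; first exact: (integrableD measurableT i01 i23).
under eq_integral do rewrite !EFinD.
rewrite (integralD measurableT i01 i23) (integralD measurableT iq i1) (integralD measurableT i2 i3).
rewrite E1 E2 E3; have := integrable_fin_num measurableT iq.
rewrite /= => /fineK <-; rewrite -!EFinD -EFinM; congr EFin; ring.
Qed.

End measure_preserving.

Lemma powR_add_le {R : realType} (p a b : R) : 0 < p -> 0 <= a -> 0 <= b ->
  (a + b) `^ p <= 2 `^ p * (a `^ p + b `^ p).
Proof.
move=> p0 a0 b0; wlog ab : a b a0 b0 / a <= b => [hw|].
  by have [/hw|/ltW/hw] := leP a b; rewrite 1?(addrC a) 1?[X in _ * X]addrC; exact.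
apply: (@le_trans _ _ ((2 * b) `^ p)).
  by apply: ge0_ler_powR; rewrite ?nnegrE ?addr_ge0 ?mulr_ge0// ?(ltW p0)//; lra.
by rewrite powRM// ler_pM2l ?powR_gt0// lerDr powR_ge0.
Qed.

Lemma young_Gp {R : realType} (p a b : R) : 1 < p -> `|Gp p a * b| <= `|a| `^ p + `|b| `^ p.
Proof.
move=> p1; rewrite normrM normr_Gp//.
have p10 : 0 <= p - 1 by rewrite subr_ge0 ltW.
have p0 : 0 < p by rewrite (lt_trans ltr01).
have [ab|/ltW ba] := leP `|a| `|b|.
  apply: (@le_trans _ _ (`|b| `^ p)); last by rewrite lerDr powR_ge0.
  rewrite -[leRHS]mulr_powRB1// mulrC; apply: ler_wpM2l => //.
  by apply: ge0_ler_powR; rewrite ?nnegrE.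
apply: (@le_trans _ _ (`|a| `^ p)); last by rewrite lerDl powR_ge0.
by rewrite -[leRHS]mulr_powRB1// mulrC; apply: ler_wpM2r; rewrite ?powR_ge0.
Qed.

Section test_functions.
Context {R : realType} {n : nat}.
Local Notation T := (Rn R n).
Local Notation mu := (@lebesgue_Rn R n).
Variables (s p : R) (s01 : 0 < s < 1) (p12 : 1 < p <= 2).

Definition order : R := n%:R + s * p.

Lemma order_gt0 : 0 < order.
Proof.
by move: s01 p12 => /andP[s0 _] /andP[p1 _]; rewrite /order ltr_wpDl// mulr_gt0// (lt_trans ltr01).
Qed.

Definition energy (u : T -> R) (z : T * T) : \bar R :=
  (`|u z.1 - u z.2| `^ p * ker order z.1 z.2)%:E.

Lemma energy_ge0 u z : (0 <= energy u z)%E.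
Proof. by rewrite lee_fin mulr_ge0 ?powR_ge0// ker_ge0. Qed.

Lemma measurable_energy u : measurable_fun setT u -> measurable_fun setT (energy u).
Proof.
move=> um; apply/measurable_EFinP; apply: measurable_funM; last exact: measurable_ker.
apply: (measurableT_comp (@measurable_powR R p)).
apply: (measurableT_comp (@normr_measurable R setT)); apply: measurable_funB.
  exact: (measurableT_comp um measurable_fst).
exact: (measurableT_comp um measurable_snd).
Qed.

Record ball_function (M : R) (u : T -> R) : Prop := BallFunction {
  bf_measurable : measurable_fun setT u ;
  bf_bound : forall x, `|u x| <= M ;
  bf_support : forall x, ~ unit_ball x -> u x = 0 }.

Lemma ball_function_powR_lty M u q : 0 < q -> ball_function M u ->
  (\int[mu]_x (`|u x| `^ q)%:E < +oo)%E.
Proof.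
move=> q0 [um uM uB].
have M0 : 0 <= M by exact: le_trans (uM (mkv (fun=> 0))).
apply: (@le_lt_trans _ _ (\int[mu]_x ((M `^ q) * \1_unit_ball x)%:E)%E).
  apply: ge0_le_integral => //.
  - apply/measurable_EFinP; apply: (measurableT_comp (@measurable_powR R q)).
    exact: (measurableT_comp (@normr_measurable R setT)).
  - apply/measurable_EFinP; apply: measurable_funM => //.
    exact: measurable_indic measurable_unit_ball.
  move=> x _; rewrite lee_fin indicE; have [xB|xB] := pselect (unit_ball x).
    rewrite mem_set// mulr1; apply: ge0_ler_powR; rewrite ?nnegrE ?(ltW q0)//.
  by rewrite memNset// mulr0 uB// normr0 powR0 ?gt_eqF.
under eq_integral do rewrite EFinM.
rewrite ge0_integralZl ?lee_fin ?powR_ge0//; last first.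
  by apply/measurable_EFinP; exact: measurable_indic measurable_unit_ball.
rewrite integral_indic//; last exact: measurable_unit_ball.
by rewrite setIT unit_ballE lte_mul_pinfty ?lee_fin ?powR_ge0// eball_lty.
Qed.

Lemma ball_function_Wsp0 M u : ball_function M u ->
  (\int[mu \x mu]_z energy u z < +oo)%E -> Wsp0 s p u.
Proof.
move=> uM uE; have p0 : 0 < p by move: p12 => /andP[p1 _]; rewrite (lt_trans ltr01).
split; last by apply: aeW => x; exact: bf_support uM x.
split=> //; apply/andP; split; first by rewrite inE/=; exact: bf_measurable uM.
rewrite inE/= /finite_norm unlock /=.
have := ball_function_powR_lty p0 uM.
set J := (X in (X < _)%E) => Joo.
rewrite (_ : (\int[mu]__ _)%E = J); last by apply: eq_integral => x _.
have J0 : (0 <= J)%E by apply: integral_ge0 => x _; rewrite lee_fin powR_ge0.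
by rewrite -(@fineK _ J) ?ge0_fin_numE// poweR_EFin ltry.
Qed.

End test_functions.

(** * The excess beyond a hyperplane as a test function *)
Section part_contractions.
Context {R : realDomainType}.
Implicit Types a b : R.

Lemma maxr0_contraction a b : `|Num.max a 0 - Num.max b 0| <= `|a - b|.
Proof.
have := ler_norm (a - b); have := ler_norm (b - a); rewrite (distrC b).
rewrite ler_norml => ? ?; have [?|?] := leP a 0; have [?|?] := leP b 0;
  by apply/andP; split; lra.
Qed.

Lemma minr0_contraction a b : `|Num.min a 0 - Num.min b 0| <= `|a - b|.
Proof.
have := ler_norm (a - b); have := ler_norm (b - a); rewrite (distrC b).
rewrite ler_norml => ? ?; have [?|?] := leP a 0; have [?|?] := leP b 0;
  by apply/andP; split; lra.
Qed.

End part_contractions.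

(** If [a] and [b] have the same sign the first term on the right suffices. Otherwise the second one does,
and the weights compare in its favour. *)
Lemma parts_sum_powR {R : realType} (p a b k1 k2 : R) : 0 < p ->
  0 <= k1 -> 0 <= k2 -> (a <> b -> k1 <= k2) ->
  `|Num.max a 0 + Num.max b 0| `^ p * k1 <= `|a + b| `^ p * k1 + `|a - b| `^ p * k2.
Proof.
move=> p0 k10 k20 k12.
have mono (x y : R) : `|x| <= `|y| -> `|x| `^ p <= `|y| `^ p.
  by apply: ge0_ler_powR; rewrite ?nnegrE// ltW.
have t1 : 0 <= `|a + b| `^ p * k1 by apply: mulr_ge0 => //; exact: powR_ge0.
have t2 : 0 <= `|a - b| `^ p * k2 by apply: mulr_ge0 => //; exact: powR_ge0.
have opp (x : R) : a <> b -> `|x| <= `|a - b| -> `|x| `^ p * k1 <= `|a + b| `^ p * k1 + `|a - b| `^ p * k2.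
  move=> /k12 k12' /mono xab; apply: (@le_trans _ _ (`|a - b| `^ p * k2)).
    by apply: ler_pM => //; exact: powR_ge0.
  by rewrite lerDr.
have [a0|a0] := leP a 0; have [b0|b0] := leP b 0.
- by rewrite addr0 normr0 powR0 ?gt_eqF// mul0r addr_ge0.
- apply: opp; first by move=> ab; move: a0; rewrite ab leNgt b0.
  by rewrite add0r gtr0_norm// ler0_norm; lra.
- apply: opp; first by move=> ab; move: b0; rewrite -ab leNgt a0.
  by rewrite addr0 gtr0_norm// ger0_norm; lra.
- by rewrite lerDl.
Qed.

Section moving_plane.
Context {R : realType} {n : nat}.
Local Notation T := (Rn R n).
Local Notation mu := (@lebesgue_Rn R n).
Variables (s p : R) (s01 : 0 < s < 1) (p12 : 1 < p <= 2).
Variables (u : T -> R) (M : R) (M0 : 0 < M).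
Hypotheses (um : measurable_fun setT u) (u0 : forall x, 0 <= u x <= M)
  (uB : forall x, ~ unit_ball x -> u x = 0)
  (uE : (\int[mu \x mu]_z energy s p u z < +oo)%E).
Variables (nu : T) (nu1 : dot nu nu = 1) (lam : R).
Local Notation Re := (refl nu lam).
Local Notation K := (ker (order (n:=n) s p)).

Let p1 : 1 < p. Proof. by case/andP: p12. Qed.
Let p0 : 0 < p. Proof. exact: lt_trans p1. Qed.
Let N0 : 0 < order (n:=n) s p. Proof. exact: order_gt0. Qed.

Definition gap x := u x - u (Re x).

(** The positive part of [gap] beyond the hyperplane, extended as an odd function of the reflection. The odd extension,
rather than zero, makes the four reflected copies of the weak form combine into [four_point_sum] and the reaction term
into a difference of values of the reaction. *)
Definition excess x := if lam <= dot x nu then Num.max (gap x) 0 else Num.min (gap x) 0.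

Lemma gap_refl x : gap (Re x) = - gap x.
Proof. by rewrite /gap reflK// opprB. Qed.

Lemma excess_refl x : excess (Re x) = - excess x.
Proof.
rewrite /excess dot_refl// gap_refl.
have [xl|xl] := leP lam (dot x nu); have [xl'|xl'] := leP lam (2 * lam - dot x nu).
- have g0 : gap x = 0 by rewrite /gap refl_fix ?subrr//; lra.
  by rewrite g0 oppr0 maxxx oppr0.
- by rewrite oppr_max oppr0.
- by rewrite oppr_min oppr0.
- lra.
Qed.

Lemma measurable_gap : measurable_fun setT gap.
Proof.
apply: measurable_funB => //; apply: (measurableT_comp um).
exact: measurable_refl.
Qed.

Lemma measurable_excess : measurable_fun setT excess.
Proof.
apply: measurable_fun_ifT.
- apply: measurable_fun_ler => //; exact: measurable_dot.
- by apply: measurable_maxr => //; exact: measurable_gap.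
- by apply: measurable_minr => //; exact: measurable_gap.
Qed.

Lemma gap_bound x : `|gap x| <= M.
Proof.
rewrite /gap ler_norml.
have /andP[? ?] := u0 x; have /andP[? ?] := u0 (Re x).
by apply/andP; split; lra.
Qed.

Lemma excess_bound x : `|excess x| <= M.
Proof.
have := gap_bound x; rewrite /excess !ler_norml => /andP[? ?].
case: ifP => _; [have [?|?] := leP (gap x) 0 | have [?|?] := leP (gap x) 0];
  by apply/andP; split; lra.
Qed.

Lemma excess_ge0 x : lam <= dot x nu -> 0 <= excess x.
Proof. by rewrite /excess => ->; rewrite le_max lexx orbT. Qed.

Lemma excess_le0 x : dot x nu <= lam -> excess x <= 0.
Proof.
rewrite le_eqVlt => /orP[/eqP xl|xl].
  by rewrite /excess xl lexx /gap refl_fix// subrr maxxx.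
by rewrite /excess (leNgt lam) xl/= ge_min lexx orbT.
Qed.

Lemma excess_gap x : excess x * gap x = excess x ^+ 2.
Proof.
rewrite /excess; case: ifP => _; have [?|?] := leP (gap x) 0; rewrite ?mul0r ?expr0n//.
Qed.

Lemma u_gt0_ball x : 0 < u x -> unit_ball x.
Proof. by move=> ux; apply: contrapT => /uB ux0; move: ux; rewrite ux0 ltxx. Qed.

Lemma excess_support : 0 <= lam -> forall x, ~ unit_ball x -> excess x = 0.
Proof.
move=> lam0 x xB; rewrite /excess; have [xl|xl] := leP lam (dot x nu).
  by rewrite max_r// /gap uB// sub0r oppr_le0; have /andP[] := u0 (Re x).
rewrite min_r// /gap uB// sub0r oppr_ge0 leNgt; apply/negP => /u_gt0_ball RxB.
apply: xB; move: RxB; rewrite /unit_ball/= !enorm_ltE//; apply: le_lt_trans.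
have := dot_refl_self nu1 lam x; have : 0 <= lam * (lam - dot x nu) by rewrite mulr_ge0// subr_ge0 ltW.
lra.
Qed.

Lemma excess_ball_function : 0 <= lam -> ball_function M excess.
Proof.
move=> lam0; split; [exact: measurable_excess|exact: excess_bound|exact: excess_support].
Qed.

Lemma edist_le_refl x y : lam <= dot x nu -> lam <= dot y nu -> edist x y <= edist x (Re y).
Proof.
move=> xl yl; rewrite -(ler_pXn2r (_ : 0 < 2)%N) ?nnegrE ?edist_ge0//.
by rewrite edist2_refl// lerDl !mulr_ge0// subr_ge0.
Qed.

Lemma ker_refl x y : K (Re x) (Re y) = K x y.
Proof. by rewrite /ker edist_refl. Qed.

Lemma ker_reflr x y : K x (Re y) = K (Re x) y.
Proof. by rewrite /ker edist_reflr. Qed.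

Let pow_mono (a b : R) : `|a| <= `|b| -> `|a| `^ p <= `|b| `^ p.
Proof. by apply: ge0_ler_powR; rewrite ?nnegrE// ltW. Qed.

Let excess_pair_opp x y : lam <= dot x nu -> dot y nu < lam ->
  `|excess x - excess y| `^ p * K x y <=
  `|gap x - gap y| `^ p * K x y + `|gap x - gap (Re y)| `^ p * K x (Re y).
Proof.
move=> xl yl.
have yl' : lam <= dot (Re y) nu by rewrite (dot_refl nu1) lerBrDr mulr_natl mulr2n lerD2l ltW.
have ey : excess y = - Num.max (gap (Re y)) 0.
  by rewrite -[y](reflK nu1 lam) excess_refl /excess (reflK nu1) yl'.
have gy : gap y = - gap (Re y) by rewrite gap_refl opprK.
rewrite ey gy {1}/excess xl !opprK.
apply: parts_sum_powR p0 (ker_ge0 _ _ _) (ker_ge0 _ _ _) _ => gxy.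
apply: (le_ker N0); first by move=> xy; apply: gxy; rewrite -xy.
by rewrite -[y in leRHS](reflK nu1 lam); exact: edist_le_refl.
Qed.

(** Cutting at zero contracts differences on each side of the hyperplane. Across the hyperplane it does not, but then
either the values of [gap] add up already, or reflecting one of the points gives a larger difference at a shorter
distance. *)
Lemma excess_pair x y :
  `|excess x - excess y| `^ p * K x y <=
  `|gap x - gap y| `^ p * K x y + `|gap x - gap (Re y)| `^ p * K x (Re y).
Proof.
have same : `|excess x - excess y| <= `|gap x - gap y| ->
    `|excess x - excess y| `^ p * K x y <=
    `|gap x - gap y| `^ p * K x y + `|gap x - gap (Re y)| `^ p * K x (Re y).
  move=> le_xy; apply: (@le_trans _ _ (`|gap x - gap y| `^ p * K x y)).
    by apply: ler_wpM2r; [exact: ker_ge0|exact: pow_mono].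
  by rewrite lerDl mulr_ge0 ?powR_ge0 ?ker_ge0.
have [xl|xl] := leP lam (dot x nu); have [yl|yl] := leP lam (dot y nu).
- by apply: same; rewrite /excess xl yl maxr0_contraction.
- exact: excess_pair_opp.
- have := excess_pair_opp yl xl.
  rewrite (distrC (excess y)) (distrC (gap y)) (kerC _ y x) !gap_refl.
  rewrite (ker_reflr x) (kerC _ (Re x)) (_ : gap y - - gap x = gap x - - gap y)//.
  ring.
- by apply: same; rewrite /excess !(leNgt lam) xl yl minr0_contraction.
Qed.

Let gap_pair x y : `|gap x - gap y| `^ p <=
  2 `^ p * (`|u x - u y| `^ p + `|u (Re x) - u (Re y)| `^ p).
Proof.
apply: le_trans (powR_add_le p0 (normr_ge0 _) (normr_ge0 _)).
apply: ge0_ler_powR; rewrite ?nnegrE ?addr_ge0 ?(ltW p0)//.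
rewrite (_ : gap x - gap y = (u x - u y) - (u (Re x) - u (Re y))); first exact: ler_normB.
by rewrite /gap; ring.
Qed.

Let E x y := `|u x - u y| `^ p * K x y.

Lemma excess_energy_le x y : `|excess x - excess y| `^ p * K x y <=
  2 `^ p * ((E x y + E (Re x) (Re y)) + (E x (Re y) + E (Re x) y)).
Proof.
apply: le_trans (excess_pair x y) _; rewrite mulrDr; apply: lerD.
  rewrite /E ker_refl -mulrDl mulrA; apply: ler_wpM2r; [exact: ker_ge0|exact: gap_pair].
rewrite /E -ker_reflr -mulrDl mulrA; apply: ler_wpM2r; first exact: ker_ge0.
by have := gap_pair x (Re y); rewrite reflK.
Qed.

Let mRe : measurable_fun setT Re. Proof. exact: measurable_refl. Qed.

(** The pointwise bound compares the energy density of the excess with the densities of [u] at reflected pairs, whose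
integrals all equal the energy of [u]. *)
Lemma excess_energy_lty : (\int[mu \x mu]_z energy s p excess z < +oo)%E.
Proof.
have mE := measurable_energy s p um; have E0 := energy_ge0 s p u.
have mP (f g : T * T -> T) : measurable_fun setT f -> measurable_fun setT g ->
    measurable_fun setT (fun z => energy s p u (f z, g z)).
  by move=> mf mg; apply: (measurableT_comp mE); apply/measurable_fun_pairP.
have m1 : measurable_fun setT (fun z : T * T => Re z.1) by exact: (measurableT_comp mRe measurable_fst).
have m2 : measurable_fun setT (fun z : T * T => Re z.2) by exact: (measurableT_comp mRe measurable_snd).
have m3 : measurable_fun setT (fun z : T * T => z.1) by exact: measurable_fst.
have m4 : measurable_fun setT (fun z : T * T => z.2) by exact: measurable_snd.
pose e1 z := energy s p u (Re z.1, Re z.2).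
pose e2 z := energy s p u (z.1, Re z.2).
pose e3 z := energy s p u (Re z.1, z.2).
have me1 : measurable_fun setT e1 := mP _ _ m1 m2.
have me2 : measurable_fun setT e2 := mP _ _ m3 m2.
have me3 : measurable_fun setT e3 := mP _ _ m1 m4.
have e10 z : (0 <= e1 z)%E by exact: E0.
have e20 z : (0 <= e2 z)%E by exact: E0.
have e30 z : (0 <= e3 z)%E by exact: E0.
pose A z := (energy s p u z + e1 z)%E.
pose B z := (e2 z + e3 z)%E.
pose AB z := (A z + B z)%E.
pose F z := ((2 `^ p)%:E * AB z)%E.
have mA : measurable_fun setT A := emeasurable_funD mE me1.
have mB : measurable_fun setT B := emeasurable_funD me2 me3.
have mAB : measurable_fun setT AB := emeasurable_funD mA mB.
have A0 z : (0 <= A z)%E := adde_ge0 (E0 z) (e10 z).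
have B0 z : (0 <= B z)%E := adde_ge0 (e20 z) (e30 z).
have AB0 z : (0 <= AB z)%E := adde_ge0 (A0 z) (B0 z).
have mF : measurable_fun setT F := measurable_funeM _ mAB.
have AE : (\int[mu \x mu]_z A z = \int[mu \x mu]_z energy s p u z + \int[mu \x mu]_z e1 z)%E.
  exact: (ge0_integralD _ measurableT (fun z _ => E0 z) mE (fun z _ => e10 z) me1).
have BE : (\int[mu \x mu]_z B z = \int[mu \x mu]_z e2 z + \int[mu \x mu]_z e3 z)%E.
  exact: (ge0_integralD _ measurableT (fun z _ => e20 z) me2 (fun z _ => e30 z) me3).
have ABE : (\int[mu \x mu]_z AB z = \int[mu \x mu]_z A z + \int[mu \x mu]_z B z)%E.
  exact: (ge0_integralD _ measurableT (fun z _ => A0 z) mA (fun z _ => B0 z) mB).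
apply: (@le_lt_trans _ _ (\int[mu \x mu]_z F z)%E).
  apply: (ge0_le_integral _ measurableT (fun z _ => energy_ge0 s p excess z)
    (measurable_energy s p measurable_excess) mF).
  move=> z _; rewrite /F /AB /A /B /e1 /e2 /e3 /energy/= -!EFinD -EFinM lee_fin.
    exact: excess_energy_le.
rewrite /F (ge0_integralZl_EFin _ measurableT (fun z _ => AB0 z) mAB) ?powR_ge0//.
have E1 : (\int[mu \x mu]_z e1 z = \int[mu \x mu]_z energy s p u z)%E :=
  ge0_integral_refl12 nu1 lam mE E0.
have E2 : (\int[mu \x mu]_z e2 z = \int[mu \x mu]_z energy s p u z)%E :=
  ge0_integral_refl2 nu1 lam mE E0.
have E3 : (\int[mu \x mu]_z e3 z = \int[mu \x mu]_z energy s p u z)%E :=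
  ge0_integral_refl1 nu1 lam mE E0.
clearbody AB A B e1 e2 e3; rewrite ABE AE BE E1 E2 E3.
have c0 : (0 <= (2 `^ p)%:E :> \bar R)%E by rewrite lee_fin powR_ge0.
exact: (lte_mul_pinfty c0 _ (lte_add_pinfty (lte_add_pinfty uE uE) (lte_add_pinfty uE uE))).
Qed.

Lemma excess_Wsp0 : 0 <= lam -> Wsp0 s p excess.
Proof.
move=> lam0; apply: (ball_function_Wsp0 p12 (excess_ball_function lam0)).
exact: excess_energy_lty.
Qed.

End moving_plane.

(** * The equation tested with the excess *)
Section equation.
Context {R : realType} {n : nat}.
Local Notation T := (Rn R n).
Local Notation mu := (@lebesgue_Rn R n).
Variables (s p : R) (s01 : 0 < s < 1) (p12 : 1 < p <= 2).
Local Notation K := (ker (order (n:=n) s p)).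

Definition form_density (u v : T -> R) (z : T * T) : R :=
  Gp p (u z.1 - u z.2) * (v z.1 - v z.2) * K z.1 z.2.

Let p1 : 1 < p. Proof. by case/andP: p12. Qed.

Lemma frac_plapE (u v : T -> R) : (frac_plap s p u v =
  (2^-1)%:E * \int[mu \x mu]_z (form_density u v z)%:E)%E.
Proof. by []. Qed.

Lemma measurable_Gp : measurable_fun setT (Gp p : R -> R).
Proof.
apply: measurable_funM => //.
apply: (measurableT_comp (@measurable_powR R (p - 2))).
exact: normr_measurable.
Qed.

Lemma measurable_form_density u v : measurable_fun setT u -> measurable_fun setT v ->
  measurable_fun setT (form_density u v).
Proof.
move=> um vm.
have mB (w : T -> R) : measurable_fun setT w ->
    measurable_fun setT (fun z : T * T => w z.1 - w z.2).
  move=> wm; apply: measurable_funB; first exact: (measurableT_comp wm measurable_fst).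
  exact: (measurableT_comp wm measurable_snd).
apply: measurable_funM; last exact: measurable_ker.
apply: measurable_funM; last exact: mB.
exact: (measurableT_comp measurable_Gp (mB _ um)).
Qed.

Lemma form_density_integrable u v : measurable_fun setT u -> measurable_fun setT v ->
  (\int[mu \x mu]_z energy s p u z < +oo)%E ->
  (\int[mu \x mu]_z energy s p v z < +oo)%E ->
  (mu \x mu)%E.-integrable setT (EFin \o form_density u v).
Proof.
move=> um vm uE vE.
have mq : measurable_fun setT (EFin \o form_density u v).
  by apply/measurable_EFinP; exact: measurable_form_density.
apply/integrableP; split; first exact: mq.
have mS := emeasurable_funD (measurable_energy s p um) (measurable_energy s p vm).
have mabs : measurable_fun setT (fun z => `|(EFin \o form_density u v) z|)%E.
  exact: measurableT_comp.
apply: (@le_lt_trans _ _ (\int[mu \x mu]_z (energy s p u z + energy s p v z))%E).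
  apply: (ge0_le_integral _ measurableT (fun z _ => abse_ge0 _) mabs mS).
  move=> z _; rewrite /= /energy -EFinD lee_fin /form_density normrM.
  rewrite (ger0_norm (ker_ge0 _ _ _)) -mulrDl.
  by apply: ler_wpM2r; [exact: ker_ge0|exact: young_Gp].
rewrite (ge0_integralD _ measurableT (fun z _ => energy_ge0 s p u z) (measurable_energy s p um)
  (fun z _ => energy_ge0 s p v z) (measurable_energy s p vm)).
exact: (lte_add_pinfty uE vE).
Qed.

Variables (f : R -> R) (u : T -> R) (M Kf Cf : R) (M0 : 0 < M) (Cf0 : 0 <= Cf).
Hypotheses (um : measurable_fun setT u) (u0 : forall x, 0 <= u x <= M)
  (uB : forall x, ~ unit_ball x -> u x = 0)
  (uE : (\int[mu \x mu]_z energy s p u z < +oo)%E).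
Hypotheses (fm : measurable_fun setT (f \o u))
  (fK : forall x, `|f (u x)| <= Kf)
  (fL : forall x y, `|f (u x) - f (u y)| <= Cf * `|u x - u y|).
Hypothesis (weak : forall phi, Wsp0 s p phi ->
  frac_plap s p u phi = (\int[mu]_(x in unit_ball) (f (u x) * phi x)%:E)%E).
Variables (nu : T) (nu1 : dot nu nu = 1) (lam : R) (lam0 : 0 <= lam).
Local Notation Re := (refl nu lam).
Local Notation phi := (excess u nu lam).

Definition form_sum (z : T * T) : R :=
  form_density u phi z + form_density u phi (Re z.1, Re z.2) +
  (form_density u phi (z.1, Re z.2) + form_density u phi (Re z.1, z.2)).

Let mRe : measurable_fun setT Re. Proof. exact: measurable_refl. Qed.

Let phi_m : measurable_fun setT phi. Proof. exact: measurable_excess. Qed.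

Let phi_ball : ball_function M phi. Proof. exact: excess_ball_function. Qed.

Let refl12P : preserves (mu \x mu)%E (fun z => (Re z.1, Re z.2)).
Proof.
split; last by move=> g mg g0; exact: ge0_integral_refl12.
apply/measurable_fun_pairP; split.
  exact: (measurableT_comp mRe measurable_fst).
exact: (measurableT_comp mRe measurable_snd).
Qed.

Let refl2P : preserves (mu \x mu)%E (fun z => (z.1, Re z.2)).
Proof.
split; last by move=> g mg g0; exact: ge0_integral_refl2.
apply/measurable_fun_pairP; split; first exact: measurable_fst.
exact: (measurableT_comp mRe measurable_snd).
Qed.

Let refl1P : preserves (mu \x mu)%E (fun z => (Re z.1, z.2)).
Proof.
split; last by move=> g mg g0; exact: ge0_integral_refl1.
apply/measurable_fun_pairP; split; last exact: measurable_snd.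
exact: (measurableT_comp mRe measurable_fst).
Qed.

Let qI : (mu \x mu)%E.-integrable setT (EFin \o form_density u phi).
Proof. exact: (form_density_integrable um phi_m uE (excess_energy_lty s01 p12 um uE nu1 lam)). Qed.

Let phi2_lty : (\int[mu]_x (phi x ^+ 2)%:E < +oo)%E.
Proof.
have := ball_function_powR_lty (ltr0n R 2) phi_ball.
by under eq_integral do rewrite powR_mulrn// real_normK ?num_real//.
Qed.

Let phi1_lty : (\int[mu]_x `|phi x|%:E < +oo)%E.
Proof.
have := ball_function_powR_lty ltr01 phi_ball.
by under eq_integral do rewrite powRr1//.
Qed.

Let F x := f (u x) * phi x.

Let FI : mu.-integrable setT (EFin \o F).
Proof.
have mF : measurable_fun setT (EFin \o F) by apply/measurable_EFinP; exact: measurable_funM.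
have Kf0 : 0 <= Kf by exact: le_trans (fK (mkv (fun=> 0))).
have mphi : measurable_fun setT (fun x => `|phi x|%:E : \bar R).
  by apply/measurable_EFinP; exact: measurableT_comp.
apply/integrableP; split; first exact: mF.
apply: (@le_lt_trans _ _ (\int[mu]_x (Kf%:E * `|phi x|%:E))%E).
  apply: ge0_le_integral => //.
  - exact: measurableT_comp.
  - exact: measurable_funeM.
  - by move=> x _; rewrite /= -EFinM lee_fin normrM ler_wpM2r.
rewrite ge0_integralZl//.
have Kf0' : (0 <= Kf%:E)%E by rewrite lee_fin.
exact: (lte_mul_pinfty Kf0' _ phi1_lty).
Qed.

Let rhs : ((\int[mu]_x (F x)%:E) + (\int[mu]_x (F x)%:E) <= Cf%:E * \int[mu]_x (phi x ^+ 2)%:E)%E.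
Proof.
have ReP : preserves mu Re by split=> // g mg g0; exact: ge0_integral_refl.
have [mF _] := integrableP _ _ _ FI.
have FRI : mu.-integrable setT (fun x => (F (Re x))%:E) := integrable_preserved ReP FI.
have FRE : (\int[mu]_x (F (Re x))%:E = \int[mu]_x (F x)%:E)%E := integral_preserved ReP mF.
rewrite -[X in (_ + X <= _)%E]FRE -(integralD measurableT FI FRI).
have mphi2 : measurable_fun setT (fun x => (phi x ^+ 2)%:E : \bar R).
  by apply/measurable_EFinP; exact: measurable_funX.
have phi20 x : (0%E <= (phi x ^+ 2)%:E :> \bar R)%E by rewrite lee_fin sqr_ge0.
have phi2I : mu.-integrable setT (fun x => (phi x ^+ 2)%:E).
  apply/integrableP; split; first exact: mphi2.
  by under eq_integral do rewrite gee0_abs//; exact: phi2_lty.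
rewrite -(integralZl measurableT phi2I).
apply: (le_integral measurableT (integrableD measurableT FI FRI) (integrableZl measurableT Cf phi2I)).
move=> x _; rewrite /= -EFinD -EFinM lee_fin /F excess_refl// mulrN -mulrBl.
apply: le_trans (ler_norm _) _; rewrite normrM.
rewrite -excess_gap -(ger0_norm (_ : 0 <= phi x * gap u nu lam x)); last first.
  by rewrite excess_gap sqr_ge0.
rewrite normrM mulrA (mulrAC Cf); apply: ler_wpM2r => //; exact: fL.
Qed.

(** The four reflected copies of the form have the same integral, which makes the left-hand side eight times the weak
form. Since the excess is odd, the reaction term is half the integral of the excess times [f (u x) - f (u (Re x))],
which the Lipschitz condition bounds by [Cf] times the square of the excess. *)
Lemma integral_form_sum :
  (mu \x mu)%E.-integrable setT (EFin \o form_sum) /\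
  (\int[mu \x mu]_z (form_sum z)%:E <= (4 * Cf)%:E * \int[mu]_x (phi x ^+ 2)%:E)%E.
Proof.
have [SI SE] := integral_symmetrized refl12P refl2P refl1P qI.
split; first exact: SI.
rewrite [X in (X <= _)%E]SE.
have phiW : Wsp0 s p phi := excess_Wsp0 s01 p12 um u0 uB uE nu1 lam0.
have := weak phiW; rewrite frac_plapE.
have -> : (\int[mu]_(x in unit_ball) (f (u x) * phi x)%:E = \int[mu]_x (F x)%:E)%E.
  rewrite integral_mkcond; apply: eq_integral => x _; rewrite patchE.
  case: ifPn => // /negP xB; rewrite /F (excess_support u0 uB nu1 lam0) ?mulr0//.
  by move=> xB'; apply: xB; rewrite inE.
move: rhs; have := integrable_fin_num measurableT FI; have := integrable_fin_num measurableT qI.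
rewrite /=; set I := (\int[_]__ (form_density u phi _)%:E)%E; set J := (\int[_]__ (F _)%:E)%E.
set P := (\int[_]__ (_ ^+ 2)%:E)%E.
move=> /fineK <- /fineK <-; rewrite -EFinD -EFinM => JP [IJ].
have P0 : (0 <= P)%E by apply: integral_ge0 => x _; rewrite lee_fin sqr_ge0.
move: JP; rewrite -(@fineK _ P) ?ge0_fin_numE// -!EFinM !lee_fin -IJ.
lra.
Qed.

End equation.

(** * Lower bounds for the symmetrized form *)
Section lower_bounds.
Context {R : realType} {n : nat}.
Local Notation T := (Rn R n).
Local Notation mu := (@lebesgue_Rn R n).
Variables (s p : R) (s01 : 0 < s < 1) (p12 : 1 < p <= 2).
Local Notation N := (order (n:=n) s p).
Local Notation K := (ker N).
Variables (u : T -> R) (M : R) (M0 : 0 < M).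
Hypotheses (um : measurable_fun setT u) (u0 : forall x, 0 <= u x <= M).
Variables (nu : T) (nu1 : dot nu nu = 1) (lam : R).
Local Notation Re := (refl nu lam).
Local Notation phi := (excess u nu lam).
Local Notation S := (form_sum s p u nu lam).

(** The smallest slope of [Gp p] between [- M] and [M], see [Gp_lower]. *)
Definition ellipticity : R := (p - 1) * M `^ (p - 2).
Local Notation c := ellipticity.

Lemma ellipticity_gt0 : 0 < c.
Proof. by case/andP: p12 => p1 _; rewrite mulr_gt0 ?subr_gt0// powR_gt0. Qed.

Let N0 : 0 < N. Proof. exact: order_gt0. Qed.

Lemma form_sum_refl1 x y : S (Re x, y) = S (x, y).
Proof.
rewrite /form_sum/= (reflK nu1); move: (form_density _ _ _ _) => q.
by rewrite addrC; congr (_ + _); exact: addrC.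
Qed.

Lemma form_sum_refl2 x y : S (x, Re y) = S (x, y).
Proof. by rewrite /form_sum/= (reflK nu1); move: (form_density _ _ _ _) => q; exact: addrC. Qed.

(** On the far side of the hyperplane the excess is a positive part, and the reflection preserves the kernel. *)
Lemma form_sumE x y : lam <= dot x nu -> lam <= dot y nu ->
  S (x, y) = four_point_sum (Gp p) (u x) (u (Re x)) (u y) (u (Re y)) (K x y) (K x (Re y)).
Proof.
move=> xl yl; rewrite /form_sum /form_density /four_point_sum /= !excess_refl//.
rewrite ker_refl// -ker_reflr//.
have -> : phi x = Num.max (u x - u (Re x)) 0 by rewrite /excess xl.
have -> : phi y = Num.max (u y - u (Re y)) 0 by rewrite /excess yl.
move: (K x y) (K x (Re y)) (Gp p) (u x) (u y) (u (Re x)) (u (Re y)) => k k' g a b a' b'; ring.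
Qed.

Let gmono a b : - M <= b -> b <= a -> a <= M -> c * (a - b) <= Gp p a - Gp p b.
Proof. by move=> *; exact: Gp_lower. Qed.

Let c0 : 0 <= c. Proof. exact: ltW ellipticity_gt0. Qed.

Let lower x y : lam <= dot x nu -> lam <= dot y nu ->
  c * ((phi x - phi y) ^+ 2 * K x y + (phi x + phi y) ^+ 2 * K x (Re y)) <= S (x, y) /\
  c * phi x * Num.max (- gap u nu lam y) 0 * (K x y - K x (Re y)) <= S (x, y).
Proof.
move=> xl yl; rewrite form_sumE//.
have ex : phi x = Num.max (u x - u (Re x)) 0 by rewrite /excess xl.
have ey : phi y = Num.max (u y - u (Re y)) 0 by rewrite /excess yl.
have [xy|xy] := pselect (x = y).
  rewrite -{}xy in ey yl *.
  have [L1 L2] := four_point_lower c0 gmono (u0 x) (u0 (Re x)) (u0 x) (u0 (Re x))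
    (ker_ge0 N x (Re x)) (lexx _).
  have Sx k : four_point_sum (Gp p) (u x) (u (Re x)) (u x) (u (Re x)) k (K x (Re x)) =
      four_point_sum (Gp p) (u x) (u (Re x)) (u x) (u (Re x)) (K x (Re x)) (K x (Re x)).
    by rewrite /four_point_sum !subrr !mulr0 !mul0r.
  rewrite Sx; split.
    have -> : (phi x - phi x) ^+ 2 * K x x = (phi x - phi x) ^+ 2 * K x (Re x).
      by rewrite subrr expr2 !mul0r.
    by rewrite -!ex in L1.
  have z : phi x * Num.max (- gap u nu lam x) 0 = 0.
    rewrite ex -/(gap u nu lam x); have [?|?] := leP (gap u nu lam x) 0; first by rewrite mul0r.
    by rewrite max_r ?mulr0// oppr_le0 ltW.
  rewrite -(mulrA c (phi x)) z mulr0 mul0r; apply: le_trans L1.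
  apply: mulr_ge0 => //; apply: addr_ge0; apply: mulr_ge0; rewrite ?sqr_ge0 ?ker_ge0//.
have Kxy : K x (Re y) <= K x y.
  by apply: (le_ker N0) => //; exact: (edist_le_refl nu1).
have [L1 L2] := four_point_lower c0 gmono (u0 x) (u0 (Re x)) (u0 y) (u0 (Re y))
  (ker_ge0 N x (Re y)) Kxy.
rewrite -ex -ey in L1 L2.
by rewrite (_ : - gap u nu lam y = u (Re y) - u y) //; rewrite /gap opprB.
Qed.

(** A point [y] on the near side is replaced by its mirror image, which exchanges the two kernels in the coercivity
bound and changes the sign of the excess. *)
Lemma form_sum_lower x y : lam <= dot x nu ->
  c * (phi x - phi y) ^+ 2 * K x y <= S (x, y).
Proof.
move=> xl; have [yl|yl] := leP lam (dot y nu).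
  have [L _] := lower xl yl; apply: le_trans L; rewrite -mulrA; apply: ler_wpM2l => //.
  by rewrite lerDl mulr_ge0 ?sqr_ge0 ?ker_ge0.
have yl' : lam <= dot (Re y) nu by rewrite (dot_refl nu1) lerBrDr mulr_natl mulr2n lerD2l ltW.
have [L _] := lower xl yl'; rewrite form_sum_refl2 in L; apply: le_trans L.
rewrite -mulrA; apply: ler_wpM2l => //; rewrite (reflK nu1) excess_refl// opprK.
by rewrite lerDr mulr_ge0 ?sqr_ge0 ?ker_ge0.
Qed.

Lemma form_sum_ge0 z : 0 <= S z.
Proof.
case: z => x y; have [xl|xl] := leP lam (dot x nu).
  apply: le_trans (form_sum_lower y xl).
  by rewrite mulr_ge0 ?ker_ge0// mulr_ge0// sqr_ge0.
have xl' : lam <= dot (Re x) nu by rewrite (dot_refl nu1) lerBrDr mulr_natl mulr2n lerD2l ltW.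
rewrite -form_sum_refl1; apply: le_trans (form_sum_lower y xl').
by rewrite mulr_ge0 ?ker_ge0// mulr_ge0// sqr_ge0.
Qed.

Lemma form_sum_lower_gap x y : lam <= dot x nu -> lam <= dot y nu -> gap u nu lam y <= 0 ->
  c * phi x * (- gap u nu lam y) * (K x y - K x (Re y)) <= S (x, y).
Proof.
by move=> xl yl gy; have [L1 L2] := lower xl yl; rewrite max_l ?oppr_ge0 in L2.
Qed.

Let Nmeas : measurable_fun setT S.
Proof.
have mphi : measurable_fun setT phi by exact: measurable_excess.
have mq := measurable_form_density s p um mphi.
have mRe : measurable_fun setT Re by exact: measurable_refl.
have mR1 : measurable_fun setT (fun z : T * T => Re z.1) := measurableT_comp mRe measurable_fst.
have mR2 : measurable_fun setT (fun z : T * T => Re z.2) := measurableT_comp mRe measurable_snd.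
have mm (F G : T * T -> T) : measurable_fun setT F -> measurable_fun setT G ->
    measurable_fun setT (fun z => form_density s p u phi (F z, G z)).
  by move=> mF mG; apply: (measurableT_comp mq); apply/measurable_fun_pairP; split.
apply: measurable_funD; apply: measurable_funD.
- exact: mq.
- exact: mm mR1 mR2.
- exact: mm measurable_fst mR2.
- exact: mm mR1 measurable_snd.
Qed.

Let mSx x : measurable_fun setT (fun y => (S (x, y))%:E : \bar R).
Proof. by apply/measurable_EFinP; exact: (measurableT_comp Nmeas (measurable_pair1 x)). Qed.

Let lower_on_set x (A : set T) (k : R) : measurable A -> 0 <= k ->
  (forall y, A y -> k <= S (x, y)) -> (k%:E * mu A <= \int[mu]_y (S (x, y))%:E)%E.
Proof.
move=> mA k0 kS.
have m1 : measurable_fun setT (fun y => (\1_A y)%:E : \bar R).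
  by apply/measurable_EFinP; exact: measurable_indic.
have mk : measurable_fun setT (fun y => k%:E * (\1_A y)%:E : \bar R)%E by exact: measurable_funeM.
have k0' : (0 <= k%:E)%E by rewrite lee_fin.
have i0 y : (0%E <= (\1_A y)%:E :> \bar R)%E by rewrite lee_fin.
have -> : (k%:E * mu A = \int[mu]_y (k%:E * (\1_A y)%:E))%E.
  by rewrite ge0_integralZl// integral_indic// setIT.
apply: (ge0_le_integral _ measurableT (fun y _ => mule_ge0 k0' (i0 y)) mk (mSx x)).
move=> y _; rewrite -EFinM lee_fin indicE; have [yA|yA] := pselect (A y).
  by rewrite mem_set// mulr1 kS.
by rewrite memNset// mulr0 form_sum_ge0.
Qed.

(** The ball used to bound the form from below sits at distance comparable to [r] from [x], on the side of the
hyperplane. *)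
Definition probe x r : set T := eball (vadd x (vscale (- (2 * r)) nu)) r.

Lemma probe_dist x y r : 0 < r -> probe x r y -> x <> y /\ edist x y <= 4 * r.
Proof.
move=> r0; rewrite /probe/eball/= edistE enorm_ltE// => yr.
set v := vsub y (vadd x (vscale (- (2 * r)) nu)) in yr.
have d : edist x y ^+ 2 = dot v v - 2 * (2 * r) * dot v nu + (2 * r) ^+ 2.
  rewrite edist2 /v !dotBl !dotBr !dotDl !dotDr !dotZl !dotZr nu1 (dotC y x) !(dotC nu); ring.
have := dot_unit_le v nu1 => vnu.
have vr : `|dot v nu| < r.
  rewrite -(ltr_pXn2r (_ : 0 < 2)%N) ?nnegrE ?(ltW r0)//.
  by rewrite real_normK ?num_real//; exact: le_lt_trans yr.
move: vr; rewrite ltr_norml => /andP[v1 v2].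
have v0 := dot_ge0 v.
have rv : 0 < r * (r - dot v nu) by rewrite mulr_gt0// subr_gt0.
have rv' : 0 < r * (r + dot v nu) by rewrite mulr_gt0//; lra.
split.
  move=> xy; move: d; rewrite xy edist_xx expr0n/=.
  have : 0 < (2 * r - dot v nu) ^+ 2 by rewrite exprn_gt0//; lra.
  rewrite sqrrB; lra.
rewrite -(ler_pXn2r (_ : 0 < 2)%N) ?nnegrE ?edist_ge0 ?mulr_ge0 ?(ltW r0)//.
rewrite d; lra.
Qed.

Lemma probe_dot x y r : 0 < r -> probe x r y -> dot y nu <= dot x nu - r.
Proof.
move=> r0; rewrite /probe/eball/= edistE enorm_ltE// => yr.
set v := vsub y (vadd x (vscale (- (2 * r)) nu)) in yr.
have vr : `|dot v nu| < r.
  rewrite -(ltr_pXn2r (_ : 0 < 2)%N) ?nnegrE ?(ltW r0)//.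
  by rewrite real_normK ?num_real//; apply: le_lt_trans (dot_unit_le v nu1) yr.
move: vr; rewrite ltr_norml => /andP[_]; rewrite /v dotBl dotDl dotZl nu1; lra.
Qed.

(** On half of the ball the excess is at most half its value at [x]. The resulting factor in front of the square of the
excess at [x] is of order [r ^ (- s p)]. *)
Lemma probe_lower x r D : 0 < r -> lam <= dot x nu -> measurable D ->
  (mu (probe x r `&` D) <= (2^-1)%:E * mu (probe x r))%E ->
  (forall y, probe x r y -> ~ D y -> 2 * phi y <= phi x) ->
  ((c / 8 * ((4 * r) `^ N)^-1 * (2 * (r / n.+1%:R)) ^+ n * phi x ^+ 2)%:E <=
    \int[mu]_y (S (x, y))%:E)%E.
Proof.
move=> r0 xl mD Dsmall phiy.
have mP : measurable (probe x r) by exact: measurable_eball.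
have mPD : measurable (probe x r `\` D) by exact: measurableD.
have phi0 := excess_ge0 u xl.
pose k := c * (phi x / 2) ^+ 2 * ((4 * r) `^ N)^-1.
have k0 : 0 <= k.
  by apply: mulr_ge0; [rewrite mulr_ge0// sqr_ge0|rewrite invr_ge0 powR_ge0].
have kS y : (probe x r `\` D) y -> k <= S (x, y).
  move=> [yP yD]; apply: le_trans (form_sum_lower y xl).
  have [xy dxy] := probe_dist r0 yP.
  have i0 : 0 <= ((4 * r) `^ N)^-1 by rewrite invr_ge0 powR_ge0.
  have c2 : 0 <= c * (phi x / 2) ^+ 2 by rewrite mulr_ge0// sqr_ge0.
  have phi_le : phi x / 2 <= phi x - phi y by have := phiy y yP yD; lra.
  have h0 : 0 <= phi x / 2 by rewrite divr_ge0.
  apply: (ler_pM c2 i0 _ (ker_ge N0 xy dxy)); apply: ler_wpM2l => //.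
  by rewrite ler_pXn2r ?nnegrE// (le_trans h0).
apply: le_trans (lower_on_set mPD k0 kS).
have half : ((2^-1)%:E * mu (probe x r) <= mu (probe x r `\` D))%E.
  have Pf : mu (probe x r) \is a fin_num by exact: fin_eball.
  have If : mu (probe x r `&` D) \is a fin_num.
    rewrite ge0_fin_numE ?measure_ge0//; apply: le_lt_trans (eball_lty (vadd x (vscale (- (2 * r)) nu)) r).
    by apply: le_measure; rewrite ?inE; [exact: measurableI|exact: mP|exact: subIsetl].
  have key (a b t : \bar R) : a \is a fin_num -> b \is a fin_num ->
      (b <= (2^-1)%:E * a -> t = a - b -> (2^-1)%:E * a <= t)%E.
    case: a => // a; case: b => // b _ _; rewrite -EFinM lee_fin => ab ->.
    by rewrite -EFinB lee_fin; lra.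
  apply: (key _ _ _ Pf If Dsmall); apply: measureD => //.
  by rewrite -ge0_fin_numE ?measure_ge0.
apply: (@le_trans _ _ (k%:E * ((2^-1)%:E * mu (probe x r))))%E; last first.
  by apply: lee_wpmul2l => //; rewrite lee_fin.
apply: (@le_trans _ _ (k%:E * ((2^-1)%:E * ((2 * (r / n.+1%:R)) ^+ n)%:E)))%E; last first.
  apply: lee_wpmul2l; first by rewrite lee_fin.
  by apply: lee_wpmul2l; [rewrite lee_fin invr_ge0|exact: eball_ge].
rewrite -!EFinM lee_fin /k le_eqVlt; apply/orP; left; apply/eqP.
by move: (_ `^ N)^-1 (_ ^+ n) => a b; field.
Qed.

(** Unlike [probe_lower] this bound is linear in the excess at [x]. *)
Lemma gap_lower x (A : set T) (theta k : R) : lam <= dot x nu -> measurable A ->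
  0 <= theta -> 0 <= k ->
  (forall y, A y -> [/\ lam <= dot y nu, gap u nu lam y <= - theta &
    phi x != 0 -> k <= K x y - K x (Re y)]) ->
  ((c * theta * k * phi x)%:E * mu A <= \int[mu]_y (S (x, y))%:E)%E.
Proof.
move=> xl mA th0 k0 hA; have phi0 := excess_ge0 u xl.
have ct0 : 0 <= c * theta by exact: mulr_ge0.
have ctk0 : 0 <= c * theta * k * phi x by apply: mulr_ge0 => //; exact: mulr_ge0.
apply: (lower_on_set mA ctk0).
move=> y /hA[yl gy ky]; have [p0|p0] := eqVneq (phi x) 0.
  by rewrite p0 mulr0 form_sum_ge0.
have gy0 : gap u nu lam y <= 0 by rewrite (le_trans gy)// oppr_le0.
apply: le_trans (form_sum_lower_gap xl yl gy0).
have {}ky := ky p0.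
rewrite (_ : c * theta * k * phi x = c * phi x * theta * k); last by ring.
have cp0 : 0 <= c * phi x by exact: mulr_ge0.
apply: (ler_pM _ k0 _ ky); first exact: mulr_ge0.
by apply: ler_wpM2l => //; rewrite lerNr.
Qed.

End lower_bounds.

(** * Hyperplanes without excess *)
Section scales.
Context {R : realType}.

(** The right-hand side is a constant times [r ^ (- a)]: the powers [r ^ n] of the volume and of the kernel cancel. *)
Lemma small_radius (n : nat) (a b c0 : R) : 0 < a -> 0 < b -> 0 < c0 ->
  exists2 r, 0 < r <= 1 &
    b <= c0 / 8 * ((4 * r) `^ (n%:R + a))^-1 * (2 * (r / n.+1%:R)) ^+ n.
Proof.
move=> a0 b0 c00; pose c1 := c0 / 8 * (4 `^ (n%:R + a))^-1 * (2 / n.+1%:R) ^+ n.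
have c10 : 0 < c1.
  apply: mulr_gt0; last by rewrite exprn_gt0// divr_gt0.
  by apply: mulr_gt0; [rewrite divr_gt0|rewrite invr_gt0 powR_gt0].
pose r := Num.min 1 ((c1 / b) `^ a^-1).
have r0 : 0 < r by rewrite lt_min ltr01 powR_gt0// divr_gt0.
exists r; first by rewrite r0 ge_min lexx.
have ra : r `^ a <= c1 / b.
  apply: (@le_trans _ _ (((c1 / b) `^ a^-1) `^ a)).
    apply: ge0_ler_powR; rewrite ?nnegrE ?(ltW a0) ?(ltW r0) ?powR_ge0//.
    by rewrite ge_min lexx orbT.
  by rewrite -powRrM mulVf ?gt_eqF// powRr1// divr_ge0// ltW.
have rap : 0 < r `^ a by exact: powR_gt0.
have -> : c0 / 8 * ((4 * r) `^ (n%:R + a))^-1 * (2 * (r / n.+1%:R)) ^+ n = c1 / r `^ a.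
  rewrite powRM ?(ltW r0)// (@powRD _ r); last by rewrite (gt_eqF r0) implybT.
  rewrite powR_mulrn ?(ltW r0)// /c1.
  have -> : 2 * (r / n.+1%:R) = r * (2 / n.+1%:R) by ring.
  rewrite exprMn.
  have h1 : 4 `^ (n%:R + a) != 0 by rewrite gt_eqF// powR_gt0.
  have h2 : r ^+ n != 0 by rewrite gt_eqF// exprn_gt0.
  have h3 : r `^ a != 0 by rewrite gt_eqF.
  move: (4 `^ _) (r ^+ n) (r `^ a) (_ ^+ n) h1 h2 h3 => A B C D h1 h2 h3.
  by field; rewrite h1 h2 h3.
by rewrite ler_pdivlMr// mulrC -ler_pdivlMr.
Qed.

End scales.

(** In terms of [u]: almost everywhere beyond the hyperplane, [u] is at most its reflection. *)
Definition no_excess {R : realType} {n : nat} (u : Rn R n -> R) nu lam :=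
  lebesgue_Rn n [set x | excess u nu lam x != 0] = 0%E.

Section continuation.
Context {R : realType} {n : nat}.
Local Notation T := (Rn R n).
Local Notation mu := (@lebesgue_Rn R n).
Variables (s p : R) (s01 : 0 < s < 1) (p12 : 1 < p <= 2).
Local Notation N := (order (n:=n) s p).
Local Notation K := (ker N).
Variables (f : R -> R) (u : T -> R) (M Kf Cf : R) (M0 : 0 < M) (Cf0 : 0 <= Cf).
Hypotheses (um : measurable_fun setT u) (u0 : forall x, 0 <= u x <= M)
  (uB : forall x, ~ unit_ball x -> u x = 0)
  (uE : (\int[mu \x mu]_z energy s p u z < +oo)%E).
Hypotheses (fm : measurable_fun setT (f \o u))
  (fK : forall x, `|f (u x)| <= Kf)
  (fL : forall x y, `|f (u x) - f (u y)| <= Cf * `|u x - u y|).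
Hypothesis (weak : forall phi, Wsp0 s p phi ->
  frac_plap s p u phi = (\int[mu]_(x in unit_ball) (f (u x) * phi x)%:E)%E).
Variables (nu : T) (nu1 : dot nu nu = 1).

Let mphi lam : measurable_fun setT (excess u nu lam). Proof. exact: measurable_excess. Qed.

Let S lam := form_sum s p u nu lam.

Let S0 lam z : 0 <= S lam z. Proof. exact: (form_sum_ge0 s01 p12 M0 u0 nu1). Qed.

(** Integrating the hypothesis, which extends to the other side of the hyperplane by symmetry, bounds the integral of
the form from below by [4 * Cf + 1] times the integral of the squared excess; [integral_form_sum] bounds it from above
by [4 * Cf] times the same integral, which is finite and therefore zero. *)
Lemma no_excess_criterion lam : 0 <= lam ->
  (forall x, lam <= dot x nu -> (((4 * Cf + 1) * excess u nu lam x ^+ 2)%:E <=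
    \int[mu]_y (S lam (x, y))%:E)%E) -> no_excess u nu lam.
Proof.
move=> lam0 hx; pose phi := excess u nu lam.
have hall x : (((4 * Cf + 1) * phi x ^+ 2)%:E <= \int[mu]_y (S lam (x, y))%:E)%E.
  have [xl|xl] := leP lam (dot x nu); first exact: hx.
  have xl' : lam <= dot (refl nu lam x) nu by rewrite (dot_refl nu1) lerBrDr mulr_natl mulr2n lerD2l ltW.
  have <- : (\int[mu]_y (S lam (refl nu lam x, y))%:E = \int[mu]_y (S lam (x, y))%:E)%E.
    by apply: eq_integral => y _; rewrite /S (form_sum_refl1 s p u nu1 lam x y).
  by have := hx _ xl'; rewrite (excess_refl u nu1) sqrrN.
have [SI SE] := integral_form_sum s01 p12 um u0 uB uE fm fK fL weak nu1 lam0.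
have [mS _] := integrableP _ _ _ SI.
have mphi2 : measurable_fun setT (fun x => (phi x ^+ 2)%:E : \bar R).
  by apply/measurable_EFinP; apply: measurable_funX; exact: mphi.
have phi20 x : (0%E <= (phi x ^+ 2)%:E :> \bar R)%E by rewrite lee_fin sqr_ge0.
pose P := (\int[mu]_x (phi x ^+ 2)%:E)%E.
have P0 : (0 <= P)%E by apply: integral_ge0 => x _; exact: phi20.
have Pfin : (P < +oo)%E.
  have := ball_function_powR_lty (ltr0n R 2) (excess_ball_function um u0 uB nu1 lam0).
  by under eq_integral do rewrite powR_mulrn// real_normK ?num_real//.
have SP : ((4 * Cf + 1)%:E * P <= \int[mu \x mu]_z (S lam z)%:E)%E.
  have SE0 z : (0%E <= (S lam z)%:E :> \bar R)%E by rewrite lee_fin S0.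
  have c0 : (0 <= (4 * Cf + 1)%:E :> \bar R)%E by rewrite lee_fin addr_ge0// mulr_ge0.
  have mF : measurable_fun setT (fun x => \int[mu]_y (S lam (x, y))%:E)%E :=
    @measurable_fun_fubini_tonelli_F _ _ _ _ _ mu (fun z => (S lam z)%:E) mS SE0.
  rewrite (@fubini_tonelli1 _ _ _ _ _ mu mu (fun z => (S lam z)%:E) mS SE0).
  have cR : 0 <= 4 * Cf + 1 by rewrite -lee_fin.
  rewrite /P -(ge0_integralZl_EFin _ measurableT (fun x _ => phi20 x) mphi2 cR).
  apply: (ge0_le_integral _ measurableT (fun x _ => mule_ge0 c0 (phi20 x))
    (measurable_funeM _ mphi2) mF).
  by move=> x _; rewrite -EFinM; exact: hall.
have {SP SE} : ((4 * Cf + 1)%:E * P <= (4 * Cf)%:E * P)%E by exact: le_trans SP SE.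
have Pf : P \is a fin_num by rewrite ge0_fin_numE.
rewrite -(fineK Pf) -!EFinM lee_fin => PP.
have {PP} P00 : P = 0%E.
  apply/eqP; rewrite eq_le P0 andbT -(fineK Pf) lee_fin; lra.
have absP : (\int[mu]_x `|(phi x ^+ 2)%:E| = 0)%E.
  by rewrite -P00; apply: eq_integral => x _; rewrite gee0_abs.
have [N0 [mN0 N00 sub]] := (ae_eq_integral_abs mu measurableT mphi2).1 absP.
apply/eqP; rewrite eq_le measure_ge0 andbT -N00; apply: le_measure; rewrite ?inE//.
  by apply: measurable_neq0; exact: mphi.
apply: subset_trans sub => x /= px h; have /eqP := h I.
by rewrite eqe sqrf_eq0 (negbTE px).
Qed.

End continuation.

Section nearby_planes.
Context {R : realType} {n : nat}.
Local Notation T := (Rn R n).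
Local Notation mu := (@lebesgue_Rn R n).
Variables (u : T -> R) (M : R).
Hypotheses (um : measurable_fun setT u) (u0 : forall x, 0 <= u x <= M)
  (uB : forall x, ~ unit_ball x -> u x = 0).
Variables (nu : T) (nu1 : dot nu nu = 1).

Let enu : enorm nu = 1.
Proof. by rewrite enormE nu1 sqrtr1. Qed.

Let gapB a b y : gap u nu b y - gap u nu a y =
  u (refl nu a y) - u (vadd (refl nu a y) (vscale (2 * (b - a)) nu)).
Proof. by rewrite /gap (refl_shift nu b a); ring. Qed.

Lemma measurable_gap_jump a b (delta : R) :
  measurable [set y | delta < `|gap u nu b y - gap u nu a y|].
Proof.
apply: measurable_gt; apply: (measurableT_comp (@normr_measurable R setT)).
by apply: measurable_funB; exact: measurable_gap.
Qed.

(** Two reflections in parallel hyperplanes differ by a translation of twice their distance. *)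
Lemma gap_near (delta e : R) : 0 < delta -> 0 < e -> exists2 rho, 0 < rho &
  forall a b, `|b - a| <= rho ->
    (mu [set y | (delta < `|gap u nu b y - gap u nu a y|)%R] <= e%:E)%E.
Proof.
move=> d0 e0; have [r r0 hr] := shift_continuity_in_measure um u0 uB d0 e0.
exists (r / 2); first by rewrite divr_gt0.
move=> a b ab; pose h := vscale (2 * (b - a)) nu.
have hh : enorm h <= r.
  by rewrite enorm_vscale enu mulr1 normrM ger0_norm//; lra.
have mJ := measurable_shift_gap um h delta.
apply: le_trans (hr h hh); rewrite -(lebesgue_Rn_refl nu1 a mJ).
rewrite (_ : [set y | _] = refl nu a @^-1` [set x | delta < `|u (vadd x h) - u x|])//.
by apply/seteqP; split=> y /=; rewrite gapB distrC.
Qed.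

Definition between a b : set T := [set y | ~ (a <= dot y nu <-> b <= dot y nu)].

Lemma betweenC a b : between a b = between b a.
Proof. by apply/seteqP; split=> y h k; apply: h; tauto. Qed.

Lemma measurable_between a b : measurable (between a b).
Proof.
rewrite (_ : between a b = ([set y | a <= dot y nu] `&` [set y | dot y nu < b]) `|`
    ([set y | b <= dot y nu] `&` [set y | dot y nu < a])).
  apply: measurableU; apply: measurableI.
  - by apply: measurable_le; exact: measurable_dot.
  - by apply: measurable_lt; exact: measurable_dot.
  - by apply: measurable_le; exact: measurable_dot.
  - by apply: measurable_lt; exact: measurable_dot.
apply/seteqP; split=> y; rewrite /between/=.
  have [ya|ya] := leP a (dot y nu); have [yb|yb] := leP b (dot y nu) => h.
  - by exfalso; apply: h.
  - by left.
  - by right.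
  - by exfalso; apply: h.
case=> -[h1 h2] [h3 h4].
  by move: h2; rewrite ltNge h3.
by move: h2; rewrite ltNge h4.
Qed.

(** The slab between two parallel hyperplanes is the set of points that a translation along [nu] moves into or out of a
half-space. *)
Lemma between_near a (e : R) : 0 < e -> exists2 rho, 0 < rho &
  forall b, `|b - a| <= rho -> (mu (unit_ball `&` between a b) <= e%:E)%E.
Proof.
move=> e0; have mA : measurable [set y : T | a <= dot y nu].
  by apply: measurable_le; exact: measurable_dot.
have [_ /(_ 1 e e0)[r r0 hr]] := translation_mcont mA.
exists r => // b ab; pose h := vscale (a - b) nu.
have hh : coord_small r h.
  by apply: coord_small_enorm; rewrite enorm_vscale enu mulr1 distrC.
apply: le_trans (hr h hh); apply: le_measure; rewrite ?inE.
- by apply: measurableI; [exact: measurable_unit_ball|exact: measurable_between].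
- apply: measurableI; first exact: measurable_box.
  by apply: measurable_flip => //; exact: measurable_translation.
- apply: setISS; first exact: unit_ball_box.
  move=> y; rewrite /between /flip/= dotDl dotZl nu1 mulr1 => yab k; apply: yab.
  by rewrite k; split=> ?; lra.
Qed.

(** A point where the excess jumps from zero to more than [delta] either changes sides or sees [gap] jump. *)
Lemma excess_small a b (delta : R) : no_excess u nu a -> 0 < delta ->
  (mu [set y | (delta < excess u nu b y)%R] <=
   mu [set y | (delta < `|gap u nu b y - gap u nu a y|)%R] + mu (unit_ball `&` between a b))%E.
Proof.
move=> na d0.
have mb : measurable [set y | delta < excess u nu b y].
  by apply: measurable_gt; exact: measurable_excess.
have mneq : measurable [set y | excess u nu a y != 0].
  by apply: measurable_neq0; exact: measurable_excess.
have mG := measurable_gap_jump a b delta.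
have mS : measurable (unit_ball `&` between a b).
  by apply: measurableI; [exact: measurable_unit_ball|exact: measurable_between].
apply: (@le_trans _ _ (mu ([set y | excess u nu a y != 0] `|`
   ([set y | delta < `|gap u nu b y - gap u nu a y|] `|` (unit_ball `&` between a b))))).
  apply: le_measure; rewrite ?inE//; first by do 2 apply: measurableU => //.
  move=> y /= yd; have [yb|yb] := leP b (dot y nu); last first.
    by have := excess_le0 u (ltW yb); rewrite leNgt (lt_trans d0 yd).
  have gb : delta < gap u nu b y.
    by move: yd; rewrite /excess yb; case: (leP (gap u nu b y) 0) => // _; rewrite ltNge (ltW d0).
  have yB : unit_ball y.
    apply: contrapT => /uB uy0; move: gb; rewrite /gap uy0 sub0r.
    by have /andP[? _] := u0 (refl nu b y); lra.
  have [ya|ya] := leP a (dot y nu); last first.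
    by right; right; split => //; rewrite /between/= yb leNgt ya; case=> _ /(_ isT).
  have [ea|ea] := eqVneq (excess u nu a y) 0; last by left.
  right; left; have ga : gap u nu a y <= 0.
    by move: ea; rewrite /excess ya; case: leP => // g0 /eqP; rewrite gt_eqF.
  by rewrite gtr0_norm; lra.
apply: le_trans (measureU2 _ _ _) _ => //; first exact: measurableU.
by rewrite [X in (X + _ <= _)%E]na add0e; exact: measureU2.
Qed.

(** The excess is odd and the reflection preserves the measure. *)
Lemma no_excess_pos a : mu [set y | 0 < excess u nu a y] = 0%E -> no_excess u nu a.
Proof.
move=> h; have mp : measurable [set y | 0 < excess u nu a y].
  by apply: measurable_gt; exact: measurable_excess.
have mm : measurable [set y | excess u nu a y < 0].
  by apply: measurable_lt; exact: measurable_excess.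
have E : [set y | excess u nu a y < 0] = refl nu a @^-1` [set y | 0 < excess u nu a y].
  by apply/seteqP; split=> y /=; rewrite excess_refl// oppr_gt0.
have h' : mu [set y | excess u nu a y < 0] = 0%E by rewrite E lebesgue_Rn_refl.
apply/eqP; rewrite eq_le measure_ge0 andbT.
rewrite (_ : [set x | _] = [set y | 0 < excess u nu a y] `|` [set y | excess u nu a y < 0]).
  by apply: le_trans (measureU2 _ _ _) _ => //; rewrite [X in (X + _)%E]h [X in (_ + X)%E]h' add0e.
apply/seteqP; split => x /=; rewrite neq_lt; first by move=> /orP[?|?]; [right|left].
by move=> [->|->]; rewrite ?orbT.
Qed.

(** By [excess_small], with both terms on its right small, the excess is at most [delta] almost everywhere, for every
[delta]. *)
Lemma no_excess_closed a : (forall rho, 0 < rho -> exists2 b, `|b - a| <= rho & no_excess u nu b) ->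
  no_excess u nu a.
Proof.
move=> near_a; apply: no_excess_pos.
have me (d : R) : measurable [set y | d < excess u nu a y].
  by apply: measurable_gt; exact: measurable_excess.
have z (d : R) : 0 < d -> mu [set y | d < excess u nu a y] = 0%E.
  move=> d0; apply/eqP; rewrite eq_le measure_ge0 andbT.
  apply/lee_addgt0Pr => e e0; rewrite add0e.
  have e20 : 0 < e / 2 by rewrite divr_gt0.
  have [r1 r10 h1] := gap_near d0 e20; have [r2 r20 h2] := between_near a e20.
  have r0 : 0 < Num.min r1 r2 by rewrite lt_min r10.
  have [b ab nb] := near_a _ r0.
  apply: le_trans (excess_small a nb d0) _; rewrite (splitr e) EFinD betweenC.
  apply: leeD.
    by apply: h1; rewrite distrC (le_trans ab)// ge_min lexx.
  by apply: h2; rewrite (le_trans ab)// ge_min lexx orbT.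
rewrite (_ : [set y | _] = \bigcup_k [set y | k.+1%:R^-1 < excess u nu a y]).
  apply/negligibleP; first by apply: bigcup_measurable.
  apply: negligible_bigcup => k; apply/negligibleP => //; apply: z.
  by rewrite invr_gt0.
apply/seteqP; split=> y /=.
  move=> y0; exists (Num.truncn (excess u nu a y)^-1) => //=.
  rewrite invf_plt ?posrE//.
  have i0 : 0 <= (excess u nu a y)^-1 by rewrite invr_ge0 ltW.
  by have /andP[_ h] := truncn_itv i0.
by move=> [k _ /=]; apply: lt_trans; rewrite invr_gt0.
Qed.

End nearby_planes.

(** * Moving the hyperplane *)
Section moving.
Context {R : realType} {n : nat}.
Local Notation T := (Rn R n).
Local Notation mu := (@lebesgue_Rn R n).
Variables (s p : R) (s01 : 0 < s < 1) (p12 : 1 < p <= 2).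
Local Notation N := (order (n:=n) s p).
Local Notation K := (ker N).
Variables (f : R -> R) (u : T -> R) (M Kf Cf : R) (M0 : 0 < M) (Cf0 : 0 <= Cf).
Hypotheses (um : measurable_fun setT u) (u0 : forall x, 0 <= u x <= M)
  (uB : forall x, ~ unit_ball x -> u x = 0)
  (uE : (\int[mu \x mu]_z energy s p u z < +oo)%E).
Hypotheses (fm : measurable_fun setT (f \o u))
  (fK : forall x, `|f (u x)| <= Kf)
  (fL : forall x y, `|f (u x) - f (u y)| <= Cf * `|u x - u y|).
Hypothesis (weak : forall phi, Wsp0 s p phi ->
  frac_plap s p u phi = (\int[mu]_(x in unit_ball) (f (u x) * phi x)%:E)%E).
Variables (nu : T) (nu1 : dot nu nu = 1).
Local Notation c := (ellipticity p M).
Local Notation C1 := (4 * Cf + 1).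

Let C10 : 0 < C1. Proof. by rewrite ltr_wpDl// mulr_ge0. Qed.
Let c0 : 0 < c. Proof. exact: ellipticity_gt0. Qed.

Let spec_r (r : R) := C1 <= c / 8 * ((4 * r) `^ N)^-1 * (2 * (r / n.+1%:R)) ^+ n.

Let ex_r : exists2 r, 0 < r <= 1 & spec_r r.
Proof.
have sp0 : 0 < s * p.
  by move: s01 p12 => /andP[? _] /andP[? _]; rewrite mulr_gt0// (lt_trans ltr01).
exact: (small_radius n sp0 C10 c0).
Qed.

Let criterion := no_excess_criterion s01 p12 M0 Cf0 um u0 uB uE fm fK fL weak nu1.

(** The ball of [probe_lower] lies on the other side of the hyperplane, where the excess is nonpositive. *)
Let near_plane (r lam : R) x : 0 < r -> spec_r r -> lam <= dot x nu -> dot x nu - lam <= r ->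
  ((C1 * excess u nu lam x ^+ 2)%:E <= \int[mu]_y (form_sum s p u nu lam (x, y))%:E)%E.
Proof.
move=> r0 hr xl xr.
have phi0 := excess_ge0 u xl.
apply: le_trans (probe_lower s01 p12 M0 um u0 nu1 r0 xl measurable0 _ _).
- by rewrite lee_fin; apply: ler_wpM2r => //; exact: sqr_ge0.
- by rewrite setI0 measure0 mule_ge0// lee_fin invr_ge0.
move=> y yP _; apply: le_trans phi0; rewrite pmulr_rle0//.
by apply: excess_le0; have := probe_dot nu1 r0 yP; lra.
Qed.

(** The cap cut off the unit ball by a hyperplane near its boundary lies within a small distance of the hyperplane. *)
Lemma no_excess_start : exists2 r, 0 < r &
  forall lam, 0 <= lam -> 1 - lam <= r -> no_excess u nu lam.
Proof.
have [r /andP[r0 r1] hr] := ex_r; exists r => // lam lam0 lr.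
apply: criterion => // x xl.
have [e0|e0] := eqVneq (excess u nu lam x) 0.
  rewrite e0 expr0n mulr0; apply: integral_ge0 => y _.
  by rewrite lee_fin; exact: (form_sum_ge0 s01 p12 M0 u0 nu1).
apply: (near_plane r0 hr xl).
have xB : unit_ball x.
  by apply: contrapT => /(excess_support u0 uB nu1 lam0) /eqP; rewrite (negbTE e0).
have : dot x nu < 1.
  have : dot x nu ^+ 2 < 1.
    apply: le_lt_trans (dot_unit_le x nu1) _.
    by move: xB; rewrite /unit_ball/= enorm_ltE// expr1n.
  by move=> h; rewrite ltNge; apply/negP => h1; move: h; rewrite ltNge exprn_ege1.
lra.
Qed.

(** Reflecting the point [y] increases its distance to [x] definitely. The kernel gap applies on a bounded range of
distances, hence the use of [gap u nu lam y < 0], which puts the mirror image of [y] in the unit ball. *)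
Let far_point (lam r k e : R) x y : 0 <= lam -> 0 < r -> 0 < e ->
  (forall a b z w : T, a <> b -> edist z w <= 2 -> edist a b ^+ 2 + Num.min (4 * r * e) 4 <= edist z w ^+ 2 ->
    k <= K a b - K z w) ->
  unit_ball x -> r <= dot x nu - lam -> e <= dot y nu - lam -> gap u nu lam y < 0 -> x <> y ->
  k <= K x y - K x (refl nu lam y).
Proof.
move=> lam0 r0 e0 hk xB xr ye gy xy.
have RyB : unit_ball (refl nu lam y).
  apply: (u_gt0_ball uB); move: gy; rewrite /gap.
  by have /andP[? _] := u0 y; lra.
apply: hk => //.
  have z0 : (0:R) <= 2 by [].
  rewrite -(ler_pXn2r (_ : 0 < 2)%N) ?nnegrE ?edist_ge0// edist2.
  move: xB RyB; rewrite /unit_ball/= !enorm_ltE// expr1n => h1.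
  move: (refl nu lam y) => z h2; have := dot_ge0 (vadd x z).
  rewrite !dotDl !dotDr (dotC z x); lra.
rewrite (edist2_refl nu1) lerD2l ge_min; apply/orP; left.
rewrite -mulrA -[leRHS]mulrA; apply: ler_wpM2l => //.
by apply: ler_pM => //; exact: ltW.
Qed.

(** Where the excess is small it is controlled by the set on which [u] lies below its reflection, which enters the form
linearly; the set where it is large is small, and there the singularity of the kernel takes over. *)
Lemma no_excess_step lam0 : 0 < lam0 -> no_excess u nu lam0 ->
  mu [set y | lam0 <= dot y nu /\ gap u nu lam0 y < 0] != 0%E ->
  exists2 e, 0 < e & forall lam, 0 <= lam -> lam0 - e <= lam <= lam0 -> no_excess u nu lam.
Proof.
move=> lam00 nl0 pos.
have [r /andP[r0 r1] hr] := ex_r.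
have mgap b : measurable_fun setT (gap u nu b) by exact: measurable_gap.
(* the points of that set where the gap is definitely negative, at a definite distance from the hyperplane *)
pose E (k : nat) := [set y | lam0 + k.+1%:R^-1 <= dot y nu] `&` [set y | gap u nu lam0 y < - (2 * k.+1%:R^-1)].
have mE k : measurable (E k).
  by apply: measurableI; [apply: measurable_le; exact: measurable_dot|exact: measurable_lt].
have [k Ek] : exists k, mu (E k) != 0%E.
  apply: contrapT => /forallNP Ek; move/negP: pos; apply; apply/eqP.
  rewrite (_ : [set y | _] = \bigcup_k E k).
    apply/negligibleP; first exact: bigcup_measurable.
    apply: negligible_bigcup => k; apply/negligibleP => //.
    by apply/eqP/negPn/negP; exact: Ek.
  apply/seteqP; split=> y /=; last first.
    move=> [k _ [/= h1 h2]]; have k0 : 0 < k.+1%:R^-1 :> R by rewrite invr_gt0.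
    by move: h1 h2 k0; move: (_^-1) => q h1 h2 k0; split; lra.
  move=> [yl gy].
  have yl' : lam0 < dot y nu.
    rewrite lt_neqAle yl andbT; apply/eqP => ye; move: gy.
    by rewrite /gap refl_fix// subrr ltxx.
  pose t := Num.min (dot y nu - lam0) (- gap u nu lam0 y / 2).
  have t0 : 0 < t by rewrite lt_min subr_gt0 yl' divr_gt0// oppr_gt0.
  have i0 : 0 <= t^-1 by rewrite invr_ge0 ltW.
  have /andP[_ hk] := truncn_itv i0.
  have kt : (Num.truncn t^-1).+1%:R^-1 < t by rewrite invf_plt ?posrE.
  exists (Num.truncn t^-1) => //; move: kt; rewrite /E/=; move: ((Num.truncn t^-1).+1%:R^-1) => q.
  rewrite lt_min => /andP[q1 q2].
  by split=> /=; lra.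
pose th : R := k.+1%:R^-1; have th0 : 0 < th by rewrite invr_gt0.
have Efin : mu (E k) \is a fin_num.
  rewrite ge0_fin_numE ?measure_ge0//.
  apply: (@le_lt_trans _ _ (mu (refl nu lam0 @^-1` unit_ball))); last first.
    by rewrite lebesgue_Rn_refl//; [rewrite unit_ballE eball_lty|exact: measurable_unit_ball].
  apply: le_measure; rewrite ?inE//.
    by rewrite -[X in measurable X]setTI; apply: (measurable_refl nu lam0) => //; exact: measurable_unit_ball.
  move=> y [_ /=]; rewrite -/th => gy; apply: (u_gt0_ball uB).
  by move: gy; rewrite /gap; have /andP[? _] := u0 y; lra.
pose mE' := fine (mu (E k)).
have mE0 : 0 < mE' by rewrite fine_gt0// lt0e Ek measure_ge0/= -ge0_fin_numE ?measure_ge0.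
have D4 : 0 < Num.min (4 * r * (th / 2)) 4 <= 2 ^+ 2.
  have h : 0 < 4 * r * (th / 2) by rewrite !mulr_gt0// divr_gt0.
  by rewrite lt_min h ge_min ltr0n; apply/orP; right; rewrite expr2; lra.
have [kap kap0 hkap] := @ker_gap R n N (order_gt0 (n:=n) s01 p12) 2 _ (ltr0n R 2) D4.
pose m0 := c * th * kap * (mE' / 2).
have mE20 : 0 < mE' / 2 by rewrite divr_gt0.
have m00 : 0 < m0 by apply: mulr_gt0 mE20; apply: mulr_gt0 kap0; exact: mulr_gt0.
(* [m0 * excess] is the linear lower bound; below [2 * delta] it dominates [C1 * excess ^+ 2] *)
pose delta := m0 / (2 * C1).
have delta0 : 0 < delta by rewrite divr_gt0// mulr_gt0.
pose V := fine (mu (eball (mkv (fun=> 0)) r)).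
have V0 : 0 < V by rewrite fine_gt0// eball_gt0//= eball_lty.
have q0 : 0 < V / 4 by rewrite divr_gt0.
have [r1' r10 h1] := gap_near um u0 uB nu1 delta0 q0.
have [r2 r20 h2] := between_near nu1 lam0 q0.
have [r3 r30 h3] := gap_near um u0 uB nu1 th0 mE20.
pose e := Num.min (th / 2) (Num.min r1' (Num.min r2 r3)).
have e0 : 0 < e by rewrite !lt_min divr_gt0// r10 r20.
exists e => // lam laml0 /andP[lam1 lam2].
have dl : `|lam - lam0| <= e by rewrite ler0_norm; lra.
have [dl0 dl1 dl2 dl3] : [/\ lam0 - lam <= th / 2, `|lam - lam0| <= r1', `|lam - lam0| <= r2 & `|lam - lam0| <= r3].
  have ee : e <= e by [].
  move: ee; rewrite {2}/e !le_min => /and4P[a1 a2 a3 a4].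
  by split; [lra|exact: le_trans a2|exact: le_trans a3|exact: le_trans a4].
(* at most half of any ball of radius [r], so that [probe_lower] applies to an excess above [2 * delta] *)
pose D := [set y | delta < excess u nu lam y].
have mD : measurable D by apply: measurable_gt; exact: measurable_excess.
have Dsmall : (mu D <= (V / 2)%:E)%E.
  apply: le_trans (excess_small um u0 uB lam nl0 delta0) _.
  rewrite (_ : V / 2 = V / 4 + V / 4); last by field.
  by rewrite EFinD; apply: leeD; [exact: h1|exact: h2].
(* what remains of [E k] after the hyperplane has moved *)
pose A := E k `&` [set y | gap u nu lam y <= - th].
have mA : measurable A.
  apply: measurableI => //.
  rewrite (_ : [set y | _] = [set y | th <= - gap u nu lam y]).
    by apply: measurable_le; exact: measurableT_comp.
  by apply/seteqP; split=> y /=; rewrite lerNr.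
have Abig : ((mE' / 2)%:E <= mu A)%E.
  have EA : (mu (E k) <= mu A + (mE' / 2)%:E)%E.
    pose J := [set y | th < `|gap u nu lam y - gap u nu lam0 y|].
    have mJ : measurable J by exact: measurable_gap_jump.
    apply: (@le_trans _ _ (mu (A `|` J))).
      apply: le_measure; rewrite ?inE//; first exact: measurableU.
      move=> y Ey; have [gy|gy] := leP (gap u nu lam y) (- th); first by left.
      right; rewrite /J/=; move: Ey => [_ /=]; rewrite -/th => gy0.
      by rewrite gtr0_norm; lra.
    by apply: le_trans (measureU2 _ _ _) _ => //; rewrite leeD2l//; exact: h3.
  have Afin : mu A \is a fin_num.
    rewrite ge0_fin_numE ?measure_ge0//; apply: le_lt_trans (_ : mu (E k) < +oo)%E.
      by apply: le_measure; rewrite ?inE//; exact: subIsetl.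
    by rewrite -ge0_fin_numE ?measure_ge0.
  move: EA; rewrite -(fineK Efin) -(fineK Afin) -EFinD !lee_fin -/mE'; lra.
apply: criterion => // x xl.
have [p0|p0] := eqVneq (excess u nu lam x) 0.
  rewrite p0 expr0n mulr0; apply: integral_ge0 => y _.
  by rewrite lee_fin; exact: (form_sum_ge0 s01 p12 M0 u0 nu1).
have phi0 := excess_ge0 u xl.
have [xr|xr] := leP (dot x nu - lam) r; first exact: (near_plane r0 hr xl).
have [px|px] := leP (excess u nu lam x) (2 * delta); last first.
  apply: le_trans (probe_lower s01 p12 M0 um u0 nu1 r0 xl mD _ _).
  - by rewrite lee_fin; apply: ler_wpM2r => //; exact: sqr_ge0.
  - have -> : mu (probe nu x r) = V%:E by rewrite /probe lebesgue_Rn_eball fineK// fin_eball.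
    rewrite -EFinM mulrC.
    apply: le_trans Dsmall; apply: le_measure; rewrite ?inE; [|exact: mD|exact: subIsetr].
    by apply: measurableI => //; exact: measurable_eball.
  - by move=> y _ /negP; rewrite /D/= -leNgt => yd; lra.
have xB : unit_ball x.
  by apply: contrapT => /(excess_support u0 uB nu1 laml0) /eqP; rewrite (negbTE p0).
have hA y : A y -> [/\ lam <= dot y nu, gap u nu lam y <= - th &
    excess u nu lam x != 0 -> kap <= K x y - K x (refl nu lam y)].
  move=> [[/=]]; rewrite -/th => yl gy0 gy.
  have gyneg : gap u nu lam y < 0 by lra.
  split; [lra|exact: gy|].
  move=> _; apply: (far_point laml0 r0 (_ : 0 < th / 2) hkap xB) => //; [by rewrite divr_gt0|exact: ltW|lra|].
  move=> xy; move: p0; rewrite xy /excess ifT ?max_r ?eqxx//; first exact: ltW.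
  lra.
apply: le_trans (gap_lower s01 p12 M0 um u0 nu1 xl mA (ltW th0) (ltW kap0) hA).
have ct0 : 0 <= c * th * kap * excess u nu lam x.
  by apply: mulr_ge0 => //; apply: ltW; apply: mulr_gt0 kap0; exact: mulr_gt0.
apply: (@le_trans _ _ ((c * th * kap * excess u nu lam x)%:E * (mE' / 2)%:E)%E); last first.
  by apply: lee_wpmul2l.
rewrite -EFinM lee_fin (_ : _ * _ * (mE' / 2) = m0 * excess u nu lam x); last by rewrite /m0; ring.
rewrite expr2 mulrA; apply: ler_wpM2r => //.
move: px; rewrite /delta => px.
apply: (@le_trans _ _ (C1 * (2 * (m0 / (2 * C1))))); first by rewrite ler_pM2l.
by rewrite le_eqVlt; apply/orP; left; apply/eqP; field; rewrite gt_eqF.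
Qed.

End moving.

(** * Vanishing on a ball *)
Section almost_everywhere.
Context {R : realType} {n : nat}.
Local Notation T := (Rn R n).
Local Notation mu := (@lebesgue_Rn R n).
Variables (s p : R).

Lemma ae_pair (P : T -> Prop) : {ae mu, forall x, P x} ->
  {ae (mu \x mu)%E, forall z, P z.1 /\ P z.2}.
Proof.
move=> [N [mN N0 hN]].
exists ((N `*` setT) `|` (setT `*` N)); split.
- by apply: measurableU; exact: measurableX.
- apply/eqP; rewrite eq_le measure_ge0 andbT.
  apply: le_trans (measureU2 _ _ _) _; [exact: measurableX|exact: measurableX|].
  rewrite [X in (X + _ <= _)%E]product_measure1E// [X in (_ + X <= _)%E]product_measure1E//.
  by rewrite [X in (X * _ + _ <= _)%E]N0 [X in (_ + _ * X <= _)%E]N0 mul0e mule0 adde0.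
move=> -[x y] /= h; have [Nx|Nx] := pselect (N x); first by left.
right; split => //; apply: contrapT => Ny; apply: h; split; apply: contrapT => h'.
  by apply: Nx; exact: hN.
by apply: Ny; exact: hN.
Qed.

Variables (u v : T -> R).
Hypotheses (um : measurable_fun setT u) (vm : measurable_fun setT v)
  (uv : {ae mu, forall x, u x = v x}).

Lemma energy_ae : (\int[mu \x mu]_z energy s p u z = \int[mu \x mu]_z energy s p v z)%E.
Proof.
apply: ae_eq_integral => //; [exact: measurable_energy|exact: measurable_energy|].
by apply: filterS (ae_pair uv) => z [h1 h2] _; rewrite /energy h1 h2.
Qed.

Lemma frac_plap_ae phi : measurable_fun setT phi -> frac_plap s p u phi = frac_plap s p v phi.
Proof.
move=> phim; rewrite !frac_plapE; congr (_ * _)%E.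
apply: ae_eq_integral => //.
- by apply/measurable_EFinP; exact: measurable_form_density.
- by apply/measurable_EFinP; exact: measurable_form_density.
by apply: filterS (ae_pair uv) => z [h1 h2] _; rewrite /form_density h1 h2.
Qed.

Lemma reaction_ae (f : R -> R) phi : measurable_fun setT (f \o u) -> measurable_fun setT (f \o v) ->
  measurable_fun setT phi ->
  (\int[mu]_(x in unit_ball) (f (u x) * phi x)%:E =
   \int[mu]_(x in unit_ball) (f (v x) * phi x)%:E)%E.
Proof.
move=> fum fvm phim; have mB := @measurable_unit_ball R n.
apply: ae_eq_integral => //.
- by apply/measurable_EFinP/measurable_funTS; exact: measurable_funM.
- by apply/measurable_EFinP/measurable_funTS; exact: measurable_funM.
by apply: filterS uv => z h _; rewrite h.
Qed.

Lemma weak_ae (f : R -> R) : measurable_fun setT (f \o u) -> measurable_fun setT (f \o v) ->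
  (forall phi, Wsp0 s p phi ->
    frac_plap s p u phi = (\int[mu]_(x in unit_ball) (f (u x) * phi x)%:E)%E) ->
  (forall phi, Wsp0 s p phi ->
    frac_plap s p v phi = (\int[mu]_(x in unit_ball) (f (v x) * phi x)%:E)%E).
Proof.
move=> fum fvm weak phi phiW.
have phim : measurable_fun setT phi.
  by have [[/andP[]]] := phiW; rewrite inE.
by rewrite -(frac_plap_ae phim) weak// reaction_ae.
Qed.

End almost_everywhere.

Section vanishing.
Context {R : realType} {n : nat}.
Local Notation T := (Rn R n).
Local Notation mu := (@lebesgue_Rn R n).
Variables (s p : R) (s01 : 0 < s < 1) (p12 : 1 < p <= 2).
Local Notation N := (order (n:=n) s p).
Local Notation K := (ker N).
Variables (f : R -> R) (u : T -> R) (M : R) (f0 : 0 <= f 0).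
Hypotheses (um : measurable_fun setT u) (u0 : forall x, 0 <= u x <= M)
  (uB : forall x, ~ unit_ball x -> u x = 0)
  (uE : (\int[mu \x mu]_z energy s p u z < +oo)%E).
Hypothesis (weak : forall phi, Wsp0 s p phi ->
  frac_plap s p u phi = (\int[mu]_(x in unit_ball) (f (u x) * phi x)%:E)%E).
Variables (z : T) (rho : R) (rho0 : 0 < rho).
Hypotheses (zB : eball z rho `<=` unit_ball) (uz : forall x, eball z rho x -> u x = 0).

(** A rescaled copy of [u] is a test function supported in the ball, nonnegative and, unless [u] is zero, nonzero. *)
Let phi x := u (dilation z rho x).

Let phim : measurable_fun setT phi.
Proof. by apply: (measurableT_comp um); exact: measurable_dilation. Qed.

Let phi_ge0 x : 0 <= phi x. Proof. by have /andP[] := u0 (dilation z rho x). Qed.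

Let phi_supp x : ~ eball z rho x -> phi x = 0.
Proof. by move=> xz; apply: uB; rewrite (dilation_unit_ball z x rho0). Qed.

Let phi_bf : ball_function M phi.
Proof.
split=> // [x|x xB]; last by apply: phi_supp => /zB.
by rewrite ger0_norm//; have /andP[] := u0 (dilation z rho x).
Qed.

Let ker_dilation x y : K x y = (rho `^ N)^-1 * K (dilation z rho x) (dilation z rho y).
Proof.
rewrite /ker edist_dilation// powRM ?edist_ge0 ?invr_ge0 ?(ltW rho0)//.
have -> : rho^-1 `^ N = (rho `^ N)^-1.
  by rewrite -(powR_inv1 (ltW rho0)) -powRrM mulN1r powRN.
by rewrite invfM invrK mulrA mulVf ?mul1r// gt_eqF// powR_gt0.
Qed.

Let phi_energy : (\int[mu \x mu]_x energy s p phi x < +oo)%E.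
Proof.
have [c c0 hc] := lebesgue_Rn_dilation z rho0.
have md := measurable_dilation z rho.
pose k := (rho `^ N)^-1; have k0 : 0 <= k by rewrite invr_ge0 powR_ge0.
pose g w := (k%:E * energy s p u w)%E.
have mg : measurable_fun setT g by apply: measurable_funeM; exact: measurable_energy.
have g0 w : (0 <= g w)%E by apply: mule_ge0; [rewrite lee_fin|exact: energy_ge0].
rewrite (_ : (\int[mu \x mu]_x energy s p phi x =
    \int[mu \x mu]_w g (dilation z rho w.1, dilation z rho w.2))%E); last first.
  apply: eq_integral => w _; rewrite /g /energy /= -EFinM ker_dilation; congr EFin.
  by rewrite mulrCA.
rewrite (ge0_integral_comp2 md hc md hc mg g0) /g.
rewrite (ge0_integralZl_EFin _ measurableT (fun w _ => energy_ge0 s p u w) (measurable_energy s p um) k0).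
have i0 : (0 <= \int[mu \x mu]_w energy s p u w)%E.
  by apply: integral_ge0 => w _; exact: energy_ge0.
rewrite muleA -EFinM; apply: lte_mul_pinfty => //.
by rewrite lee_fin !mulr_ge0.
Qed.

Let phiW : Wsp0 s p phi.
Proof. exact: (ball_function_Wsp0 p12 phi_bf phi_energy). Qed.

Let p1 : 1 < p. Proof. by case/andP: p12. Qed.

Let q := form_density s p u phi.

Let uzphi x : phi x != 0 -> u x = 0.
Proof.
by move=> px; apply: uz; apply: contrapT => /phi_supp /eqP; rewrite (negbTE px).
Qed.

(** [u] and [phi] are never both nonzero at a point, so their differences have opposite signs. *)
Let q_le0 w : q w <= 0.
Proof.
case: w => x y; rewrite /q /form_density/=.
apply: mulr_le0_ge0; last exact: ker_ge0.
have ux : 0 <= u x by have /andP[] := u0 x.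
have uy : 0 <= u y by have /andP[] := u0 y.
have [px|px] := eqVneq (phi x) 0; have [py|py] := eqVneq (phi y) 0.
- by rewrite px py subrr mulr0.
- rewrite (uzphi py) subr0 px sub0r; apply: mulr_ge0_le0; last by rewrite oppr_le0.
  by rewrite ge0_GpE ?powR_ge0.
- rewrite (uzphi px) sub0r py subr0 GpN; apply: mulr_le0_ge0 => //.
  by rewrite oppr_le0 ge0_GpE ?powR_ge0.
- by rewrite (uzphi px) (uzphi py) subrr Gp0 mul0r.
Qed.

Let q_neq0 x y : phi x != 0 -> u y != 0 -> q (x, y) != 0.
Proof.
move=> px uy; have ux := uzphi px.
have py : phi y = 0 by apply/eqP; apply: contraNT uy => /uzphi ->.
rewrite /q /form_density/= ux py sub0r subr0 GpN mulNr mulNr oppr_eq0.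
have uy0 : 0 < u y by rewrite lt_neqAle eq_sym uy/=; have /andP[] := u0 y.
have xy : x <> y by move=> xy; move: uy; rewrite -xy ux eqxx.
apply: mulf_neq0.
  by apply: mulf_neq0 px; rewrite gt_eqF// Gp_gt0.
by rewrite gt_eqF// invr_gt0 powR_gt0// edist_gt0.
Qed.

(** If [u] vanished on a ball, then testing with a nonnegative bump in that ball, namely a rescaled copy of [u]
itself, the nonlocal operator would be negative there unless [u] is zero, against [f 0 >= 0]. *)
Lemma vanishing_on_ball : mu [set x | u x != 0] = 0%E.
Proof.
have qI : (mu \x mu)%E.-integrable setT (EFin \o q) := form_density_integrable p12 um phim uE phi_energy.
have [mq _] := integrableP _ _ _ qI.
have rhs0 : (0 <= \int[mu]_(x in unit_ball) (f (u x) * phi x)%:E)%E.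
  apply: integral_ge0 => x _; rewrite lee_fin; have [->|px] := eqVneq (phi x) 0; first by rewrite mulr0.
  by rewrite (uzphi px) mulr_ge0.
have q0 : (0 <= \int[mu \x mu]_w (q w)%:E)%E.
  move: rhs0; rewrite -(weak phiW) frac_plapE -/q.
  have := integrable_fin_num measurableT qI; rewrite /= => /fineK <-.
  by rewrite -EFinM !lee_fin pmulr_rge0.
have absq : (\int[mu \x mu]_w `|(q w)%:E| = 0)%E.
  apply/eqP; rewrite eq_le; apply/andP; split; last by apply: integral_ge0 => w _; exact: abse_ge0.
  rewrite (_ : (\int[mu \x mu]_w `|(q w)%:E| = \int[mu \x mu]_w (- (q w)%:E))%E); last first.
    by apply: eq_integral => w _; rewrite lee0_abs// lee_fin.
  have -> : (\int[mu \x mu]_w (- (q w)%:E) = - \int[mu \x mu]_w (q w)%:E)%E.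
    rewrite -mulN1e -EFinN -(integralZl measurableT qI (-1)).
    by apply: eq_integral => w _; rewrite /= -EFinM mulN1r.
  by rewrite oppe_le0.
have [Z [mZ Z0 hZ]] := (ae_eq_integral_abs (mu \x mu)%E measurableT mq).1 absq.
have mP := measurable_neq0 phim.
have mU := measurable_neq0 um.
have rect : ([set x | phi x != 0] `*` [set y | u y != 0]) `<=` Z.
  move=> [x y] /= [px uy]; apply: hZ => /= h; have /eqP := h I.
  by rewrite eqe (negbTE (q_neq0 px uy)).
pose P := [set x | phi x != 0]; pose U := [set y | u y != 0].
have : ((mu \x mu) (P `*` U) = 0)%E.
  apply/eqP; rewrite eq_le measure_ge0 andbT -Z0; apply: le_measure; rewrite ?inE//.
  exact: measurableX.
have [c c0 hc] := lebesgue_Rn_dilation z rho0.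
have Pc : (mu P = c%:num%:E * mu U)%E by rewrite -(hc _ mU).
rewrite product_measure1E// [X in (X * _)%E]Pc => /eqP; rewrite !mule_eq0 eqe gt_eqF//=.
by rewrite orbb => /eqP.
Qed.

End vanishing.

(** * Reaching the origin *)
Section all_planes.
Context {R : realType} {n : nat}.
Local Notation T := (Rn R n).
Local Notation mu := (@lebesgue_Rn R n).
Variables (s p : R) (s01 : 0 < s < 1) (p12 : 1 < p <= 2).
Variables (f : R -> R) (u : T -> R) (M Kf Cf : R) (M0 : 0 < M) (Cf0 : 0 <= Cf).
Hypotheses (um : measurable_fun setT u) (u0 : forall x, 0 <= u x <= M)
  (uB : forall x, ~ unit_ball x -> u x = 0)
  (uE : (\int[mu \x mu]_z energy s p u z < +oo)%E).
Hypotheses (fm : measurable_fun setT f) (f0 : 0 <= f 0)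
  (fK : forall x, `|f (u x)| <= Kf)
  (fL : forall x y, `|f (u x) - f (u y)| <= Cf * `|u x - u y|).
Hypothesis (weak : forall phi, Wsp0 s p phi ->
  frac_plap s p u phi = (\int[mu]_(x in unit_ball) (f (u x) * phi x)%:E)%E).
Hypothesis (unz : mu [set x | u x != 0] <> 0%E).
Variables (nu : T) (nu1 : dot nu nu = 1).

Let far_cap_radius (lam0 : R) := Num.min lam0 1 / 6.
Let far_cap_center (lam0 : R) : T := vscale (- (1 - 2 * far_cap_radius lam0)) nu.

(** The reflection adds [4 * lam0 * (lam0 - dot y nu)] to the squared norm, more than what a point near the boundary
point of the unit ball opposite to [nu] lacks to leave the ball. *)
Let far_cap (lam0 : R) y : 0 < lam0 -> eball (far_cap_center lam0) (far_cap_radius lam0) y ->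
  [/\ unit_ball y, ~ unit_ball (refl nu lam0 y) & dot y nu <= lam0].
Proof.
move=> lam00; set r := far_cap_radius lam0; set z := far_cap_center lam0.
have r0 : 0 < r by rewrite divr_gt0// lt_min lam00 ltr01.
have r1 : 6 * r <= 1.
  by rewrite /r /far_cap_radius mulrCA divff// mulr1 ge_min lexx orbT.
have rl : 6 * r <= lam0.
  by rewrite /r /far_cap_radius mulrCA divff// mulr1 ge_min lexx.
have zE : z = vscale (- (1 - 2 * r)) nu by [].
rewrite /eball/= edistE enorm_ltE// zE; set v := vsub y _ => vr.
have vn : `|dot v nu| < r.
  rewrite -(ltr_pXn2r (_ : 0 < 2)%N) ?nnegrE ?(ltW r0)//.
  by rewrite real_normK ?num_real//; apply: le_lt_trans (dot_unit_le v nu1) vr.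
have va : dot v nu = dot y nu + (1 - 2 * r).
  by rewrite dotBl dotZl nu1; ring.
have vv : dot v v = dot y y + 2 * (1 - 2 * r) * dot y nu + (1 - 2 * r) ^+ 2.
  by rewrite dotBl !dotBr !dotZl !dotZr nu1 (dotC nu y); ring.
move: vn; rewrite ltr_norml va => /andP[a1 a2].
have cs := dot_unit_le y nu1.
have ryy := dot_refl_self nu1 lam0 y.
move: (dot y nu) a1 a2 cs ryy vv => a a1 a2 cs ryy vv.
have b1 : 0 < 1 - 2 * r by lra.
have h1 : 0 <= (1 - 2 * r) * (a + (1 - 2 * r) + r) by rewrite mulr_ge0//; lra.
have h2 : (1 - 3 * r) ^+ 2 <= a ^+ 2.
  by rewrite -(sqrrN a) ler_pXn2r ?nnegrE//; lra.
have h3 : 0 <= lam0 * (lam0 - a - 1 / 2) by rewrite mulr_ge0 ?(ltW lam00)//; lra.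
have h4 : 0 < r * (1 - r) by rewrite mulr_gt0//; lra.
have h5 : 0 <= r ^+ 2 by exact: sqr_ge0.
split.
- by rewrite /unit_ball/= enorm_ltE// expr1n; lra.
- rewrite /unit_ball/= enorm_ltE// expr1n => h; lra.
- lra.
Qed.

(** If [u] were nowhere below its reflection beyond the hyperplane, then on the near side it would be at most its
reflection, which is zero on the far cap. *)
Let no_gap_vanish (lam0 : R) : 0 < lam0 ->
  mu [set y | lam0 <= dot y nu /\ gap u nu lam0 y < 0] = 0%E ->
  mu [set y | eball (far_cap_center lam0) (far_cap_radius lam0) y /\ u y != 0] = 0%E.
Proof.
move=> lam00 h; set B := eball _ _.
have mH : measurable [set y | lam0 <= dot y nu /\ gap u nu lam0 y < 0].
  apply: measurableI; first by apply: measurable_le; exact: measurable_dot.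
  by apply: measurable_lt; exact: measurable_gap.
apply/eqP; rewrite eq_le measure_ge0 andbT -h -(lebesgue_Rn_refl nu1 lam0 mH).
have mR : measurable (refl nu lam0 @^-1` [set y | lam0 <= dot y nu /\ gap u nu lam0 y < 0]).
  by rewrite -[X in measurable X]setTI; exact: (measurable_refl nu lam0).
apply: le_measure; rewrite ?inE//.
  apply: measurableI; first exact: measurable_eball.
  exact: measurable_neq0.
move=> y [/= yB uy]; have [_ RyB yl] := far_cap lam00 yB.
split; first by rewrite (dot_refl nu1); lra.
rewrite gap_refl// oppr_lt0 /gap (uB RyB) subr0.
by rewrite lt_neqAle eq_sym uy; have /andP[] := u0 y.
Qed.

(** Otherwise [u] would vanish on the far cap, up to a null set on which it is modified, and [vanishing_on_ball] would
make it trivial. *)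
Lemma gap_negative lam0 : 0 < lam0 ->
  mu [set y | lam0 <= dot y nu /\ gap u nu lam0 y < 0] != 0%E.
Proof.
move=> lam00; apply/eqP => /(no_gap_vanish lam00).
set r := far_cap_radius lam0; set z := far_cap_center lam0; move=> Z0.
have r0 : 0 < r by rewrite divr_gt0// lt_min lam00 ltr01.
pose v x := u x * \1_(~` eball z r) x.
have mB : measurable (eball z r) by exact: measurable_eball.
have vm : measurable_fun setT v.
  apply: measurable_funM => //; apply: measurable_indic; exact: measurableC.
have v_in x : eball z r x -> v x = 0 by move=> xB; rewrite /v indicE memNset ?mulr0//; exact.
have v_out x : ~ eball z r x -> v x = u x by move=> xB; rewrite /v indicE mem_set ?mulr1.
have v0 x : 0 <= v x <= M.
  have [xB|xB] := pselect (eball z r x); first by rewrite v_in// lexx ltW.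
  by rewrite v_out.
have mZ : measurable [set y | eball z r y /\ u y != 0] by apply: measurableI => //; exact: measurable_neq0.
have uv : {ae mu, forall x, u x = v x}.
  exists [set y | eball z r y /\ u y != 0]; split => // x /= h.
  have [xB|xB] := pselect (eball z r x); last by exfalso; apply: h; rewrite v_out.
  by split => //; apply/eqP => ux; apply: h; rewrite v_in.
have vB x : ~ unit_ball x -> v x = 0 by move=> xB; rewrite /v uB// mul0r.
have vE : (\int[mu \x mu]_w energy s p v w < +oo)%E by rewrite -(energy_ae s p um vm uv).
have fu := measurableT_comp fm um; have fv := measurableT_comp fm vm.
have weakv := weak_ae um vm uv fu fv weak.
have zB : eball z r `<=` unit_ball by move=> y yB; have [] := far_cap lam00 yB.
have := vanishing_on_ball p12 f0 vm v0 vB vE weakv r0 zB v_in.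
move=> V0; apply: unz; apply/eqP; rewrite eq_le measure_ge0 andbT.
apply: (@le_trans _ _ (mu ([set x | v x != 0] `|` [set y | eball z r y /\ u y != 0]))).
  apply: le_measure; rewrite ?inE; [exact: measurable_neq0|by apply: measurableU => //; exact: measurable_neq0|].
  move=> x /= ux; have [xB|xB] := pselect (eball z r x); first by right.
  by left; rewrite v_out.
apply: le_trans (measureU2 _ _ _) _ => //; first exact: measurable_neq0.
by rewrite [X in (X + _ <= _)%E]V0 [X in (_ + X <= _)%E]Z0 adde0.
Qed.

(** The lowest position of the hyperplane above which there is no excess has itself no excess, by closedness; if it were
positive, it could be lowered by [no_excess_step], whose hypothesis is [gap_negative]. *)
Lemma no_excess_all lam : 0 <= lam -> no_excess u nu lam.
Proof.
have fu := measurableT_comp fm um.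
pose A := [set l : R | 0 <= l /\ forall lam, l <= lam -> no_excess u nu lam].
have A1 : A 1.
  have [r r0 hr] := no_excess_start s01 p12 M0 Cf0 um u0 uB uE fu fK fL weak nu1.
  by split=> // lam1 h; apply: hr; lra.
have Ane : A !=set0 by exists 1.
pose l0 := inf A.
have l00 : 0 <= l0 by apply: lb_le_inf => // x [].
have above lam1 : l0 < lam1 -> no_excess u nu lam1.
  by move=> /(inf_lt Ane)[l [_ hl] ll]; apply: hl; exact: ltW.
have at0 : no_excess u nu l0.
  apply: (no_excess_closed um u0 uB nu1) => rho rho0; exists (l0 + rho).
    by rewrite addrC addKr gtr0_norm.
  by apply: above; rewrite ltrDl.
have from_l0 lam1 : l0 <= lam1 -> no_excess u nu lam1.
  by rewrite le_eqVlt => /orP[/eqP <-//|]; exact: above.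
suff l0z : l0 = 0 by move=> lam0; apply: from_l0; rewrite l0z.
apply/eqP; rewrite eq_le l00 andbT leNgt; apply/negP => l0pos.
have [e e0 he] := no_excess_step s01 p12 M0 Cf0 um u0 uB uE fu fK fL weak nu1 l0pos at0 (gap_negative l0pos).
have Al : A (Num.max 0 (l0 - e)).
  split; first by rewrite le_max lexx.
  move=> lam1; rewrite ge_max => /andP[h1 h2]; have [h3|/ltW h3] := leP l0 lam1; first exact: from_l0.
  by apply: he => //; rewrite h2.
have : l0 <= Num.max 0 (l0 - e) by apply: ge_inf => //; exists 0 => x [].
by rewrite le_max !leNgt l0pos/= ltrBlDr ltrDl e0.
Qed.

End all_planes.

(** * Means over balls *)
Section averages.
Context {R : realType} {n : nat}.
Local Notation T := (Rn R n).
Local Notation mu := (@lebesgue_Rn R n).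
Variables (u : T -> R) (M : R) (M0 : 0 < M).
Hypotheses (um : measurable_fun setT u) (u0 : forall x, 0 <= u x <= M)
  (uB : forall x, ~ unit_ball x -> u x = 0).
Local Notation o := (mkv (fun=> 0) : T).

Let u_ge0 x : 0 <= u x. Proof. by have /andP[] := u0 x. Qed.

Definition ball_integral (r : R) (x : T) : \bar R :=
  (\int[mu]_y (\1_(eball x r) y * u y)%:E)%E.

Let mball (r : R) (F G : T * T -> T) : measurable_fun setT F -> measurable_fun setT G ->
  measurable_fun setT (fun w => \1_(eball (F w) r) (G w) : R).
Proof.
move=> mF mG; have m := measurable_edist2 mG mF.
rewrite (_ : (fun w => _) = \1_[set w | edist (G w) (F w) < r]).
  by apply: measurable_indic; exact: measurable_lt.
by apply/funext => w; rewrite !indicE; congr (nat_of_bool _)%:R; apply/idP/idP; rewrite !inE.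
Qed.

Let mball1 (r : R) (x : T) : measurable_fun setT (fun y => \1_(eball x r) y : R).
Proof. by apply: measurable_indic; exact: measurable_eball. Qed.

Lemma ball_integral_ge0 r x : (0 <= ball_integral r x)%E.
Proof. by apply: integral_ge0 => y _; rewrite lee_fin mulr_ge0. Qed.

Lemma ball_integral_bound r x : (ball_integral r x <= M%:E * mu (eball o r))%E.
Proof.
have M0' : (0 <= M%:E)%E by rewrite lee_fin ltW.
have mI : measurable_fun setT (fun y => (\1_(eball x r) y)%:E : \bar R).
  by apply/measurable_EFinP; exact: mball1.
have I0 y : (0%E <= (\1_(eball x r) y)%:E :> \bar R)%E by rewrite lee_fin.
rewrite -(lebesgue_Rn_eball x) -[X in mu X]setIT -integral_indic//; last exact: measurable_eball.
rewrite -(ge0_integralZl_EFin _ measurableT (fun y _ => I0 y) mI (ltW M0)).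
apply: ge0_le_integral => //.
- by move=> y _; rewrite lee_fin mulr_ge0.
- by apply/measurable_EFinP; apply: measurable_funM => //; exact: mball1.
- exact: measurable_funeM.
- move=> y _; rewrite -EFinM lee_fin mulrC; apply: ler_wpM2r => //.
  by have /andP[] := u0 y.
Qed.

Lemma fin_ball_integral r x : ball_integral r x \is a fin_num.
Proof.
rewrite ge0_fin_numE ?ball_integral_ge0//; apply: le_lt_trans (ball_integral_bound r x) _.
by rewrite -(fineK (fin_eball o r)) -EFinM ltry.
Qed.

Let indic_refl (nu : T) (lam r : R) x y z : dot nu nu = 1 -> refl nu lam x = y ->
  \1_(eball x r) (refl nu lam z) = \1_(eball y r) z :> R.
Proof.
move=> nu1 <-; rewrite !indicE; congr (nat_of_bool _)%:R.
by apply/idP/idP; rewrite !inE /eball/= -(edist_refl nu1 lam) (reflK nu1).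
Qed.

Hypothesis planes : forall nu lam, dot nu nu = 1 -> 0 <= lam -> no_excess u nu lam.

(** The reflection exchanging [x] and [y] has a hyperplane that does not separate the origin from the point closer to
it, so reflecting does not decrease [u] on the far side. Pairing each point with its mirror image compares the
integrals over the two balls. *)
Lemma ball_integral_le r x y : enorm y <= enorm x -> (ball_integral r x <= ball_integral r y)%E.
Proof.
move=> yx; have [->//|xy] := pselect (x = y).
have d0 := edist_gt0 xy; set d := edist x y in d0.
pose nu := vscale d^-1 (vsub x y).
have dd : dot (vsub x y) (vsub x y) = d ^+ 2 by rewrite -enorm2.
have nu1 : dot nu nu = 1 by rewrite dotZl dotZr dd expr2; field; rewrite gt_eqF.
pose lam := (dot x nu + dot y nu) / 2.
have xn a : dot a nu = d^-1 * (dot a x - dot a y) by rewrite dotZr dotBr.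
have lamE : lam = (2 * d)^-1 * (dot x x - dot y y).
  by rewrite /lam !xn (dotC y x); field; rewrite gt_eqF.
have lam0 : 0 <= lam.
  rewrite lamE mulr_ge0 ?invr_ge0 ?mulr_ge0 ?(ltW d0)// subr_ge0.
  by rewrite -le_enorm.
have xl : lam <= dot x nu.
  rewrite /lam -subr_ge0.
  have -> : dot x nu - (dot x nu + dot y nu) / 2 = d / 2.
    have : dot x nu - dot y nu = d.
      by rewrite -dotBl dotZr dd expr2 mulrA mulVf ?mul1r// gt_eqF.
    by move=> e; rewrite -[in RHS]e; field.
  by apply: divr_ge0 => //; exact: ltW.
have Rx : refl nu lam x = y.
  apply: vecP => i; rewrite !co_mkv.
  have -> : 2 * (lam - dot x nu) = - d.
    have <- : dot x nu - dot y nu = d.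
      by rewrite -dotBl dotZr dd expr2 mulrA mulVf ?mul1r// gt_eqF.
    by rewrite /lam; field.
  by field; rewrite gt_eqF.
have Ry : refl nu lam y = x by rewrite -Rx (reflK nu1).
pose bx z : R := \1_(eball x r) z; pose b_y z : R := \1_(eball y r) z.
pose v z := u (refl nu lam z).
have mR := measurable_refl nu lam.
have vm : measurable_fun setT v := measurableT_comp um mR.
have b0 (z w : T) : 0 <= \1_(eball z r) w :> R by [].
have m1 : measurable_fun setT (fun z => (bx z * u z)%:E : \bar R).
  by apply/measurable_EFinP; apply: measurable_funM => //; exact: mball1.
have m2 : measurable_fun setT (fun z => (b_y z * u z)%:E : \bar R).
  by apply/measurable_EFinP; apply: measurable_funM => //; exact: mball1.
have m3 : measurable_fun setT (fun z => (b_y z * v z)%:E : \bar R).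
  by apply/measurable_EFinP; apply: measurable_funM => //; exact: mball1.
have m4 : measurable_fun setT (fun z => (bx z * v z)%:E : \bar R).
  by apply/measurable_EFinP; apply: measurable_funM => //; exact: mball1.
have p1 z : (0%E <= (bx z * u z)%:E :> \bar R)%E by rewrite lee_fin mulr_ge0.
have p2 z : (0%E <= (b_y z * u z)%:E :> \bar R)%E by rewrite lee_fin mulr_ge0.
have p3 z : (0%E <= (b_y z * v z)%:E :> \bar R)%E by rewrite lee_fin mulr_ge0// /v.
have p4 z : (0%E <= (bx z * v z)%:E :> \bar R)%E by rewrite lee_fin mulr_ge0// /v.
have E3 : (\int[mu]_z (b_y z * v z)%:E = ball_integral r x)%E.
  rewrite -(ge0_integral_refl nu1 lam m3 p3); apply: eq_integral => z _; congr EFin.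
  by rewrite /b_y (indic_refl _ _ nu1 Ry) /v (reflK nu1).
have E4 : (\int[mu]_z (bx z * v z)%:E = ball_integral r y)%E.
  rewrite -(ge0_integral_refl nu1 lam m4 p4); apply: eq_integral => z _; congr EFin.
  by rewrite /bx (indic_refl _ _ nu1 Rx) /v (reflK nu1).
have le2 : (ball_integral r x + ball_integral r x <= ball_integral r y + ball_integral r y)%E.
  rewrite -[X in (_ + X <= _)%E]E3 -[X in (_ <= _ + X)%E]E4.
  rewrite -(ge0_integralD _ measurableT (fun z _ => p1 z) m1 (fun z _ => p3 z) m3).
  rewrite -(ge0_integralD _ measurableT (fun z _ => p2 z) m2 (fun z _ => p4 z) m4).
  have mL := emeasurable_funD m1 m3; have mRr := emeasurable_funD m2 m4.
  apply: (ae_ge0_le_integral measurableT _ mL _ mRr).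
  - by move=> z _; exact: adde_ge0.
  - by move=> z _; exact: adde_ge0.
  exists [set z | excess u nu lam z != 0]; split; first exact: measurable_neq0 (measurable_excess um nu lam).
    exact: planes.
  move=> z /= h; apply/eqP => ez; apply: h => _; rewrite -!EFinD lee_fin.
  have key : 0 <= (bx z - b_y z) * (v z - u z).
    have [zl|zl] := leP lam (dot z nu).
      apply: mulr_ge0; last first.
        rewrite subr_ge0 -subr_le0 -/(gap u nu lam z); move: ez; rewrite /excess zl.
        by case: leP => // g0 /eqP; rewrite gt_eqF.
      rewrite subr_ge0 /bx /b_y !indicE ler_nat leq_eqVlt.
      have [zy|zy] := boolP (z \in eball y r); last by case: (_ \in _).
      rewrite (_ : z \in eball x r)// inE /eball/=; move: zy; rewrite inE /eball/=.
      apply: le_lt_trans; rewrite -Rx edistC (edistC z) -edist_reflr//.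
      by rewrite edist_reflr//; apply: le_trans (edist_le_refl nu1 xl zl) _; rewrite edist_reflr.
    apply: mulr_le0; last first.
      rewrite subr_le0 -subr_ge0 -/(gap u nu lam z); move: ez; rewrite /excess leNgt zl/=.
      by case: leP => // g0 ez; rewrite ?ez//; move: g0; rewrite ?ez ?ltxx.
    rewrite subr_le0 /bx /b_y !indicE ler_nat leq_eqVlt.
    have [zx|zx] := boolP (z \in eball x r); last by case: (_ \in _).
    rewrite (_ : z \in eball y r)// inE /eball/=; move: zx; rewrite inE /eball/=.
    apply: le_lt_trans; rewrite -Rx edistC (edistC z) -edist_reflr//.
    have zl' : lam <= dot (refl nu lam z) nu by rewrite (dot_refl nu1) lerBrDr mulr_natl mulr2n lerD2l ltW.
    by have := edist_le_refl nu1 xl zl'; rewrite (reflK nu1).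
  by move: key; lra.
move: le2 (fin_ball_integral r x) (fin_ball_integral r y).
case: (ball_integral r x) => // a; case: (ball_integral r y) => // b.
by rewrite -!EFinD !lee_fin => h _ _; lra.
Qed.

Definition ball_mean r x : R := fine (ball_integral r x) / fine (mu (eball o r)).

Let vol_gt0 r : 0 < r -> 0 < fine (mu (eball o r)).
Proof. by move=> r0; rewrite fine_gt0// eball_gt0//= eball_lty. Qed.

Lemma ball_mean_le r x y : 0 < r -> enorm y <= enorm x -> ball_mean r x <= ball_mean r y.
Proof.
move=> r0 yx; apply: ler_wpM2r; first by rewrite invr_ge0 ltW// vol_gt0.
by apply: fine_le; rewrite ?fin_ball_integral//; exact: ball_integral_le.
Qed.

Lemma ball_mean_ge0 r x : 0 < r -> 0 <= ball_mean r x.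
Proof. by move=> r0; rewrite divr_ge0// fine_ge0// ball_integral_ge0. Qed.

Lemma ball_mean_leM r x : 0 < r -> ball_mean r x <= M.
Proof.
move=> r0; rewrite ler_pdivrMr ?vol_gt0//.
have := ball_integral_bound r x.
by rewrite -(fineK (fin_ball_integral r x)) -(fineK (fin_eball o r)) -EFinM lee_fin.
Qed.

Lemma measurable_ball_mean r : measurable_fun setT (ball_mean r).
Proof.
apply: measurable_funM => //.
have mg : measurable_fun setT (fun w : T * T => (\1_(eball w.1 r) w.2 * u w.2)%:E : \bar R).
  apply/measurable_EFinP; apply: measurable_funM; first by apply: mball.
  exact: (measurableT_comp um measurable_snd).
have g0 (w : T * T) : (0%E <= (\1_(eball w.1 r) w.2 * u w.2)%:E :> \bar R)%E by rewrite lee_fin mulr_ge0.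
have mF : measurable_fun setT (ball_integral r) :=
  @measurable_fun_fubini_tonelli_F _ _ _ _ _ mu _ mg g0.
exact: (measurableT_comp (@fine_measurable R setT measurableT) mF).
Qed.

Let vaddC (x y : T) : vadd x y = vadd y x.
Proof. by apply: vecP => i; rewrite !co_mkv addrC. Qed.

Let jump (x h : T) := `|u (vadd x h) - u x|.

Let jump_ge0 x h : 0 <= jump x h. Proof. exact: normr_ge0. Qed.

Let mjump2 : measurable_fun setT (fun w : T * T => jump w.1 w.2).
Proof.
apply: (measurableT_comp (@normr_measurable R setT)); apply: measurable_funB.
  by apply: (measurableT_comp um); apply: measurable_vadd.
exact: (measurableT_comp um measurable_fst).
Qed.

(** The volume of the ball times the mean jump of [u] under translations by its points. *)
Let dev r x := (\int[mu]_h (\1_(eball o r) h * jump x h)%:E)%E.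

Let mdev2 r : measurable_fun setT (fun w : T * T => (\1_(eball o r) w.2 * jump w.1 w.2)%:E : \bar R).
Proof.
apply/measurable_EFinP; apply: measurable_funM; last exact: mjump2.
exact: (measurableT_comp (mball1 r o) measurable_snd).
Qed.

Let dev2_ge0 r x h : (0%E <= (\1_(eball o r) h * jump x h)%:E :> \bar R)%E.
Proof. by rewrite lee_fin mulr_ge0. Qed.

Let mdev1 r x : measurable_fun setT (fun h => (\1_(eball o r) h * jump x h)%:E : \bar R).
Proof. exact: (measurableT_comp (mdev2 r) (measurable_pair1 x)). Qed.

Let ball_integral_shift r x :
  ball_integral r x = (\int[mu]_h (\1_(eball o r) h * u (vadd x h))%:E)%E.
Proof.
have m1 : measurable_fun setT (fun y => (\1_(eball x r) y * u y)%:E : \bar R).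
  by apply/measurable_EFinP; apply: measurable_funM => //; exact: mball1.
have p1 y : (0%E <= (\1_(eball x r) y * u y)%:E :> \bar R)%E by rewrite lee_fin mulr_ge0.
have tr (A : set T) : measurable A ->
    (mu ((vadd^~ x) @^-1` A) = (1%:nng : {nonneg R})%:num%:E * mu A)%E.
  by move=> mA; rewrite mul1e lebesgue_Rn_translate.
have H := ge0_integral_comp (measurable_translation x) tr m1 p1.
rewrite mul1e in H; rewrite /ball_integral -H.
apply: eq_integral => h _; rewrite (vaddC x); congr (EFin (_ * _)).
rewrite !indicE; congr (nat_of_bool _)%:R.
rewrite -(eball_translate x r); by apply/idP/idP; rewrite !inE.
Qed.

Let ball_mean_dev r x : 0 < r ->
  ((`|ball_mean r x - u x| * fine (mu (eball o r)))%:E <= dev r x)%E.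
Proof.
move=> r0; have V0 := vol_gt0 r0; set V := fine _ in V0 *.
have VE : V%:E = mu (eball o r) by rewrite /V fineK// fin_eball.
have mI : measurable_fun setT (fun y => (\1_(eball o r) y)%:E : \bar R).
  by apply/measurable_EFinP; exact: mball1.
have I0 y : (0%E <= (\1_(eball o r) y)%:E :> \bar R)%E by rewrite lee_fin.
have uV : ((u x * V)%:E = \int[mu]_h (u x * \1_(eball o r) h)%:E)%E.
  under eq_integral do rewrite EFinM.
  rewrite (ge0_integralZl_EFin _ measurableT (fun y _ => I0 y) mI (u_ge0 x)).
  rewrite integral_indic//; last exact: measurable_eball.
  by rewrite setIT EFinM VE.
have muV : measurable_fun setT (fun h => (u x * \1_(eball o r) h)%:E : \bar R).
  by apply/measurable_EFinP; apply: measurable_funM => //; exact: mball1.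
have uV0 h : (0%E <= (u x * \1_(eball o r) h)%:E :> \bar R)%E by rewrite lee_fin mulr_ge0.
have mA : measurable_fun setT (fun h => (\1_(eball o r) h * u (vadd x h))%:E : \bar R).
  apply/measurable_EFinP; apply: measurable_funM; first exact: mball1.
  under eq_fun do rewrite vaddC.
  exact: (measurableT_comp um (measurable_translation x)).
have A0 h : (0%E <= (\1_(eball o r) h * u (vadd x h))%:E :> \bar R)%E by rewrite lee_fin mulr_ge0.
have AV : ball_integral r x = (ball_mean r x * V)%:E.
  by rewrite /ball_mean divfK ?gt_eqF// fineK// fin_ball_integral.
have le1 : (ball_integral r x <= (u x * V)%:E + dev r x)%E.
  rewrite uV ball_integral_shift.
  rewrite -(ge0_integralD _ measurableT (fun y _ => uV0 y) muV (fun y _ => dev2_ge0 r x y) (mdev1 r x)).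
  apply: (ge0_le_integral _ measurableT (fun y _ => A0 y) mA (emeasurable_funD muV (mdev1 r x))).
  move=> h _; rewrite -EFinD lee_fin (mulrC (u x)) -mulrDr; apply: ler_wpM2l => //.
  by rewrite /jump -lerBlDl; exact: ler_norm.
have le2 : ((u x * V)%:E <= ball_integral r x + dev r x)%E.
  rewrite uV ball_integral_shift.
  rewrite -(ge0_integralD _ measurableT (fun y _ => A0 y) mA (fun y _ => dev2_ge0 r x y) (mdev1 r x)).
  apply: (ge0_le_integral _ measurableT (fun y _ => uV0 y) muV (emeasurable_funD mA (mdev1 r x))).
  move=> h _; rewrite -EFinD lee_fin (mulrC (u x)) -mulrDr; apply: ler_wpM2l => //.
  by rewrite /jump -lerBlDl distrC; exact: ler_norm.
have dev0 : (0 <= dev r x)%E by apply: integral_ge0 => h _; exact: dev2_ge0.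
move: le1 le2 dev0; rewrite AV; case: (dev r x) => [D|_ _ _|_ _]; last by rewrite leeNy_eq.
- move=> + + _; rewrite -!EFinD !lee_fin => h1 h2; rewrite -(ger0_norm (ltW V0)) -normrM ler_norml.
  by apply/andP; split; lra.
- by rewrite leey.
Qed.

(** The translation by [h] changes a bounded function of bounded support by at most a small amount, except on a small
set. *)
Let shift_L1 (e : R) : 0 < e -> exists2 r, 0 < r & forall h, enorm h <= r ->
  (\int[mu]_x (jump x h)%:E <= e%:E)%E.
Proof.
move=> e0; pose Q := centered_box 2 : set T.
have mQ : measurable Q by exact: measurable_box.
have Qf : mu Q \is a fin_num by rewrite ge0_fin_numE ?measure_ge0// centered_box_lty.
pose q := fine (mu Q); have q0 : 0 <= q by rewrite fine_ge0.
pose delta := e / (2 * (q + 1)).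
have d0 : 0 < delta by rewrite divr_gt0// mulr_gt0// ltr_wpDl.
have eM : 0 < e / (2 * M) by rewrite divr_gt0// mulr_gt0.
have [r r0 hr] := shift_continuity_in_measure um u0 uB d0 eM.
exists (Num.min r 1); first by rewrite lt_min r0 ltr01.
move=> h; rewrite le_min => /andP[hhr hh1].
pose J := [set x | delta < jump x h].
have mJ : measurable J by exact: measurable_shift_gap.
have mjh : measurable_fun setT (fun x => (jump x h)%:E : \bar R).
  by apply/measurable_EFinP; exact: (measurableT_comp mjump2 (measurable_pair2 h)).
have m1 : measurable_fun setT (fun x => (delta * \1_Q x)%:E : \bar R).
  by apply/measurable_EFinP; apply: measurable_funM => //; exact: measurable_indic.
have m2 : measurable_fun setT (fun x => (M * \1_J x)%:E : \bar R).
  by apply/measurable_EFinP; apply: measurable_funM => //; exact: measurable_indic.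
have p1 x : (0%E <= (delta * \1_Q x)%:E :> \bar R)%E by rewrite lee_fin mulr_ge0// ltW.
have p2 x : (0%E <= (M * \1_J x)%:E :> \bar R)%E by rewrite lee_fin mulr_ge0// ltW.
have scaled (k : R) (A : set T) : 0 <= k -> measurable A -> (\int[mu]_x (k * \1_A x)%:E = k%:E * mu A)%E.
  move=> k0 mA; under eq_integral do rewrite EFinM.
  rewrite ge0_integralZl_EFin//; last by apply/measurable_EFinP; exact: measurable_indic.
  by rewrite integral_indic// setIT.
apply: (@le_trans _ _ (\int[mu]_x ((delta * \1_Q x)%:E + (M * \1_J x)%:E))%E).
  apply: (ge0_le_integral _ measurableT _ mjh (emeasurable_funD m1 m2)).
    by move=> x _; rewrite lee_fin.
  move=> x _; rewrite -EFinD lee_fin; have [xJ|xJ] := pselect (J x).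
    have -> : \1_J x = 1 :> R by rewrite indicE mem_set.
    rewrite mulr1 ler_wpDl//; first by rewrite mulr_ge0// ltW.
    rewrite /jump ler_norml; have /andP[? ?] := u0 x; have /andP[? ?] := u0 (vadd x h).
    by apply/andP; split; lra.
  have -> : \1_J x = 0 :> R by rewrite indicE memNset.
  rewrite mulr0 addr0.
  have jd : jump x h <= delta by rewrite leNgt; apply/negP.
  have [xQ|xQ] := pselect (Q x); first by rewrite indicE mem_set// mulr1.
  rewrite indicE memNset// mulr0 /jump.
  have nx : ~ unit_ball x.
    by move=> xB; apply: xQ; apply: unit_ball_box xB; lra.
  have nxh : ~ unit_ball (vadd x h).
    move=> xhB; apply: xQ => i /=; have := @unit_ball_box R n 1 (lexx _) _ xhB i.
    have := coord_small_enorm hh1 i.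
    rewrite /= !in_itv/= -!/(co _ i) co_mkv ler_norml => /andP[? ?] /andP[? ?].
    by apply/andP; split; lra.
  by rewrite (uB nx) (uB nxh) subrr normr0.
rewrite (ge0_integralD _ measurableT (fun x _ => p1 x) m1 (fun x _ => p2 x) m2).
rewrite (scaled _ _ (ltW d0) mQ) (scaled _ _ (ltW M0) mJ).
have := hr h hhr; rewrite -/J => Jle.
apply: (@le_trans _ _ ((delta * q)%:E + (M * (e / (2 * M)))%:E)%E).
  apply: leeD; first by rewrite -(fineK Qf) -EFinM.
  by rewrite EFinM; apply: lee_wpmul2l => //; rewrite lee_fin ltW.
rewrite -EFinD lee_fin.
have -> : M * (e / (2 * M)) = e / 2 by field; rewrite gt_eqF.
have : delta * q <= e / 2.
  rewrite /delta mulrAC ler_pdivrMr; last by rewrite mulr_gt0// ltr_wpDl.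
  have := mulr_ge0 (ltW e0) q0; lra.
lra.
Qed.

Let dev_integral (e : R) : 0 < e -> exists2 r, 0 < r &
  (\int[mu]_x dev r x <= (e * fine (mu (eball o r)))%:E)%E.
Proof.
move=> e0; have [r r0 hr] := shift_L1 e0; exists r => //.
rewrite /dev (@fubini_tonelli _ _ _ _ _ mu mu _ (mdev2 r)); last by move=> w; exact: dev2_ge0.
have mI : measurable_fun setT (fun y => (\1_(eball o r) y)%:E : \bar R).
  by apply/measurable_EFinP; exact: mball1.
have I0 y : (0%E <= (\1_(eball o r) y)%:E :> \bar R)%E by rewrite lee_fin.
rewrite EFinM (fineK (fin_eball o r)).
rewrite -[X in (_ <= _ * mu X)%E]setIT -integral_indic//; last exact: measurable_eball.
rewrite -(ge0_integralZl_EFin _ measurableT (fun y _ => I0 y) mI (ltW e0)).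
have mG := @measurable_fun_fubini_tonelli_G _ _ _ _ _ mu _ (mdev2 r) (fun w => dev2_ge0 r w.1 w.2).
apply: (ge0_le_integral _ measurableT _ mG (measurable_funeM _ mI)).
  by move=> h _; apply: integral_ge0 => x _; exact: dev2_ge0.
move=> h _; rewrite /fubini_G /=.
have [hB|hB] := pselect (eball o r h).
  rewrite indicE mem_set// mule1; under eq_integral do rewrite mul1r.
  apply: hr; apply: ltW; move: hB; rewrite /eball/= edistE; congr (enorm _ < _).
  by apply: vecP => i; rewrite !co_mkv subr0.
rewrite indicE memNset// mule0; under eq_integral do rewrite mul0r.
by rewrite integral0.
Qed.

(** The deviation of the mean from [u] is at most the mean of the jumps of [u] under small translations, whose integral
is small; Markov's inequality converts this to a bound in measure. *)
Lemma ball_mean_near (t e : R) : 0 < t -> 0 < e -> exists2 r, 0 < r &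
  (mu [set x | (t < `|ball_mean r x - u x|)%R] <= e%:E)%E.
Proof.
move=> t0 e0; have te0 : 0 < t * e by exact: mulr_gt0.
have [r r0 hr] := dev_integral te0; exists r => //.
have V0 := vol_gt0 r0; set V := fine _ in V0 hr.
pose E := [set x | t < `|ball_mean r x - u x|].
have mE : measurable E.
  apply: measurable_gt; apply: (measurableT_comp (@normr_measurable R setT)).
  by apply: measurable_funB => //; exact: measurable_ball_mean.
have mI : measurable_fun setT (fun y => (\1_E y)%:E : \bar R).
  by apply/measurable_EFinP; exact: measurable_indic.
have I0 y : (0%E <= (\1_E y)%:E :> \bar R)%E by rewrite lee_fin.
have tV0 : 0 < t * V by exact: mulr_gt0.
have mD := @measurable_fun_fubini_tonelli_F _ _ _ _ _ mu _ (mdev2 r) (fun w => dev2_ge0 r w.1 w.2).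
have key : ((t * V)%:E * mu E <= (t * e * V)%:E)%E.
  apply: le_trans hr; rewrite -[X in mu X]setIT -integral_indic//.
  rewrite -(ge0_integralZl_EFin _ measurableT (fun y _ => I0 y) mI (ltW tV0)).
  apply: (ge0_le_integral _ measurableT _ (measurable_funeM _ mI) mD).
    by move=> x _; rewrite mule_ge0// lee_fin ltW.
  move=> x _; have [xE|xE] := pselect (E x).
    rewrite indicE mem_set// mule1; apply: le_trans (ball_mean_dev x r0).
    by rewrite lee_fin ler_wpM2r// ltW.
  by rewrite indicE memNset// mule0; apply: integral_ge0 => h _; exact: dev2_ge0.
move: key; rewrite (_ : t * e * V = t * V * e); last by ring.
by rewrite (EFinM (t * V) e) lee_pmul2l// lte_fin.
Qed.

End averages.

(** * The radial representative *)

(** Means over balls inherit radial monotonicity from the reflection inequalities for every single pair of points, while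
[u] itself satisfies them only almost everywhere; the limit superior along a sequence of radii keeps the inequalities
and recovers [u] almost everywhere. *)
Lemma radial_representative (R : realType) (n : nat) (u : Rn R n -> R) (M : R) :
  0 < M -> measurable_fun setT u -> (forall x, 0 <= u x <= M) ->
  (forall x, ~ unit_ball x -> u x = 0) ->
  (forall nu lam, dot nu nu = 1 -> 0 <= lam -> no_excess u nu lam) ->
  exists v : Rn R n -> R, {ae lebesgue_Rn n, forall x, u x = v x} /\
    forall x y, enorm x <= enorm y -> v y <= v x.
Proof.
move=> M0 um u0 uB planes; pose mu := @lebesgue_Rn R n.
have tk (k : nat) : 0 < k.+1%:R^-1 :> R by rewrite invr_gt0.
have ek (k : nat) : 0 < 1 / (2 ^ k.+1)%:R :> R by rewrite divr_gt0// ltr0n expn_gt0.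
pose rad k := sval (cid2 (ball_mean_near M0 um u0 uB (tk k) (ek k))).
have rad0 k : 0 < rad k by rewrite /rad; case: cid2.
pose F k := [set x | k.+1%:R^-1 < `|ball_mean u (rad k) x - u x|].
have Fle k : (mu (F k) <= (1 / (2 ^ k.+1)%:R)%:E)%E by rewrite /F /rad; case: cid2.
have mF k : measurable (F k).
  apply: measurable_gt; apply: (measurableT_comp (@normr_measurable R setT)).
  by apply: measurable_funB => //; exact: (measurable_ball_mean um u0).
have F0 : mu (lim_sup_set F) = 0%E.
  apply: (lim_sup_set_cvg0 mF); apply: (@le_lt_trans _ _ 1%:E); last exact: ltry.
  apply: le_trans (epsilon_trick0 xpredT (@ler01 R)).
  by apply: lee_nneseries => [k _ _|k _]; [exact: measure_ge0|exact: Fle].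
pose w x k : \bar R := (ball_mean u (rad k) x)%:E.
pose v x := fine (limn_esup (w x)).
have w0 x k : (0 <= w x k <= M%:E)%E.
  by rewrite !lee_fin (ball_mean_ge0 u0 _ (rad0 k)) (ball_mean_leM M0 um u0 _ (rad0 k)).
have esup_le x y : (forall k, w x k <= w y k)%E -> (limn_esup (w x) <= limn_esup (w y))%E.
  move=> h; rewrite /limn_esup /limf_esup; apply: le_ereal_inf_tmp => _ [V FV <-].
  apply: ge_ereal_inf; exists (ereal_sup (w x @` V)); first by exists V.
  apply: ge_ereal_sup => _ [k Vk <-]; apply: le_trans (h k) _.
  by apply: ereal_sup_ubound; exists k.
have fin x : limn_esup (w x) \is a fin_num.
  rewrite ge0_fin_numE.
    apply: (@le_lt_trans _ _ M%:E); last exact: ltry.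
    apply: (@le_trans _ _ (ereal_sup (w x @` setT))).
      by apply: ereal_inf_lbound; exists setT => //; exact: filterT.
    by apply: ge_ereal_sup => _ [k _ <-]; have /andP[] := w0 x k.
  have wx0 k : (0 <= w x k)%E by have /andP[] := w0 x k.
  by apply: (limf_esup_ge0 _ wx0) => -[N _ /(_ N (leqnn N))].
exists v; split.
  exists (lim_sup_set F); split=> //.
    by apply: bigcap_measurable => // k _; exact: bigcup_measurable.
  move=> x /= ux; apply: contrapT => xF; apply: ux.
  have : w x @ \oo --> (u x)%:E.
    apply: cvg_EFin; first by apply: nearW.
    apply/cvgrPdist_le => e e0.
    have [N _ hN] : exists2 N, True & forall k, (N <= k)%N -> ~ F k x.
      apply: contrapT => h; apply: xF => N _; apply: contrapT => h'; apply: h.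
      by exists N => // k Nk Fk; apply: h'; exists k.
    near=> k; rewrite /w/= distrC; apply: le_trans (_ : k.+1%:R^-1 <= _).
      by rewrite leNgt; apply/negP/hN; near: k; exists N.
    by apply: ltW; near: k; exact: near_infty_natSinv_lt (PosNum e0).
  by move=> /cvg_limn_einf_sup[_]; rewrite /v => ->.
move=> x y xy; apply: (fine_le (fin y) (fin x)); apply: esup_le => k.
rewrite lee_fin; exact: (ball_mean_le M0 um u0 planes (rad0 k) xy).
Unshelve. all: by end_near. Qed.

(** * Reduction to a bounded function and a Lipschitz reaction *)

(** Local Lipschitz constants hold near every pair of points, not only near the diagonal; compactness of the square
gives a common one. *)
Lemma locally_lipschitz_segment (R : realType) (f : R -> R) (m M : R) :
  [locally [lipschitz f x | x in [set: R]]] -> exists2 C, 0 < C &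
    forall a b, m <= a <= M -> m <= b <= M -> `|f a - f b| <= C * `|a - b|.
Proof.
move=> flip; pose S := `[m, M]%classic `*` `[m, M]%classic : set (R * R).
have cS : compact S by apply: compact_setX; exact: segment_compact.
have := (proj1 (compact_near_coveringP S)) cS R (+oo%R : set_system R)
  (fun C w => `|f w.1 - f w.2| <= C * `|w.1 - w.2|) _.
case=> [[a b] _|C [_ hC]].
  have /pinfty_ex_gt0[C C0 hC] := flip (a, b) (conj I I).
  exists ([set w | `|f w.1 - f w.2| <= C * `|w.1 - w.2|], [set D | C <= D]).
    split; last by apply: nbhs_pinfty_ge; exact: num_real.
    have hab : nbhs (a, b) [set w : R * R | ([set: R] `*` [set: R]) w -> `|f w.1 - f w.2| <= C * `|w.1 - w.2|] := hC.
    by apply: filterS hab => w; apply.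
  by move=> [w D] /= [hw CD]; apply: le_trans hw _; apply: ler_wpM2r.
exists (Num.max C 0 + 1); first by rewrite ltr_wpDl// le_max lexx orbT.
move=> x y x0 y0; apply: (hC _ _ (x, y)); last by split; rewrite /= in_itv.
by rewrite (@le_lt_trans _ _ (Num.max C 0)) ?le_max ?lexx// ltrDl.
Qed.

Lemma locally_lipschitz_measurable (R : realType) (f : R -> R) :
  [locally [lipschitz f x | x in [set: R]]] -> measurable_fun [set: measurableTypeR R] f.
Proof.
move=> flip; apply: continuous_measurable_fun => a; apply/cvgrPdist_le => e e0.
have [C C0 hC] := locally_lipschitz_segment (a - 1) (a + 1) flip.
have C1 : 0 < e / C by rewrite divr_gt0.
near=> b; have ab : `|a - b| <= Num.min 1 (e / C).
  near: b; apply: cvgr_dist_le; last by rewrite lt_min ltr01.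
  exact: cvg_id.
move: ab; rewrite le_min => /andP[ab1 abe].
apply: le_trans (hC a b _ _) _.
- by apply/andP; split; lra.
- by move: ab1; rewrite ler_norml => /andP[? ?]; apply/andP; split; lra.
by rewrite mulrC -ler_pdivlMr.
Unshelve. all: by end_near. Qed.

Section bounded_version.
Context {R : realType} {n : nat}.
Local Notation T := (Rn R n).
Local Notation mu := (@lebesgue_Rn R n).

Lemma Linfty_ball_bound (u : T -> R) : Linfty_ball u ->
  exists2 M, 0 < M & {ae mu, forall x, unit_ball x -> `|u x| <= M}.
Proof.
move=> [/andP[_]]; rewrite inE /= /finite_norm unlock /Lnorm.
have -> : (0 < mrestr mu measurable_unit_ball setT)%E.
  by rewrite /mrestr setTI unit_ballE; exact: eball_gt0.
rewrite (_ : abse \o (EFin \o u) = EFin \o (Num.norm \o u))// => /ess_sup_inf.ess_supr_bounded[M [N [mN N0 uN]]].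
exists (Num.max M 1); first by rewrite lt_max ltr01 orbT.
exists (N `&` unit_ball); split => //; first exact: (measurableI _ _ mN measurable_unit_ball).
move=> x /= ux; have xB : unit_ball x by apply: contrapT => h; apply: ux => /h.
split=> //; apply: uN => /= h; apply: ux => _; rewrite le_max; apply/orP; left; exact: h.
Qed.

(** Pointwise bounds, rather than almost everywhere, allow reflections and rescalings of the function to be used without
tracking null sets. *)
Lemma bounded_version (u : T -> R) : measurable_fun setT u -> Linfty_ball u ->
  {ae mu, forall x, ~ unit_ball x -> u x = 0} -> {ae mu, forall x, 0 <= u x} ->
  exists v : T -> R, exists2 M, 0 < M & [/\ measurable_fun setT v, {ae mu, forall x, u x = v x},
    forall x, 0 <= v x <= M & forall x, ~ unit_ball x -> v x = 0].
Proof.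
move=> um /Linfty_ball_bound[M M0 uM] uB u0.
pose v x : R := \1_unit_ball x * Num.max 0 (Num.min (u x) M).
exists v, M => //; split.
- apply: measurable_funM; first by apply: measurable_indic; exact: measurable_unit_ball.
  apply: measurable_maxr; first exact: measurable_cst.
  by apply: measurable_minr; [|exact: measurable_cst].
- near=> x; rewrite /v; have [xB|xB] := pselect (unit_ball x); last first.
    by rewrite indicE memNset// mul0r; move: xB; near: x.
  have uxM : `|u x| <= M by move: xB; near: x.
  have ux0 : 0 <= u x by near: x.
  rewrite indicE mem_set// mul1r min_l; last exact: le_trans (ler_norm _) uxM.
  by rewrite max_r.
- move=> x; rewrite /v indicE; case: (_ \in _); last by rewrite mul0r lexx ltW.
  by rewrite mul1r le_max lexx/= ge_max ltW//= ge_min lexx orbT.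
- by move=> x xB; rewrite /v indicE memNset// mul0r.
Unshelve. all: by end_near. Qed.

End bounded_version.

Theorem theorem1p2 (R : realType) (n : nat) (s p : R) (f : R -> R)
    (u : Rn R n -> R) :
  (2 <= n)%N -> 0 < s < 1 -> 1 < p <= 2 ->
  [locally [lipschitz f x | x in [set: R]]] -> 0 <= f 0 ->
  Wsp0 s p u -> Linfty_ball u ->
  ~ {ae lebesgue_Rn n, forall x, u x = 0} ->
  {ae lebesgue_Rn n, forall x, 0 <= u x} ->
  weak_solution s p f u ->
  exists v : Rn R n -> R,
    [/\ {ae lebesgue_Rn n, forall x, u x = v x},
        radially_symmetric v
      & radially_nonincreasing_in_ball v].
Proof.
move=> _ s01 p12 flip f0 [[uL uE] uB] uoo unz u0 [_ weak].
have um : measurable_fun setT u by move: uL => /andP[]; rewrite inE.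
have fm := locally_lipschitz_measurable flip.
have [w [M M0 [wm uw w0 wB]]] := bounded_version um uoo uB u0.
have [C C0 fC] := locally_lipschitz_segment 0 M flip.
have wE : (\int[lebesgue_Rn n \x lebesgue_Rn n]_z energy s p w z < +oo)%E.
  by rewrite -(energy_ae _ _ um wm uw); exact: uE.
have wweak := weak_ae um wm uw (measurableT_comp fm um) (measurableT_comp fm wm) weak.
have wK x : `|f (w x)| <= `|f 0| + C * M.
  have M00 : 0 <= (0 : R) <= M by rewrite lexx ltW.
  rewrite -[f (w x)](subrK (f 0)) addrC; apply: le_trans (ler_normD _ _) _.
  apply: lerD => //; apply: le_trans (fC _ _ (w0 x) M00) _.
  by rewrite subr0 ler_pM2l//; have /andP[w0x wM] := w0 x; rewrite ger0_norm.
have wnz : lebesgue_Rn n [set x | w x != 0] <> 0%E.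
  move=> w_null; apply: unz; near=> x.
  have -> : u x = w x by near: x.
  near: x; exists [set x | w x != 0]; split=> //; first exact: measurable_neq0.
  by move=> x /= wx; apply/eqP => wx0; apply: wx.
have planes nu lam (nu1 : dot nu nu = 1) (lam0 : 0 <= lam) : no_excess w nu lam.
  exact: (no_excess_all s01 p12 M0 (ltW C0) wm w0 wB wE fm f0 wK (fun x y => fC _ _ (w0 x) (w0 y)) wweak wnz nu1 lam0).
have [v [wv vle]] := radial_representative M0 wm w0 wB planes.
exists v; split.
- near=> x; have -> : u x = w x by near: x.
  by near: x.
- by move=> x y xy; apply/eqP; rewrite eq_le !vle ?xy.
- by move=> x y _ _ xy; exact: vle.
Unshelve. all: by end_near. Qed.
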